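(* Let $\mathcal{M}_{\mathcal{C}}=(\mathbb{R}^2,\nabla^{\mathcal{C}})$ be a Type $\mathcal{A}$ model, with Ricci tensor $\rho$ and curvature tensor $R$. (1) If the Ricci tensor has rank $1$, then: (a) If $\nabla R\neq 0$, then $\mathcal{M}_{\mathcal{C}}$ is essentially geodesically incomplete. (b) The model $\mathcal{M}_2$ is geodesically complete. (c) The model $\mathcal{M}_1$ is geodesically incomplete and essentially geodesically complete. (d) The model $\mathcal{M}_3$ is geodesically incomplete. Let $\tilde{\mathcal{M}}_3$ be the affine surface $\mathbb{R}^2$ with the torsion free connection given by $\Gamma_{22}{}^1=x^1$ and all the remaining Christoffel symbols zero. Then $\tilde{\mathcal{M}}_3$ is modeled on $\mathcal{M}_3$ and is geodesically complete. Thus $\mathcal{M}_3$ is essentially geodesically complete. (2) If the Ricci tensor has rank $2$, then the following conditions are equivalent: (a) $\mathcal{M}_{\mathcal{C}}$ is geodesically incomplete. (b) $\mathcal{M}_{\mathcal{C}}$ is essentially geodesically incomplete. (c) There exists a geodesic of $\mathcal{M}_{\mathcal{C}}$ of the form $\sigma(t)=(a\log t,\,b\log t)$, $t>0$, with $(a,b)\neq(0,0)$. (d) $\mathcal{M}_{\mathcal{C}}$ is not linearly isomorphic to $\mathcal{M}_{-,\delta}$ for any $\delta$ with $0\le\delta<2$. (3) No two distinct models in the family $\{\mathcal{M}_2,\ \mathcal{M}_3\}\cup\{\mathcal{M}_{-,\delta}: 0\le\delta<2\}$ are locally isomorphic.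
   Context: An affine surface is a pair $\mathcal{M}=(M,\nabla)$ with $M$ a (nonempty) smooth $2$-dimensional manifold and $\nabla$ a torsion free connection on $TM$. In local coordinates $(x^1,x^2)$ the Christoffel symbols are defined by $\nabla_{\partial_{x^i}}\partial_{x^j}=\Gamma_{ij}{}^k\partial_{x^k}$ (summation over repeated indices); torsion freeness means $\Gamma_{ij}{}^k=\Gamma_{ji}{}^k$. Let $R(\xi,\eta)=\nabla_\xi\nabla_\eta-\nabla_\eta\nabla_\xi-\nabla_{[\xi,\eta]}$ be the curvature, and let the Ricci tensor be $\rho(\xi,\eta)=\operatorname{Tr}(\sigma\mapsto R(\sigma,\xi)\eta)$. Given real constants $\mathcal{C}=\{C_{ij}{}^k\}_{i,j,k\in\{1,2\}}$ with $C_{ij}{}^k=C_{ji}{}^k$, the Type $\mathcal{A}$ model $\mathcal{M}_{\mathcal{C}}=(\mathbb{R}^2,\nabla^{\mathcal{C}})$ is the affine surface with $\nabla^{\mathcal{C}}_{\partial_{x^i}}\partial_{x^j}=C_{ij}{}^k\partial_{x^k}$. Its Ricci tensor is symmetric with constant components, so it has a well-defined rank. Two Type $\mathcal{A}$ models $\mathcal{M}_{\mathcal{C}}$ and $\mathcal{M}_{\tilde{\mathcal{C}}}$ are linearly isomorphic (equivalently, linearly equivalent) if some $T\in\operatorname{GL}(2,\mathbb{R})$, acting as a linear change of coordinates on $\mathbb{R}^2$, takes $\nabla^{\mathcal{C}}$ to $\nabla^{\tilde{\mathcal{C}}}$; equivalently, $\mathcal{C}$ and $\tilde{\mathcal{C}}$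 lie in the same orbit of the natural action of $\operatorname{GL}(2,\mathbb{R})$ on $S^2((\mathbb{R}^2)^* )\otimes\mathbb{R}^2$. Two affine surfaces are locally isomorphic if there is a diffeomorphism between nonempty open subsets of them which intertwines the two connections (Type $\mathcal{A}$ models are homogeneous, so the choice of points does not matter). An affine surface $(M,\nabla)$ is modeled on $\mathcal{M}_{\mathcal{C}}$ (and is then called a Type $\mathcal{A}$ surface) if $M$ is covered by local coordinate charts in each of which the Christoffel symbols of $\nabla$ are the constants $\Gamma_{ij}{}^k=C_{ij}{}^k$. A geodesic is a curve $\sigma$ with $\nabla_{\dot\sigma}\dot\sigma=0$, i.e. $\ddot x^k+\Gamma_{ij}{}^k\dot x^i\dot x^j=0$ in local coordinates. An affine surface is geodesically complete if every geodesic extends to have domain all of $\mathbb{R}$; otherwise it is geodesically incomplete. The model $\mathcal{M}_{\mathcal{C}}$ is essentially geodesically complete if there exists a geodesically complete affine surface modeled on $\mathcal{M}_{\mathcal{C}}$; otherwise it is essentially geodesically incomplete. The following specific Type $\mathcal{A}$ models are given by listing their nonzero Christoffel symbols $C_{ij}{}^k$ with $i\le j$ (with $C_{ji}{}^k:=C_{ij}{}^k$): - $\mathcal{M}_1$: $C_{11}{}^1=-1$, $C_{12}{}^1=-\frac12$. - $\mathcal{M}_2$: $C_{12}{}^1=-\frac12$. - $\mathcal{M}_3$: $C_{11}{}^1=-1$, $C_{22}{}^1=-1$. - $\mathcal{M}_{-,\delta}$ (for $\delta\ge 0$ real): $C_{11}{}^2=-1$, $C_{12}{}^1=\frac12$,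 $C_{12}{}^2=\frac{\delta}{2}$. The models $\mathcal{M}_1,\mathcal{M}_2,\mathcal{M}_3$ have Ricci tensor of rank $1$. *)

(* Defs.v *)
From HB Require Import structures.
From mathcomp Require Import all_boot all_order all_algebra.
From mathcomp Require Import all_classical all_reals all_analysis.

Set Implicit Arguments.
Unset Strict Implicit.
Unset Printing Implicit Defensive.

Import Order.TTheory GRing.Theory Num.Theory.
Import numFieldNormedType.Exports.
Local Open Scope classical_set_scope.
Local Open Scope ring_scope.

(* The coordinates x^1, x^2 of the literature are [x 0 0] and [x 0 1]; all
   coordinate indices range over 'I_2 and are therefore shifted by one. *)
Definition plane (R : realType) := 'rV[R]_2.

(* [S i j k] is S_{ij}^k. *)
Definition symbols (R : realType) := 'I_2 -> 'I_2 -> 'I_2 -> R.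

Definition christoffel (R : realType) := plane R -> symbols R.

Section Smooth.
Variable R : realType.
Implicit Types (U : set (plane R)) (f : plane R -> R).

Definition coord_vec (i : 'I_2) : plane R := delta_mx 0 i.

Definition partial (i : 'I_2) f : plane R -> R :=
  fun x => 'D_(coord_vec i) f x.

Fixpoint Ck (k : nat) U f : Prop :=
  (forall x, U x -> {for x, continuous f}) /\
  if k is k'.+1 then
    forall i, (forall x, U x -> derivable f x (coord_vec i)) /\
              Ck k' U (partial i f)
  else True.

Definition smooth U f := forall k, Ck k U f.

Definition component (F : plane R -> plane R) (k : 'I_2) : plane R -> R :=
  fun x => F x 0 k.

Definition smooth_map U (F : plane R -> plane R) :=
  forall k, smooth U (component F k).

(* F intertwines the connections with symbols G (source) and G' (target):
   F_* (nabla_{d_i} d_j) = nabla'_{F_* d_i} (F_* d_j), written in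
   coordinates.  When F is a change of coordinates this is the transformation
   law of Christoffel symbols. *)
Definition affine_map U (G G' : christoffel R) (F : plane R -> plane R) :=
  smooth_map U F /\
  forall x, U x -> forall i j k,
    partial i (partial j (component F k)) x +
      \sum_a \sum_b partial i (component F a) x * partial j (component F b) x
                    * G' (F x) a b k
    = \sum_l G x i j l * partial l (component F k) x.

End Smooth.

(* [coord] and [param] are total functions, meaningful on [dom] and [cod]. *)
Record chart (R : realType) (M : topologicalType) := Chart {
  dom : set M;
  cod : set (plane R);
  coord : M -> plane R;
  param : plane R -> M;
  dom_open : open dom;
  cod_open : open cod;
  coord_cod : forall p, dom p -> cod (coord p);
  param_dom : forall x, cod x -> dom (param x);
  coordK : forall p, dom p -> param (coord p) = p;
  paramK : forall x, cod x -> coord (param x) = x;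
  coord_cont : forall p, dom p -> {for p, continuous coord};
  param_cont : forall x, cod x -> {for x, continuous param} }.

(* The map F : M -> N, restricted to U, read in the charts c and d. *)
Definition chart_affine (R : realType) (M N : topologicalType)
    (c : chart R M) (G : christoffel R) (d : chart R N) (G' : christoffel R)
    (U : set M) (F : M -> N) :=
  affine_map
    [set x | [/\ cod c x, U (param c x) & dom d (F (param c x))]]
    G G' (coord d \o F \o param c).

(* A torsion free connection is given by its Christoffel symbols [gamma c] in
   each chart c of the atlas (the values of [gamma] off the atlas are
   irrelevant); [surf_compat] says both that the transition functions are
   smooth and that the symbols obey the transformation law. *)
Record affineSurface (R : realType) := AffineSurface {
  carrier :> topologicalType;
  surf_hausdorff : hausdorff_space carrier;
  surf_countable : @second_countable carrier;
  surf_nonempty : [set: carrier] !=set0;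
  atlas : set (chart R carrier);
  gamma : chart R carrier -> christoffel R;
  atlas_cover : forall p, exists2 c, atlas c & dom c p;
  gamma_smooth : forall c, atlas c ->
    forall i j k, smooth (cod c) (fun x => gamma c x i j k);
  gamma_sym : forall c, atlas c ->
    forall x, cod c x -> forall i j k, gamma c x i j k = gamma c x j i k;
  surf_compat : forall c d, atlas c -> atlas d ->
    chart_affine c (gamma c) d (gamma d) setT id }.

Section AffineSurfaces.
Variable R : realType.
Implicit Types M N : affineSurface R.

(* c belongs to the smooth structure of M, and the Christoffel symbols of the
   connection of M in c are G; c need not be in the given atlas. *)
Definition local_coordinates M (c : chart R M) (G : christoffel R) :=
  forall d, atlas d -> chart_affine c G d (gamma d) setT id /\
                       chart_affine d (gamma d) c G setT id.

Definition affine_on M N (U : set M) (f : M -> N) :=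
  (forall p, U p -> {for p, continuous f}) /\
  forall c d, atlas c -> atlas d -> chart_affine c (gamma c) d (gamma d) U f.

Definition locally_isomorphic M N :=
  exists (U : set M) (V : set N) (f : M -> N) (g : N -> M),
    [/\ open U /\ open V, U !=set0,
        (forall p, U p -> V (f p) /\ g (f p) = p),
        (forall q, V q -> U (g q) /\ f (g q) = q)
      & affine_on U f /\ affine_on V g].

(* sigma is total, but only its restriction to the open interval J matters. *)
Definition geodesic M (J : set R) (sigma : R -> M) :=
  [/\ open J, is_interval J &
  forall t, J t -> {for t, continuous sigma} /\
    forall c, atlas c -> dom c (sigma t) ->
      let x (k : 'I_2) (s : R) : R := coord c (sigma s) 0 k in
      forall k,
        [/\ derivable (x k) t 1, derivable (derive1 (x k)) t 1 &
            derive1 (derive1 (x k)) t +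
              \sum_i \sum_j gamma c (coord c (sigma t)) i j k
                            * derive1 (x i) t * derive1 (x j) t = 0]].

Definition geodesically_complete M :=
  forall (J : set R) (sigma : R -> M), geodesic J sigma ->
    exists2 tau : R -> M, geodesic setT tau & forall t, J t -> tau t = sigma t.

Definition geodesically_incomplete M := ~ geodesically_complete M.

End AffineSurfaces.

Section PlaneSurface.
Variable R : realType.

Lemma plane_hausdorff : hausdorff_space (plane R).
Proof. exact: norm_hausdorff. Qed.

Lemma plane_second_countable : @second_countable (plane R).
Proof.
pose f (q : 'rV[rat]_2 * nat) : set (plane R) :=
  (ball (map_mx ratr q.1 : 'rV[R]_2) (q.2.+1%:R^-1))°.
exists (range f).
  by apply: (card_le_trans (card_image_le _ _)); exact: countableP.
split => [_ [q _ <-]|x V /nbhs_ballP[e /= e0 eV]]; first exact: open_interior.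
have [N Ne] : exists N, N.+1%:R^-1 < e / 2.
  have [//|N] := @ltr_add_invr R 0 (e / 2) _; first by rewrite divr_gt0.
  by rewrite add0r => ?; exists N.
have N0 : (0 : R) < N.+1%:R^-1 by rewrite invr_gt0 ltr0n.
have H (i : 'I_2) : exists q : rat, `|ratr q - x 0 i| < N.+1%:R^-1 / 2.
  have [|q] := @rat_in_itvoo R (x 0 i - N.+1%:R^-1 / 2)
    (x 0 i + N.+1%:R^-1 / 2).
    by rewrite ltrBlDr -addrA ltrDl addr_gt0 ?divr_gt0.
  by rewrite in_itv/= => qx; exists q; rewrite distrC ltr_distlC.
have [q Hq] := choice H.
have xq : ball (map_mx ratr (\row_i q i) : plane R) (N.+1%:R^-1 / 2) x.
  split; first by rewrite divr_gt0.
  by move=> i j; rewrite !mxE ord1; exact: Hq.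
exists (f (\row_i q i, N)).
  split; first by exists (\row_i q i, N).
  apply/nbhs_ballP; exists (N.+1%:R^-1 / 2) => /=; first by rewrite divr_gt0.
  by move=> y xy; rewrite (splitr N.+1%:R^-1); apply: ball_triangle xq xy.
move=> y /interior_subset /= qy; apply: eV.
rewrite (splitr e).
apply: (@ball_triangle _ _ (map_mx ratr (\row_i q i) : plane R)).
- apply/ball_sym; apply: le_ball xq; apply/ltW/(lt_trans _ Ne).
  by rewrite ltr_pdivrMr// ltr_pMr// ltr1n.
- by apply: le_ball qy; exact/ltW.
Qed.

Lemma partial_cst (a : R) i : partial i (cst a : plane R -> R) = cst 0.
Proof. by apply/funext => x; rewrite /partial derive_cst. Qed.

Lemma Ck_cst k U (a : R) : Ck k U (cst a : plane R -> R).
Proof.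
elim: k a => [|k IH] a /=; first by split=> // x _; exact: cst_continuous.
split=> [x _|i]; first exact: cst_continuous.
by split=> [x _|]; [exact: derivable_cst | rewrite partial_cst].
Qed.

Lemma smooth_cst U (a : R) : smooth U (cst a : plane R -> R).
Proof. by move=> k; exact: Ck_cst. Qed.

Lemma derivable_coord (j i : 'I_2) (x : plane R) :
  derivable (fun y : plane R => y 0 j) x (coord_vec R i).
Proof.
have /derivable_mxP := @derivable_id R (plane R) x (coord_vec R i).
by apply.
Qed.

Lemma partial_coord (j i : 'I_2) :
  partial i (fun x : plane R => x 0 j) = cst ((i == j)%:R).
Proof.
apply/funext => x; rewrite /partial.
have := derive_mx (@derivable_id R (plane R) x (coord_vec R i)).
rewrite derive_id => /matrixP /(_ 0 j); rewrite !mxE => <-.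
by rewrite eqxx /= eq_sym.
Qed.

Lemma smooth_coord U (j : 'I_2) : smooth U (fun x : plane R => x 0 j).
Proof.
case=> [|k] /=.
  by split=> // x _; exact: coord_continuous.
split=> [x _|i]; first exact: coord_continuous.
split=> [x _|]; first exact: derivable_coord.
by rewrite partial_coord; exact: Ck_cst.
Qed.

Definition plane_chart : chart R (plane R).
Proof.
by refine (@Chart R (plane R) setT setT id id openT openT
  _ _ _ _ _ _) => // x _; exact: cvg_id.
Defined.

Lemma plane_compat (G : christoffel R) :
  chart_affine plane_chart G plane_chart G setT id.
Proof.
split=> [k|x _ i j k]; first exact: smooth_coord.
have partial_id a b : partial a (component (coord plane_chart \o id \o
    param plane_chart) b) = cst ((a == b)%:R) :> (plane R -> R).
  exact: partial_coord.
rewrite !partial_id partial_cst add0r.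
rewrite (bigD1 i)//= (bigD1 j)//= !partial_id !eqxx !mul1r.
rewrite big1 ?addr0; last first.
  by move=> b /negPf bj; rewrite partial_id /= eq_sym bj mulr0 mul0r.
rewrite big1 ?addr0; last first.
  move=> a /negPf ai; rewrite big1// => b _.
  by rewrite partial_id /= eq_sym ai !mul0r.
rewrite (bigD1 k)//= partial_id /= eqxx mulr1 big1 ?addr0//.
by move=> l /negPf lk; rewrite partial_id /= lk mulr0.
Qed.

(* The plane with its standard smooth structure and the connection whose
   symbols are G in the standard coordinates. *)
Definition plane_surface (G : christoffel R)
    (Gsmooth : forall i j k, smooth setT (fun x => G x i j k))
    (Gsym : forall x i j k, G x i j k = G x j i k) : affineSurface R.
Proof.
refine (@AffineSurface R (plane R) plane_hausdorff plane_second_countable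
  (ex_intro _ 0 I) [set plane_chart] (fun=> G) _ _ _ _).
- by move=> p; exists plane_chart.
- by move=> _ -> i j k; exact: Gsmooth.
- by move=> _ -> x _ i j k; exact: Gsym.
- by move=> _ _ -> ->; exact: plane_compat.
Defined.

End PlaneSurface.

Record typeA (R : realType) := TypeA {
  symb : symbols R;
  symb_sym : forall i j k, symb i j k = symb j i k }.

Section TypeA.
Variable R : realType.
Implicit Types C : typeA R.

Definition model C : affineSurface R :=
  @plane_surface R (fun=> symb C) (fun i j k => smooth_cst setT (symb C i j k))
    (fun=> symb_sym C).

(* "Modeled on C": covered by charts in which the symbols are C. *)
Definition modeled_on (M : affineSurface R) C :=
  forall p : M, exists2 c : chart R M, dom c p & local_coordinates c (fun=> symb C).

Definition essentially_complete C :=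
  exists2 M : affineSurface R, modeled_on M C & geodesically_complete M.

Definition essentially_incomplete C := ~ essentially_complete C.

Definition linearly_isomorphic C C' :=
  exists2 T : 'M[R]_2, T \in unitmx &
    affine_map setT (fun=> symb C) (fun=> symb C') (fun x => x *m T).

(* [mk_symbols c111 c112 c121 c122 c221 c222] has C_{ij}^k = cijk and
   C_{21}^k = C_{12}^k. *)
Definition mk_symbols (c111 c112 c121 c122 c221 c222 : R) : symbols R :=
  fun i j k =>
    if i == j then
      if i == 0 then (if k == 0 then c111 else c112)
      else (if k == 0 then c221 else c222)
    else (if k == 0 then c121 else c122).

Lemma mk_symbols_sym c111 c112 c121 c122 c221 c222 i j k :
  mk_symbols c111 c112 c121 c122 c221 c222 i j k =
  mk_symbols c111 c112 c121 c122 c221 c222 j i k.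
Proof. by rewrite /mk_symbols eq_sym; case: eqP => // ->. Qed.

Definition mk_typeA c111 c112 c121 c122 c221 c222 : typeA R :=
  TypeA (mk_symbols_sym c111 c112 c121 c122 c221 c222).

Definition C1 : typeA R := mk_typeA (-1) 0 (- 2^-1) 0 0 0.
Definition C2 : typeA R := mk_typeA 0 0 (- 2^-1) 0 0 0.
Definition C3 : typeA R := mk_typeA (-1) 0 0 0 (-1) 0.
Definition Cminus (delta : R) : typeA R :=
  mk_typeA 0 (-1) 2^-1 (delta / 2) 0 0.

Definition tildeG3 : christoffel R := fun x => mk_symbols 0 0 0 0 (x 0 0) 0.

Lemma tildeG3_smooth i j k : smooth setT (fun x => tildeG3 x i j k).
Proof.
rewrite /tildeG3 /mk_symbols.
by case: (i == j); case: (i == 0); case: (k == 0);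
  (exact: smooth_cst || exact: smooth_coord).
Qed.

Definition tildeM3 : affineSurface R :=
  plane_surface tildeG3_smooth
    (fun x => mk_symbols_sym 0 0 0 0 (x 0 0) 0).

Definition model_family : set (typeA R) :=
  [set C | [\/ C = C2, C = C3 |
               exists2 delta : R, 0 <= delta < 2 & C = Cminus delta]].

End TypeA.

Section Curvature.
Variables (R : realType) (G : christoffel R).

Definition vfield := plane R -> plane R.

Implicit Types xi eta zeta theta : vfield.

(* The connection on the plane with symbols G, acting on vector fields. *)
Definition nabla xi eta : vfield := fun x => \row_k
  (\sum_i xi x 0 i * partial i (component eta k) x +
   \sum_i \sum_j xi x 0 i * eta x 0 j * G x i j k).

Definition bracket xi eta : vfield := fun x => \row_k
  \sum_i (xi x 0 i * partial i (component eta k) x -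
          eta x 0 i * partial i (component xi k) x).

Definition curvature xi eta zeta : vfield :=
  nabla xi (nabla eta zeta) - nabla eta (nabla xi zeta)
  - nabla (bracket xi eta) zeta.

Definition coord_field (i : 'I_2) : vfield := fun=> coord_vec R i.

(* rho(d_i, d_j) = Tr (sigma |-> R(sigma, d_i) d_j). *)
Definition ricci (x : plane R) : 'M[R]_2 := \matrix_(i, j)
  \tr (\matrix_(a, b)
         curvature (coord_field a) (coord_field i) (coord_field j) x 0 b).

Definition nabla_curvature xi eta zeta theta : vfield :=
  nabla xi (curvature eta zeta theta)
  - curvature (nabla xi eta) zeta theta
  - curvature eta (nabla xi zeta) theta
  - curvature eta zeta (nabla xi theta).

(* nabla R is a tensor, so it is determined by its values on the coordinate
   frame. *)
Definition nabla_curvature_neq0 := exists x i j k l,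
  nabla_curvature (coord_field i) (coord_field j) (coord_field k)
    (coord_field l) x != 0.

End Curvature.

Section RicciRank.
Variable R : realType.

(* The components of the Ricci tensor of a Type A model are constant. *)
Definition ricci_rank (C : typeA R) (r : nat) :=
  forall x, \rank (ricci (fun=> symb C) x) = r.

Definition nabla_R_neq0 (C : typeA R) := nabla_curvature_neq0 (fun=> symb C).

End RicciRank.

(* Main.v *)
(** Constant symbols C make the plane a commutative algebra, u * v = C(u, v), and a nonzero
    idempotent v gives the geodesic t |-> ln t v.  Transition maps F between charts with symbols C
    preserve the Ricci tensor rho, which has constant components.  If rho has rank 2, this
    forces dF to be locally constant, hence an automorphism of the algebra; if rho = eps l l has
    rank 1, then l o C = f l l with f <> 0 unless R is parallel, and l o dF = l.  So "t times
    the velocity is an idempotent", respectively "l (velocity) = 1 / (f t)", is independent of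
    the chart and propagates along a geodesic, whose velocity has to blow up at t = 0 on any
    surface modeled on C.

    If rho has rank 2, either there is an idempotent or a change of basis brings C to the form
    Cminus delta with 0 <= delta < 2, whose geodesics can be integrated explicitly.  The models
    C1 and C3 become complete in the coordinate w = exp (- x^1), where the geodesic equations are
    linear. *)
Require Import Defs.
From HB Require Import structures.
From mathcomp Require Import all_boot all_order all_algebra.
From mathcomp Require Import all_classical all_reals all_analysis.
From mathcomp Require Import ring lra.
(* The library has its own [coord]. *)
Import Defs.
Import Order.TTheory GRing.Theory Num.Theory.
Import numFieldNormedType.Exports.
Local Open Scope classical_set_scope.
Local Open Scope ring_scope.

Set Implicit Arguments.
Unset Strict Implicit.
Unset Printing Implicit Defensive.

(** * Calculus in the plane *)

(** A surface modeled on C has no global coordinates, so a blow-up has to be read off a condition on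
    velocities that every transition map respects. The factor t is what makes the condition constant
    in time: for W = t x' the geodesic equation becomes t W' = W - C(W, W), and a nonzero idempotent
    is an equilibrium of it. The difference between a solution and the equilibrium satisfies a
    linear system, so uniqueness for linear systems is enough; all geodesics whose existence is
    needed are explicit or obtained by quadrature. The models C1, C2 and C3 have l = dx^2 up to a
    factor and f = 0, so the rank one obstruction is absent for them. In rank 2 everything rests on
    one dichotomy: C(v, v) is parallel to v for some v <> 0, because this is the vanishing of a form
    of odd degree on the real plane. Rescaling gives an idempotent unless C(v, v) = 0, and when
    every such v squares to zero the sign of a discriminant gives exactly the bound delta < 2, the
    same bound that keeps the slope of the velocity from having real equilibria in the model.
    Smoothness is defined by iterated partial derivatives, so the chain rule and the symmetry of
    second derivatives are derived from the mean value theorem. *)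

Lemma sum2 (V : nmodType) (F : 'I_2 -> V) : \sum_i F i = F 0 + F 1.
Proof. by rewrite !big_ord_recl big_ord0 addr0; congr (_ + F _); apply/val_inj. Qed.

Lemma ord2P (i : 'I_2) : i = 0 \/ i = 1.
Proof. by case: i => -[|[|//]] Hi; [left|right]; exact/val_inj. Qed.

Section Plane.
Variable R : realType.
Implicit Types (p x y v : plane R) (f g : plane R -> R) (U : set (plane R)).

Definition pt (a b : R) : plane R := \row_k (if k == 0 then a else b).

Lemma pt0 a b : pt a b 0 0 = a. Proof. by rewrite mxE. Qed.
Lemma pt1 a b : pt a b 0 1 = b. Proof. by rewrite mxE. Qed.

Lemma planeP x y : x 0 0 = y 0 0 -> x 0 1 = y 0 1 -> x = y.
Proof.
by move=> e0 e1; apply/rowP => i; case: (ord2P i) => ->.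
Qed.

Lemma pt_eta x : pt (x 0 0) (x 0 1) = x.
Proof. by apply: planeP; rewrite ?pt0 ?pt1. Qed.

Lemma coord_vecE (i j : 'I_2) : coord_vec R i 0 j = (i == j)%:R.
Proof. by rewrite mxE eqxx /= eq_sym. Qed.

Lemma near_boxP p (P : plane R -> Prop) :
  (\forall y \near p, P y) <->
  exists2 d : R, 0 < d & forall y, (forall i, `|p 0 i - y 0 i| < d) -> P y.
Proof.
split.
  move=> /nbhs_ballP[d /= d0 H]; exists d => // y yd.
  by apply: H; split=> // i j; rewrite ord1; exact: yd.
move=> [d d0 H]; apply/nbhs_ballP; exists d => //= y [_ yd].
by apply: H => i; exact: yd.
Qed.

Lemma near_forall2 (T : topologicalType) (a : T) (P : 'I_2 -> T -> Prop) :
  (forall i, \forall y \near a, P i y) -> \forall y \near a, forall i, P i y.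
Proof.
move=> H; near=> y => i; case: (ord2P i) => ->; near: y; exact: H.
Unshelve. all: by end_near. Qed.

Lemma is_derive_line f p v (s d : R) :
  is_derive (p + s *: v) v f d -> is_derive s 1 (fun s => f (p + s *: v)) d.
Proof.
move=> [fd <-].
have E : (fun h : R => h^-1 *: (((fun s => f (p + s *: v)) \o shift s) (h *: 1) -
   f (p + s *: v))) =
   (fun h => h^-1 *: ((f \o shift (p + s *: v)) (h *: v) - f (p + s *: v))).
  apply/funext => h /=; congr (_ *: (f _ - _)).
  by rewrite [h%:A]mulr1 scalerDl addrCA.
by split; rewrite /derivable /derive E.
Qed.

Lemma is_derive_lineV f p v (d : R) :
  is_derive (0 : R) 1 (fun s => f (p + s *: v)) d -> is_derive p v f d.
Proof.
move=> [fd <-].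
have E : (fun h : R => h^-1 *: (((fun s => f (p + s *: v)) \o shift 0) (h *: 1) -
   f (p + 0 *: v))) =
   (fun h => h^-1 *: ((f \o shift p) (h *: v) - f p)).
  apply/funext => h /=; rewrite scale0r !addr0; congr (_ *: (f _ - _)).
  by rewrite [h%:A]mulr1 addrC.
by split; rewrite /derivable /derive -E.
Qed.

Lemma is_derive_line0 f p v d :
  is_derive p v f d -> is_derive (0 : R) 1 (fun s => f (p + s *: v)) d.
Proof. by move=> H; apply: is_derive_line; rewrite scale0r addr0. Qed.

Lemma is_derive_cont (V : normedModType R) (h : R -> V) (a : R) d : is_derive a 1 h d -> {for a, continuous h}.
Proof. by move=> [H _]; exact/differentiable_continuous/derivable1_diffP. Qed.

Lemma within_cont (h dh : R -> R) (a b : R) :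
  (forall s, a <= s <= b -> is_derive s 1 h (dh s)) -> {within `[a, b], continuous h}.
Proof.
move=> H; apply: continuous_in_subspaceT => s; rewrite inE/= in_itv/= => /H.
exact: is_derive_cont.
Qed.

(** The mean value theorem turns the increment into [dh c * (b - a)]. No order between [a] and [b]
    is assumed, since coordinate increments have either sign. *)
Lemma MVT_bound (h dh : R -> R) (a b l e : R) :
  (forall s, `|s - a| <= `|b - a| -> is_derive s 1 h (dh s)) ->
  (forall s, `|s - a| <= `|b - a| -> `|dh s - l| <= e) ->
  `|h b - h a - l * (b - a)| <= e * `|b - a|.
Proof.
move=> hd he.
have key (x y : R) : x <= y -> (forall s, x <= s <= y -> `|s - a| <= `|b - a|) ->
  `|h y - h x - l * (y - x)| <= e * `|y - x|.
  move=> xy Hs.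
  have hd' s : x <= s <= y -> is_derive s 1 h (dh s) by move=> /Hs; exact: hd.
  have [|c cxy ->] := @MVT_segment R h dh x y xy _ (within_cont hd').
    by move=> s; rewrite in_itv/= => /andP[/ltW xs /ltW sy]; apply: hd'; rewrite xs.
  rewrite -mulrBl normrM ler_wpM2r// he// Hs//.
case: (leP a b) => ab.
  apply: key => // s /andP[as_ sb]; rewrite !ger0_norm ?subr_ge0 ?lerD2r//.
rewrite -normrN (_ : - (h b - h a - l * (b - a)) = h a - h b - l * (a - b)); last by ring.
rewrite (distrC b); apply: key; first exact: ltW.
by move=> s /andP[bs sa]; rewrite distrC (distrC b) !ger0_norm ?subr_ge0 ?(ltW ab)//; lra.
Qed.

(** The partial derivatives exist near [p] but are continuous only at [p]; this already gives
    differentiability at [p]. *)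
Definition C1_at f p := (\forall y \near p, forall i, derivable f y (coord_vec R i)) /\
  forall i, {for p, continuous (partial i f)}.

Lemma partial_is_derive f y i : derivable f y (coord_vec R i) ->
  is_derive y (coord_vec R i) f (partial i f y).
Proof. by move=> H; exact: derivableP. Qed.

(** One walks from [p] to [y] along two axis-parallel segments meeting at [q], and applies the
    one-variable bound on each; both segments stay in the box around [p] where the partial
    derivatives vary by at most [e]. *)
Lemma C1_increment f p (e : R) : C1_at f p -> 0 < e ->
  \forall y \near p, `|f y - f p - (\sum_i partial i f p * (y 0 i - p 0 i))| <=
     e * (\sum_i `|y 0 i - p 0 i|).
Proof.
move=> [fd fc] e0.
have N2 : \forall y \near p, forall i, `|partial i f p - partial i f y| <= e.
  by apply: near_forall2 => i; have /cvgrPdist_le/(_ _ e0) := fc i.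
have /near_boxP[d d0 H] : \forall y \near p,
    (forall i, derivable f y (coord_vec R i)) /\
    forall i, `|partial i f p - partial i f y| <= e.
  by near=> y; split; near: y.
apply/near_boxP; exists d => // y yd.
pose q := pt (p 0 0) (y 0 1).
have qE0 s : q + s *: coord_vec R 0 = pt (p 0 0 + s) (y 0 1).
  by apply: planeP; rewrite !mxE/= ?mulr1 ?mulr0 ?addr0.
have pE1 s : p + s *: coord_vec R 1 = pt (p 0 0) (p 0 1 + s).
  by apply: planeP; rewrite !mxE/= ?mulr1 ?mulr0 ?addr0.
have Q0 (s : R) : `|s| <= `|y 0 0 - p 0 0| -> forall i, `|p 0 i - (q + s *: coord_vec R 0) 0 i| < d.
  move=> sb i; rewrite qE0; case: (ord2P i) => ->; rewrite ?pt0 ?pt1; last exact: yd.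
  by rewrite opprD addrA subrr add0r normrN (le_lt_trans sb)// distrC.
have P1 (s : R) : `|s| <= `|y 0 1 - p 0 1| -> forall i, `|p 0 i - (p + s *: coord_vec R 1) 0 i| < d.
  move=> sb i; rewrite pE1; case: (ord2P i) => ->; rewrite ?pt0 ?pt1.
    by rewrite subrr normr0.
  by rewrite opprD addrA subrr add0r normrN (le_lt_trans sb)// distrC.
have B0 := @MVT_bound (fun s => f (q + s *: coord_vec R 0))
  (fun s => partial 0 f (q + s *: coord_vec R 0)) 0 (y 0 0 - p 0 0) (partial 0 f p) e.
have B1 := @MVT_bound (fun s => f (p + s *: coord_vec R 1))
  (fun s => partial 1 f (p + s *: coord_vec R 1)) 0 (y 0 1 - p 0 1) (partial 1 f p) e.
rewrite !sum2 (mulrDr e).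
have -> : f y - f p - (partial 0 f p * (y 0 0 - p 0 0) + partial 1 f p * (y 0 1 - p 0 1))
  = (f y - f q - partial 0 f p * (y 0 0 - p 0 0)) +
    (f q - f p - partial 1 f p * (y 0 1 - p 0 1)) by ring.
apply: le_trans (ler_normD _ _) _; apply: lerD.
  move: B0; rewrite !subr0 !scale0r !addr0 qE0 subrKC pt_eta; apply => s; rewrite subr0 => sb.
    by apply: is_derive_line; apply: partial_is_derive; apply (H _ (Q0 _ sb)).
  by rewrite distrC; apply (H _ (Q0 _ sb)).
move: B1; rewrite !subr0 !scale0r !addr0 pE1 subrKC; apply => s; rewrite subr0 => sb.
  by apply: is_derive_line; apply: partial_is_derive; apply (H _ (P1 _ sb)).
by rewrite distrC; apply (H _ (P1 _ sb)).
Unshelve. all: by end_near. Qed.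

Lemma chain_curve f (c : R -> plane R) (dc : 'I_2 -> R) (t : R) :
  C1_at f (c t) -> (forall i, is_derive t 1 (fun s => c s 0 i) (dc i)) ->
  is_derive t 1 (fun s => f (c s)) (\sum_i partial i f (c t) * dc i).
Proof.
move=> fC cd.
have cc : {for t, continuous c}.
  apply/differentiable_continuous/derivable1_diffP/derivable_mxP => i j.
  by rewrite ord1; have [] := cd j.
(* Near [t] the difference quotients of the coordinates are at most [|dc i| + 1], with sum [M]; a
   linearisation error with factor [e / 2 / M] then contributes at most [e / 2]. *)
pose M := \sum_i (`|dc i| + 1).
have M0 : 0 < M by rewrite /M sum2 addr_gt0// ltr_wpDl.
suff L : (h^-1 *: (f (c (h + t)) - f (c t))) @[h --> 0^'] --> \sum_i partial i f (c t) * dc i.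
  have E : (fun h : R => h^-1 *: (((fun s => f (c s)) \o shift t) (h *: 1) - f (c t))) =
     (fun h => h^-1 *: (f (c (h + t)) - f (c t))).
    by apply/funext => h /=; rewrite [h%:A]mulr1.
  split; rewrite /derivable /derive E; first by apply: cvgP L.
  exact: cvg_lim.
have Q i : (h^-1 *: (c (h + t) 0 i - c t 0 i)) @[h --> 0^'] --> dc i.
  have [H1 H2] := cd i; move: H1; rewrite /derivable => /cvg_ex[l Hl].
  have := Hl; move: H2; rewrite /derive => <-.
  rewrite (cvg_lim _ Hl)//.
  by under eq_fun do rewrite /= [_%:A]mulr1.
apply/cvgrPdist_le => e e0.
have e20 : 0 < e / 2 by rewrite divr_gt0.
have N1 := C1_increment fC (divr_gt0 e20 M0).
have N2 : \forall h \near 0^', `|f (c (h + t)) - f (c t) -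
    (\sum_i partial i f (c t) * (c (h + t) 0 i - c t 0 i))| <=
     e / 2 / M * (\sum_i `|c (h + t) 0 i - c t 0 i|).
  have C' : c (h + t) @[h --> (0 : R)] --> c t.
    by rewrite -[X in c X](add0r t); apply: continuous_comp; [exact: cvgD cvg_id (cvg_cst _)|rewrite add0r].
  apply: nbhs_dnbhs; exact: C' N1.
have N3 : (\sum_i partial i f (c t) * (h^-1 *: (c (h + t) 0 i - c t 0 i))) @[h --> 0^']
   --> \sum_i partial i f (c t) * dc i.
  rewrite sum2; under eq_fun do rewrite sum2.
  by apply: cvgD; apply: cvgMl_tmp; exact: Q.
have N4 i : \forall h \near 0^', `|h^-1 *: (c (h + t) 0 i - c t 0 i)| <= `|dc i| + 1.
  have /cvgrPdist_le/(_ 1 ltr01) := Q i.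
  apply: filterS => h; rewrite distrC => H.
  rewrite -[X in `|X|](subrK (dc i)) (le_trans (ler_normD _ _))//.
  by rewrite addrC lerD2l.
near=> h.
have h0 : h != 0 by near: h; exact: nbhs_dnbhs_neq.
have H2 : `|f (c (h + t)) - f (c t) -
    (\sum_i partial i f (c t) * (c (h + t) 0 i - c t 0 i))| <=
     e / 2 / M * (\sum_i `|c (h + t) 0 i - c t 0 i|) by near: h.
have H3 : `|\sum_i partial i f (c t) * dc i -
   \sum_i partial i f (c t) * (h^-1 *: (c (h + t) 0 i - c t 0 i))| <= e / 2.
  by near: h; have /cvgrPdist_le := N3; exact.
have H4 i : `|h^-1 *: (c (h + t) 0 i - c t 0 i)| <= `|dc i| + 1.
  by case: (ord2P i) => ->; near: h; exact: N4.
rewrite (splitr e).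
set S := \sum_i partial i f (c t) * dc i in H3 *.
set T := \sum_i partial i f (c t) * (h^-1 *: (c (h + t) 0 i - c t 0 i)) in H3 *.
rewrite -(subrKA T); apply: le_trans (ler_normD _ _) _; apply: lerD => //.
have -> : T - h^-1 *: (f (c (h + t)) - f (c t)) = - (h^-1 * (f (c (h + t)) - f (c t) -
    (\sum_i partial i f (c t) * (c (h + t) 0 i - c t 0 i)))).
  by rewrite /T !sum2 /GRing.scale/=; ring.
rewrite normrN normrM; apply: le_trans (ler_wpM2l (normr_ge0 _) H2) _.
rewrite mulrCA mulr_sumr -[leRHS](divfK (lt0r_neq0 M0)).
apply: ler_wpM2l; first by rewrite ltW// divr_gt0.
apply: ler_sum => i _; rewrite -normrM; exact: H4.
Unshelve. all: by end_near. Qed.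

End Plane.

(** * Functions of class C^k *)

Section Ck.
Variable R : realType.
Implicit Types (p x y v : plane R) (f g : plane R -> R) (U V : set (plane R)).

Lemma Ck_cont k U f x : Ck k U f -> U x -> {for x, continuous f}.
Proof. by case: k => [|k] [H _]; exact: H. Qed.

Lemma Ck_derivable k U f x i : Ck k.+1 U f -> U x -> derivable f x (coord_vec R i).
Proof. by move=> [_ /(_ i)[H _]]; exact: H. Qed.

Lemma Ck_partial k U f i : Ck k.+1 U f -> Ck k U (partial i f).
Proof. by move=> [_ /(_ i)[_ H]]. Qed.

Lemma CkSI k U f : (forall x, U x -> {for x, continuous f}) ->
  (forall i x, U x -> derivable f x (coord_vec R i)) ->
  (forall i, Ck k U (partial i f)) -> Ck k.+1 U f.
Proof. by move=> H1 H2 H3; split=> // i; split; [exact: H2|exact: H3]. Qed.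

Lemma Ck_sub k U V f : V `<=` U -> Ck k U f -> Ck k V f.
Proof.
move=> VU; elim: k f => [|k IH] f fC.
  by split=> // x Vx; apply: (Ck_cont fC); exact: VU.
apply: CkSI => [x /VU|i x /VU|i]; first exact: (Ck_cont fC).
  exact: Ck_derivable fC.
by apply: IH; exact: Ck_partial.
Qed.

Lemma CkW k U f : Ck k.+1 U f -> Ck k U f.
Proof.
elim: k f => [|k IH] f fC; first by split=> // x; exact: Ck_cont fC.
apply: CkSI => [x|i x|i]; first exact: (Ck_cont fC).
  exact: Ck_derivable fC.
by apply: IH; exact: Ck_partial.
Qed.

Lemma near_open U x (P : plane R -> Prop) : open U -> U x ->
  (forall y, U y -> P y) -> \forall y \near x, P y.
Proof. by move=> Uo Ux H; apply: filterS (open_nbhs_nbhs (conj Uo Ux)). Qed.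

Lemma partial_ext U f g x i : open U -> U x -> (forall y, U y -> f y = g y) ->
  partial i f x = partial i g x.
Proof. by move=> Uo Ux H; apply: near_eq_derive; exact: near_open H. Qed.

Lemma derivable_ext U f g x v : open U -> U x -> (forall y, U y -> f y = g y) ->
  derivable f x v -> derivable g x v.
Proof. by move=> Uo Ux H; apply: near_eq_derivable; exact: near_open H. Qed.

Lemma continuous_ext U f g x : open U -> U x -> (forall y, U y -> f y = g y) ->
  {for x, continuous f} -> {for x, continuous g}.
Proof.
move=> Uo Ux H fc; change (g @ x --> g x); rewrite -(H x Ux); apply: cvg_trans fc.
by apply: (@near_eq_cvg _ _ (nbhs x) (nbhs_filter x)); exact: (near_open Uo Ux).
Qed.

Lemma Ck_ext k U f g : open U -> (forall y, U y -> f y = g y) ->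
  Ck k U f -> Ck k U g.
Proof.
move=> Uo; elim: k f g => [|k IH] f g fg fC.
  by split=> // x Ux; apply: (continuous_ext Uo Ux fg (Ck_cont fC Ux)).
apply: CkSI => [x Ux|i x Ux|i].
- exact: (continuous_ext Uo Ux fg (Ck_cont fC Ux)).
- by apply: (@derivable_ext U f g x (coord_vec R i) Uo Ux fg); exact: Ck_derivable fC Ux.
- apply: IH (Ck_partial i fC) => y Uy; exact: partial_ext Uo Uy fg.
Qed.

Lemma C1_of_Ck k U f x : open U -> U x -> Ck k.+1 U f -> C1_at f x.
Proof.
move=> Uo Ux fC; split; last by move=> i; exact: Ck_cont (Ck_partial i fC) Ux.
by apply: near_open Uo Ux _ => y Uy i; exact: Ck_derivable fC Uy.
Qed.

(** Closure properties are proved by induction on [k]; naming the partial derivatives as explicit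
    functions lets the induction hypothesis apply to them. *)
Lemma Ck_partialI k U f (df : 'I_2 -> plane R -> R) : open U ->
  (forall x, U x -> {for x, continuous f}) ->
  (forall i x, U x -> is_derive x (coord_vec R i) f (df i x)) ->
  (forall i, Ck k U (df i)) -> Ck k.+1 U f.
Proof.
move=> Uo fc fd fC; apply: CkSI => // [i x /(fd i)[]//|i].
by apply: Ck_ext Uo _ (fC i) => y /(fd i)[_ <-].
Qed.

Lemma CkD k U f g : open U -> Ck k U f -> Ck k U g -> Ck k U (fun x => f x + g x).
Proof.
move=> Uo; elim: k f g => [|k IH] f g fC gC.
  by split=> // x Ux; apply: continuousD; [exact: Ck_cont fC Ux|exact: Ck_cont gC Ux].
apply: (@Ck_partialI _ _ _ (fun i x => partial i f x + partial i g x)) => // [x Ux|i x Ux|i].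
- by apply: continuousD; [exact: Ck_cont fC Ux|exact: Ck_cont gC Ux].
- by apply: is_deriveD; apply: partial_is_derive; [exact: Ck_derivable fC Ux|exact: Ck_derivable gC Ux].
- by apply: IH; exact: Ck_partial.
Qed.

Lemma CkM k U f g : open U -> Ck k U f -> Ck k U g -> Ck k U (fun x => f x * g x).
Proof.
move=> Uo; elim: k f g => [|k IH] f g fC gC.
  by split=> // x Ux; apply: continuousM; [exact: Ck_cont fC Ux|exact: Ck_cont gC Ux].
apply: (@Ck_partialI _ _ _ (fun i x => f x * partial i g x + g x * partial i f x)) => // [x Ux|i x Ux|i].
- by apply: continuousM; [exact: Ck_cont fC Ux|exact: Ck_cont gC Ux].
- by apply: is_deriveM; apply: partial_is_derive; [exact: Ck_derivable fC Ux|exact: Ck_derivable gC Ux].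
- by apply: CkD => //; apply: IH; (exact: CkW || exact: Ck_partial).
Qed.

Lemma Ck_sum k U (F : 'I_2 -> plane R -> R) : open U -> (forall i, Ck k U (F i)) ->
  Ck k U (fun x => \sum_i F i x).
Proof.
move=> Uo H; apply: (Ck_ext (f := fun x => F 0 x + F 1 x)) => // [y _|].
  by rewrite sum2.
exact: CkD.
Qed.

Lemma is_derive_comp1 (h : R -> R) f x v (a b : R) :
  is_derive (f x) 1 h a -> is_derive x v f b ->
  is_derive x v (fun y => h (f y)) (a * b).
Proof.
move=> hd fd; apply: is_derive_lineV.
apply: (@is_derive1_comp _ h (fun s => f (x + s *: v)) 0 a b).
  by rewrite scale0r addr0.
exact: is_derive_line0.
Qed.

Lemma continuous_comp1 (h : R -> R) f x a :
  is_derive (f x) 1 h a -> {for x, continuous f} -> {for x, continuous (fun y => h (f y))}.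
Proof. by move=> /is_derive_cont hc fc; exact: (continuous_comp fc hc). Qed.

(** The partial derivatives of the composite are [dh (f x)] times those of [f]. For the exponential,
    sine, cosine and inverse, [dh] is built from the same functions, so the last hypothesis comes
    from an induction on [k]. *)
Lemma Ck_comp1 (h dh : R -> R) k U f : open U ->
  (forall x, U x -> is_derive (f x) 1 h (dh (f x))) ->
  Ck k.+1 U f -> Ck k U (fun x => dh (f x)) -> Ck k.+1 U (fun x => h (f x)).
Proof.
move=> Uo hd fC dC.
apply: (@Ck_partialI _ _ _ (fun i x => dh (f x) * partial i f x)) => // [x Ux|i x Ux|i].
- by apply: continuous_comp1; [exact: hd|exact: Ck_cont fC Ux].
- by apply: is_derive_comp1; [exact: hd|apply: partial_is_derive; exact: Ck_derivable fC Ux].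
- by apply: CkM => //; exact: Ck_partial.
Qed.

Lemma Ck0_comp1 (h dh : R -> R) U f : 
  (forall x, U x -> is_derive (f x) 1 h (dh (f x))) ->
  Ck 0 U f -> Ck 0 U (fun x => h (f x)).
Proof.
move=> hd fC; split=> // x Ux.
by apply: continuous_comp1; [exact: hd|exact: Ck_cont fC Ux].
Qed.

Lemma Ck_exp k U f : open U -> Ck k U f -> Ck k U (fun x => expR (f x)).
Proof.
move=> Uo; elim: k => [|k IH] fC.
  by apply: Ck0_comp1 fC => x Ux; exact: is_derive_expR.
by apply: (Ck_comp1 (dh := expR)) => //; apply: IH; exact: CkW.
Qed.

Lemma CkN k U f : open U -> Ck k U f -> Ck k U (fun x => - f x).
Proof.
move=> Uo fC; apply: (Ck_ext (f := fun x => cst (-1) x * f x)) => // [y _|].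
  by rewrite /= mulN1r.
by apply: CkM => //; exact: Ck_cst.
Qed.

Lemma Ck_trig k U f : open U -> Ck k U f ->
  Ck k U (fun x => sin (f x)) /\ Ck k U (fun x => cos (f x)).
Proof.
move=> Uo; elim: k => [|k IH] fC.
  split.
    by apply: (Ck0_comp1 (dh := cos)) fC => x Ux; exact: is_derive_sin.
  by apply: (Ck0_comp1 (dh := fun z => - sin z)) fC => x Ux; exact: is_derive_cos.
have [sC cC] := IH (CkW fC).
split; first by apply: (Ck_comp1 (dh := cos)).
by apply: (Ck_comp1 (dh := fun z => - sin z)) => //; exact: CkN.
Qed.

Lemma CkV k U f : open U -> (forall x, U x -> f x != 0) ->
  Ck k U f -> Ck k U (fun x => (f x)^-1).
Proof.
move=> Uo f0.
have D x : U x -> is_derive (f x) 1 (GRing.inv : R -> R) (- ((f x)^-1 * (f x)^-1)).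
  move=> Ux; have := @is_deriveV R id (f x) 1 1 (f0 _ Ux) (is_derive_id _ _).
  by rewrite -exprVn expr2 /GRing.scale/= mulr1.
elim: k => [|k IH] fC.
  exact: (Ck0_comp1 (dh := fun z => - (z^-1 * z^-1))) fC.
apply: (Ck_comp1 (dh := fun z => - (z^-1 * z^-1))) => //.
by apply: CkN => //; apply: CkM => //; apply: IH; exact: CkW.
Qed.

Lemma Ck_ln k U f : open U -> (forall x, U x -> 0 < f x) ->
  Ck k U f -> Ck k U (fun x => ln (f x)).
Proof.
move=> Uo f0; have D x : U x -> is_derive (f x) 1 (@ln R) (f x)^-1.
  by move=> /f0; exact: is_derive1_ln.
case: k => [|k] fC; first exact: (Ck0_comp1 (dh := GRing.inv)) fC.
apply: (Ck_comp1 (dh := GRing.inv)) => //.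
by apply: CkV => // [x /f0/lt0r_neq0//|]; exact: CkW.
Qed.

End Ck.

(** * Composition and symmetry of second derivatives *)

Section Comp.
Variable R : realType.
Implicit Types (p x y v : plane R) (f g : plane R -> R) (U V : set (plane R)).
Implicit Types F : plane R -> plane R.

Lemma is_derive_comp f F x v (dF : 'I_2 -> R) :
  C1_at f (F x) -> (forall a, is_derive x v (component F a) (dF a)) ->
  is_derive x v (fun y => f (F y)) (\sum_a partial a f (F x) * dF a).
Proof.
move=> fC FD; apply: is_derive_lineV.
have := @chain_curve R f (fun s => F (x + s *: v)) dF 0.
rewrite scale0r addr0; apply => // i.
exact: (@is_derive_line0 R (component F i) x v).
Qed.

Lemma continuous_plane F x : (forall a, {for x, continuous (component F a)}) ->
  {for x, continuous F}.
Proof.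
move=> H; change (F @ x --> F x).
apply: (@cvg_trans _ (nbhs (F x))); last exact: cvg_id.
move=> P /near_boxP[d d0 HP].
have : \forall y \near x, forall i, `|component F i x - component F i y| < d.
  apply: near_forall2 => i; have /cvgrPdist_lt/(_ _ d0) := H i; exact.
by apply: filterS => y; exact: HP.
Qed.

Lemma Ck_comp k U V f F : open U -> open V -> (forall x, U x -> V (F x)) ->
  (forall a, Ck k U (component F a)) -> Ck k V f -> Ck k U (fun x => f (F x)).
Proof.
move=> Uo Vo UV.
have cc m g x : Ck m V g -> (forall a, Ck m U (component F a)) -> U x ->
    {for x, continuous (fun x => g (F x))}.
  move=> gC FC Ux; apply: continuous_comp.
    by apply: continuous_plane => a; exact: Ck_cont (FC a) Ux.
  by apply: Ck_cont gC _; exact: UV.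
elim: k f => [|k IH] f FC fC; first by split=> // x; exact: (cc 0%N).
apply: (@Ck_partialI _ _ _ _ (fun i x => \sum_a partial a f (F x) * partial i (component F a) x)) => // [x Ux|i x Ux|i].
- exact: (cc k.+1).
- apply: is_derive_comp; first by apply: C1_of_Ck fC => //; exact: UV.
  by move=> a; apply: partial_is_derive; exact: Ck_derivable (FC a) Ux.
- apply: Ck_sum => // a; apply: CkM => //; last exact: Ck_partial.
  by apply: IH; [move=> b; exact: CkW|exact: Ck_partial].
Qed.

Lemma partial_comp U V f F i x : open U -> open V -> (forall x, U x -> V (F x)) ->
  (forall a, Ck 1 U (component F a)) -> Ck 1 V f -> U x ->
  partial i (fun x => f (F x)) x = \sum_a partial a f (F x) * partial i (component F a) x.
Proof.
move=> Uo Vo UV FC fC Ux.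
suff [_ E] : is_derive x (coord_vec R i) (fun x => f (F x))
    (\sum_a partial a f (F x) * partial i (component F a) x) by exact: E.
apply: is_derive_comp; first by apply: C1_of_Ck fC => //; exact: UV.
by move=> a; apply: partial_is_derive; exact: Ck_derivable (FC a) Ux.
Qed.

Lemma is_derive_shift_line f p v (s d : R) (q : plane R) :
  is_derive (p + s *: v + q) v f d -> is_derive s 1 (fun s => f (p + s *: v + q)) d.
Proof.
move=> H; have E (r : R) : p + r *: v + q = (p + q) + r *: v by rewrite addrAC.
under eq_fun do rewrite E.
by apply: is_derive_line; rewrite -E.
Qed.

Let box i j p (a b : R) : plane R := p + a *: coord_vec R i + b *: coord_vec R j.

(** The mean value bound is used twice, in direction [i] for the difference of the two sides of the
    square and in direction [j] for the partial derivative along [i]; on a small square the mixed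
    derivative is within [e] of its value at [p]. *)
Lemma second_difference U f p i j (e : R) : open U -> Ck 2 U f -> U p -> 0 < e ->
  exists2 d : R, 0 < d & forall h : R, 0 < h < d ->
  `|f (box i j p h h) - f (box i j p h 0) - (f (box i j p 0 h) - f (box i j p 0 0))
    - partial j (partial i f) p * h * h| <= e * h * h.
Proof.
move=> Uo fC Up e0.
have N1 : \forall y \near p, U y by exact: (open_nbhs_nbhs (conj Uo Up)).
have N2 : \forall y \near p, `|partial j (partial i f) p - partial j (partial i f) y| <= e.
  by have /cvgrPdist_le/(_ _ e0) := Ck_cont (Ck_partial j (Ck_partial i fC)) Up.
have /near_boxP[d d0 H] : \forall y \near p, U y /\
   `|partial j (partial i f) p - partial j (partial i f) y| <= e.
  by near=> y; split; near: y.
exists (d / 2); first by rewrite divr_gt0.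
move=> h /andP[h0 hd].
have dist (a b : R) k : `|a| <= h -> `|b| <= h -> `|p 0 k - box i j p a b 0 k| < d.
  move=> ah bh; rewrite /box !mxE.
  have -> m n : p 0 k - (p 0 k + a * m%:R + b * n%:R) = - (a * m%:R + b * n%:R) :> R by ring.
  rewrite normrN (le_lt_trans (ler_normD _ _))// (splitr d) !normrM !normr_nat.
  by rewrite ltrD// (le_lt_trans _ hd)//; [apply: le_trans ah|apply: le_trans bh];
    rewrite ler_piMr// lern1 leq_b1.
have BU (a b : R) : `|a| <= h -> `|b| <= h -> U (box i j p a b).
  by move=> ah bh; apply (H (box i j p a b)) => k; exact: dist.
have inner (a : R) : `|a| <= h -> `|partial i f (box i j p a h) - partial i f (box i j p a 0)
   - partial j (partial i f) p * h| <= e * h.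
  move=> ah.
  have := @MVT_bound R (fun b => partial i f (box i j p a b))
    (fun b => partial j (partial i f) (box i j p a b)) 0 h (partial j (partial i f) p) e.
  rewrite !subr0 (gtr0_norm h0); apply => s; rewrite subr0 => sh.
    apply: is_derive_line; apply: partial_is_derive.
    by apply: Ck_derivable (Ck_partial i fC) _; exact: BU.
  by rewrite distrC; apply (H (box i j p a s)) => k; exact: dist.
have h' : `|h| <= h by rewrite gtr0_norm.
have h0' : `|0 : R| <= h by rewrite normr0 ltW.
have := @MVT_bound R (fun a => f (box i j p a h) - f (box i j p a 0))
    (fun a => partial i f (box i j p a h) - partial i f (box i j p a 0)) 0 h
    (partial j (partial i f) p * h) (e * h).
rewrite !subr0 (gtr0_norm h0); apply => s; rewrite subr0 => sh; last exact: inner.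
have lineD (b : R) : `|b| <= h ->
    is_derive s 1 (fun a => f (box i j p a b)) (partial i f (box i j p s b)).
  move=> bh; apply: is_derive_shift_line; apply: partial_is_derive.
  by apply: (Ck_derivable fC); exact: (BU s b).
by apply: is_deriveB; exact: lineD.
Unshelve. all: by end_near. Qed.

(** The second difference over a square is symmetric in the two directions, so both mixed
    derivatives approximate the same number divided by [h^2]. *)
Lemma Schwarz U f p i j : open U -> Ck 2 U f -> U p ->
  partial i (partial j f) p = partial j (partial i f) p.
Proof.
move=> Uo fC Up; apply/eqP; rewrite -subr_eq0 -normr_le0; apply/ler_addgt0Pr => e e0.
rewrite add0r.
have e20 : 0 < e / 2 by rewrite divr_gt0.
have [d1 d10 H1] := second_difference i j Uo fC Up e20.
have [d2 d20 H2] := second_difference j i Uo fC Up e20.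
pose h := Num.min d1 d2 / 2.
have m0 : 0 < Num.min d1 d2 by rewrite lt_min d10.
have h0 : 0 < h by rewrite divr_gt0.
have hm : h < Num.min d1 d2 by rewrite ltr_pdivrMr// ltr_pMr// ltr1n.
have hd1 : h < d1 by apply: lt_le_trans hm _; rewrite ge_min lexx.
have hd2 : h < d2 by apply: lt_le_trans hm _; rewrite ge_min lexx orbT.
have {}H1 := H1 h; have {}H2 := H2 h.
rewrite h0 hd1 in H1; rewrite h0 hd2 in H2.
have E a b : box i j p a b = box j i p b a by rewrite /box addrAC.
move: (H1 isT) (H2 isT); rewrite !E.
set A := f _; set B := f _; set C := f _; set D := f _ => G1 G2.
have hh : 0 < h * h by rewrite mulr_gt0.
rewrite -(ler_pM2r hh) -{1}(gtr0_norm hh) -normrM.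
have alg (a b c d l m k : R) : (l - m) * (k * k) =
  (a - b - (c - d) - m * k * k) - (a - c - (b - d) - l * k * k) by ring.
rewrite (alg A B C D).
apply: le_trans (ler_normB _ _) _.
have -> : e * (h * h) = e / 2 * h * h + e / 2 * h * h by rewrite -2!mulrDl -splitr mulrA.
exact: lerD G1 G2.
Qed.

End Comp.

(** * Affine maps and geodesics *)

Section AffineAlgebra.
Variable R : comNzRingType.

(** Here [f] and [h] stand for the Jacobians of the inner and outer map, [ff] and [hh] for their
    second derivatives. Once these are eliminated by the two transformation laws, the law for the
    composite is a polynomial identity. *)
Lemma affine_comp_alg (i j k : 'I_2) (hh h f : 'I_2 -> 'I_2 -> R) (ff G : 'I_2 -> R)
    (G' : 'I_2 -> 'I_2 -> 'I_2 -> R) (G'' : 'I_2 -> 'I_2 -> R) :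
  (forall b a, hh b a + \sum_m \sum_n h b m * h a n * G'' m n = \sum_l G' b a l * h l k) ->
  (forall a, ff a + \sum_m \sum_n f i m * f j n * G' m n a = \sum_l G l * f l a) ->
  \sum_a ((\sum_b hh b a * f i b) * f j a + h a k * ff a)
  + \sum_m \sum_n (\sum_a h a m * f i a) * (\sum_a h a n * f j a) * G'' m n
  = \sum_l G l * (\sum_a h a k * f l a).
Proof.
move=> H1 H2.
have E1 b a : hh b a = \sum_l G' b a l * h l k - \sum_m \sum_n h b m * h a n * G'' m n.
  by rewrite -H1 addrK.
have E2 a : ff a = \sum_l G l * f l a - \sum_m \sum_n f i m * f j n * G' m n a.
  by rewrite -H2 addrK.
rewrite !sum2 !E1 !E2 !sum2; ring.
Qed.

End AffineAlgebra.

Lemma is_deriveMl (R : realType) (V : normedModType R) (f g : V -> R) (x v : V) (df dg : R) :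
  is_derive x v f df -> is_derive x v g dg ->
  is_derive x v (fun y => f y * g y) (df * g x + f x * dg).
Proof. by move=> fd gd; rewrite addrC (mulrC df); exact: is_deriveM. Qed.

Section Affine.
Variable R : realType.
Implicit Types (p x y v : plane R) (f g : plane R -> R) (U V : set (plane R)).
Implicit Types (F H : plane R -> plane R) (G : christoffel R).

Lemma affine_map_sub U V G G' F : V `<=` U -> affine_map U G G' F -> affine_map V G G' F.
Proof.
move=> VU [Fs Fe]; split=> [k n|x /VU]; last exact: Fe.
exact: Ck_sub VU (Fs k n).
Qed.

Lemma affine_map_ext U G G' F H : open U -> (forall x, U x -> F x = H x) ->
  affine_map U G G' F -> affine_map U G G' H.
Proof.
move=> Uo FH [Fs Fe].
have e k y : U y -> component F k y = component H k y.
  by move=> Uy; rewrite /component FH.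
split=> [k n|x Ux i j k]; first exact: Ck_ext (e k) (Fs k n).
have e1 a b y : U y -> partial a (component F b) y = partial a (component H b) y.
  by move=> Uy; apply: (partial_ext a Uo Uy); exact: e.
have := Fe x Ux i j k.
rewrite (partial_ext i Uo Ux (e1 j k)).
under eq_bigr do under eq_bigr do rewrite !e1// FH//.
by move->; apply: eq_bigr => l _; rewrite e1.
Qed.

Lemma partialM (f g : plane R -> R) x i :
  derivable f x (coord_vec R i) -> derivable g x (coord_vec R i) ->
  partial i (fun y => f y * g y) x = partial i f x * g x + f x * partial i g x.
Proof.
move=> fd gd; suff [_ E] : is_derive x (coord_vec R i) (fun y => f y * g y)
    (partial i f x * g x + f x * partial i g x) by exact: E.
by apply: is_deriveMl; exact: partial_is_derive.
Qed.

Lemma partial_sum2 (f : 'I_2 -> plane R -> R) x i :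
  (forall a, derivable (f a) x (coord_vec R i)) ->
  partial i (fun y => \sum_a f a y) x = \sum_a partial i (f a) x.
Proof.
move=> fd; suff [_ E] : is_derive x (coord_vec R i) (fun y => \sum_a f a y)
    (\sum_a partial i (f a) x) by exact: E.
under eq_fun do rewrite sum2.
by rewrite sum2; apply: is_deriveD; exact: partial_is_derive.
Qed.

Lemma affine_map_comp U V G G' G'' F H : open U -> open V ->
  (forall x, U x -> V (F x)) -> affine_map U G G' F -> affine_map V G' G'' H ->
  affine_map U G G'' (H \o F).
Proof.
move=> Uo Vo UV [Fs Fe] [Hs He].
split=> [k n|x Ux i j k].
  by apply: (@Ck_comp _ n U V (component H k) F Uo Vo UV) => [a|]; [exact: Fs|exact: Hs].
have d1 a b y : U y -> partial a (component (H \o F) b) y =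
    \sum_c partial c (component H b) (F y) * partial a (component F c) y.
  by move=> Uy; apply: (partial_comp _ Uo Vo UV) => // [c|]; [exact: Fs|exact: Hs].
rewrite (partial_ext i Uo Ux (d1 j k)).
have D1 c : derivable (fun y => partial c (component H k) (F y)) x (coord_vec R i).
  apply: (Ck_derivable (k := 0) (U := U)) Ux.
  apply: (@Ck_comp _ 1 U V (partial c (component H k)) F Uo Vo UV) => [a|]; first exact: Fs.
  exact: Ck_partial (Hs k 2%N).
have D2 c : derivable (partial j (component F c)) x (coord_vec R i).
  by apply: Ck_derivable Ux; exact: Ck_partial (Fs c 2%N).
rewrite partial_sum2; last by move=> c; exact: derivableM.
have d2 c : partial i (fun y => partial c (component H k) (F y) * partial j (component F c) y) x
   = (\sum_b partial b (partial c (component H k)) (F x) * partial i (component F b) x) *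
     partial j (component F c) x +
     partial c (component H k) (F x) * partial i (partial j (component F c)) x.
  rewrite partialM//; congr (_ * _ + _).
  by apply: (partial_comp _ Uo Vo UV) => // [a|]; [exact: Fs|exact: Ck_partial (Hs k 2%N)].
under eq_bigr do rewrite d2.
under [X in _ + X]eq_bigr do under eq_bigr do rewrite !d1//.
under [RHS]eq_bigr do rewrite d1//.
apply: (affine_comp_alg (hh := fun b a => partial b (partial a (component H k)) (F x))
  (h := fun a m => partial a (component H m) (F x))
  (f := fun a m => partial a (component F m) x)
  (ff := fun a => partial i (partial j (component F a)) x) (G' := G' (F x))) => [b a|a].
  by apply: He; exact: UV.
exact: Fe.
Qed.

End Affine.

Section Curves.
Variable R : realType.
Implicit Types (U V : set (plane R)) (F : plane R -> plane R) (G : christoffel R).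
Implicit Types (c : R -> plane R).

Definition coordf c (k : 'I_2) (s : R) : R := c s 0 k.

Definition geodesic_at G c (t : R) := forall k,
  [/\ derivable (coordf c k) t 1, derivable (derive1 (coordf c k)) t 1 &
      derive1 (derive1 (coordf c k)) t +
        \sum_i \sum_j G (c t) i j k * derive1 (coordf c i) t * derive1 (coordf c j) t = 0].

Lemma derive1P (h : R -> R) t : derivable h t 1 -> is_derive t 1 h (derive1 h t).
Proof. by rewrite derive1E => /derivableP. Qed.

Lemma curve_cont c t : (forall k, derivable (coordf c k) t 1) -> {for t, continuous c}.
Proof.
move=> H; apply/differentiable_continuous/derivable1_diffP/derivable_mxP => i j.
by rewrite ord1; exact: H.
Qed.

Lemma near_in U c t : open U -> U (c t) -> {for t, continuous c} ->
  \forall s \near t, U (c s).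
Proof.
move=> Uo Uc cc; have N : nbhs (c t) U by apply: open_nbhs_nbhs; split.
exact: cc.
Qed.

Lemma push_velocity U G G' F c t : open U -> affine_map U G G' F -> U (c t) ->
  (forall k, derivable (coordf c k) t 1) ->
  forall k, is_derive t 1 (coordf (F \o c) k)
    (\sum_a partial a (component F k) (c t) * derive1 (coordf c a) t).
Proof.
move=> Uo [Fs Fe] Uc cd k.
apply: (@chain_curve R (component F k) c) => [|i]; last exact/derive1P/cd.
exact: C1_of_Ck Uo Uc (Fs k 1%N).
Qed.

Lemma geodesic_push_alg (K : comNzRingType) (k : 'I_2) (pp p : 'I_2 -> 'I_2 -> K) (w a : 'I_2 -> K)
    (G : 'I_2 -> 'I_2 -> 'I_2 -> K) (G' : 'I_2 -> 'I_2 -> K) :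
  (forall i j, pp i j + \sum_m \sum_n p i m * p j n * G' m n = \sum_l G i j l * p l k) ->
  (forall l, a l + \sum_i \sum_j G i j l * w i * w j = 0) ->
  \sum_j ((\sum_i pp i j * w i) * w j + p j k * a j) +
  \sum_m \sum_n G' m n * (\sum_i p i m * w i) * (\sum_i p i n * w i) = 0.
Proof.
move=> H1 H2.
have E1 i j : pp i j = \sum_l G i j l * p l k - \sum_m \sum_n p i m * p j n * G' m n.
  by rewrite -H1 addrK.
have E2 l : a l = - \sum_i \sum_j G i j l * w i * w j.
  by apply/eqP; rewrite -subr_eq0 opprK H2.
rewrite !sum2 !E1 !E2 !sum2; ring.
Qed.

(** Derivability near [t] is a separate hypothesis because [geodesic_at] speaks of the coordinates
    at [t] only, while the formula for the pushed velocity has to hold on a neighbourhood before it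
    can be differentiated. *)
Lemma geodesic_push U G G' F c t : open U -> affine_map U G G' F -> U (c t) ->
  (\forall s \near t, forall k, derivable (coordf c k) s 1) ->
  geodesic_at G c t -> geodesic_at G' (F \o c) t.
Proof.
move=> Uo FA Uc cd cg k.
have cd0 i : derivable (coordf c i) t 1 by have [] := cg i.
have near_U := near_in Uo Uc (curve_cont cd0).
have vE i : \forall s \near t, \sum_a partial a (component F i) (c s) * derive1 (coordf c a) s
    = derive1 (coordf (F \o c) i) s.
  near=> s; have [//||_ <-] := push_velocity Uo FA (c := c) (t := s) _ _ i.
  - by near: s.
  - by near: s.
  - by rewrite derive1E.
have v0 i := nbhs_singleton (vE i).
have [Fs Fe] := FA.
have acc : is_derive t 1 (derive1 (coordf (F \o c) k))
   (\sum_j ((\sum_i partial i (partial j (component F k)) (c t) * derive1 (coordf c i) t)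
     * derive1 (coordf c j) t + partial j (component F k) (c t) * derive1 (derive1 (coordf c j)) t)).
  apply: (near_eq_is_derive (vE k)).
  have D j : is_derive t 1 (fun s => partial j (component F k) (c s) * derive1 (coordf c j) s)
     ((\sum_i partial i (partial j (component F k)) (c t) * derive1 (coordf c i) t)
     * derive1 (coordf c j) t + partial j (component F k) (c t) * derive1 (derive1 (coordf c j)) t).
    apply: is_deriveMl.
      apply: chain_curve => [|i]; last exact/derive1P/cd0.
      exact: C1_of_Ck Uo Uc (Ck_partial j (Fs k 2%N)).
    by apply: derive1P; have [] := cg j.
  under eq_fun do rewrite sum2.
  by rewrite sum2; apply: is_deriveD; exact: D.
split.
- by have [] := push_velocity Uo FA Uc cd0 k.
- by case: acc.
have -> : derive1 (derive1 (coordf (F \o c) k)) t =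
    \sum_j ((\sum_i partial i (partial j (component F k)) (c t) * derive1 (coordf c i) t)
     * derive1 (coordf c j) t + partial j (component F k) (c t) * derive1 (derive1 (coordf c j)) t).
  by rewrite derive1E; case: acc.
under [X in _ + X]eq_bigr do under eq_bigr do rewrite -!v0.
apply: (geodesic_push_alg (pp := fun i j => partial i (partial j (component F k)) (c t))
  (p := fun i m => partial i (component F m) (c t)) (w := fun i => derive1 (coordf c i) t)
  (a := fun i => derive1 (derive1 (coordf c i)) t) (G := G (c t))
  (G' := fun m n => G' (F (c t)) m n k)) => [i j|l]; first exact: Fe.
by have [] := cg l.
Unshelve. all: by end_near. Qed.

End Curves.

(** * Charts and transition maps *)

Section Charts.
Variable R : realType.
Variable M : affineSurface R.
Implicit Types (c d : chart R M) (G : christoffel R) (sigma : R -> M) (J : set R).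

Lemma open_dom_near c (T : topologicalType) (f : T -> M) t : {for t, continuous f} -> dom c (f t) ->
  \forall s \near t, dom c (f s).
Proof.
move=> fc H; have N : nbhs (f t) (dom c) by apply: open_nbhs_nbhs; split=> //; exact: dom_open.
exact: fc.
Qed.

Lemma open_param c (A : set M) : open A -> open [set x | cod c x /\ A (param c x)].
Proof.
move=> Ao; rewrite openE => x [cx Ax].
have N1 : \forall y \near x, cod c y by apply: open_nbhs_nbhs; split=> //; exact: cod_open.
have N2 : \forall y \near x, A (param c y).
  have N : nbhs (param c x) A by apply: open_nbhs_nbhs; split.
  exact: (@param_cont _ _ c x cx).
by rewrite /interior; near=> y; split; near: y.
Unshelve. all: by end_near. Qed.

(** The set is spelled as [chart_affine] unfolds for [setT] and [id], so that the lemma applies to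
    it directly. *)
Lemma open_overlap c d : open [set x | [/\ cod c x, [set: M] (param c x) & dom d (id (param c x))]].
Proof.
rewrite (_ : [set x | _] = [set x | cod c x /\ dom d (param c x)]).
  by apply: open_param; exact: dom_open.
by apply/seteqP; split=> x /= []; split.
Qed.

Lemma geodesic_at_ext G (x y : R -> plane R) (t : R) :
  (\forall s \near t, x s = y s) -> geodesic_at G x t -> geodesic_at G y t.
Proof.
move=> xy H.
have E i : \forall s \near t, coordf x i s = coordf y i s.
  by apply: filterS xy => s; rewrite /coordf => ->.
have E1 i : \forall s \near t, derive1 (coordf x i) s = derive1 (coordf y i) s.
  have /near_join := E i; apply: filterS => s Hs.
  by rewrite !derive1E; exact: near_eq_derive.
move=> k; have [H1 H2 H3] := H k; split.
- exact: near_eq_derivable (E k) H1.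
- exact: near_eq_derivable (E1 k) H2.
- apply: etrans H3; rewrite !(derive1E (derive1 _)) (near_eq_derive _ (E1 k)).
  rewrite -(nbhs_singleton xy); congr (_ + _).
  apply: eq_bigr => i _; apply: eq_bigr => j _.
  by rewrite !(nbhs_singleton (E1 _)).
Qed.

Lemma geodesicP J sigma : geodesic J sigma <->
  [/\ open J, is_interval J & forall t, J t -> {for t, continuous sigma} /\
    forall d, atlas d -> dom d (sigma t) -> geodesic_at (gamma d) (coord d \o sigma) t].
Proof. by []. Qed.

(** [geodesic] tests atlas charts only. An atlas chart [d] around the point is chosen and the
    geodesic equation is pushed along the transition map from [d] to [c]. *)
Lemma geodesic_chart J sigma c G : geodesic J sigma -> local_coordinates c G ->
  forall t, J t -> dom c (sigma t) -> geodesic_at G (coord c \o sigma) t.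
Proof.
move=> /geodesicP[Jo Ji H] cG t Jt ct.
have [sc sg] := H t Jt.
have [d ad dt] := atlas_cover (sigma t).
have [_ /= dc] := cG d ad.
rewrite /chart_affine in dc; set W := [set x | _] in dc.
have Wo : open W by exact: open_overlap.
have nJ : \forall s \near t, J s by apply: open_nbhs_nbhs; split.
have nd : \forall s \near t, dom d (sigma s) by exact: open_dom_near.
apply: (@geodesic_at_ext G ((coord c \o id \o param d) \o (coord d \o sigma))).
  by apply: filterS nd => s ds; rewrite /= coordK.
apply: (geodesic_push Wo dc).
- split=> //=; [exact: coord_cod|by rewrite coordK].
- near=> s => k; have Js : J s by near: s. have ds : dom d (sigma s) by near: s.
  by have [_ /(_ d ad ds k)[]] := H s Js.
- exact: sg.
Unshelve. all: by end_near. Qed.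

Lemma chart_geodesic J (x : R -> plane R) c G : local_coordinates c G -> open J ->
  is_interval J -> (forall t, J t -> cod c (x t) /\ geodesic_at G x t) ->
  geodesic J (param c \o x).
Proof.
move=> cG Jo Ji H; apply/geodesicP; split=> // t Jt.
have [cx xg] := H t Jt.
have xc : {for t, continuous x} by apply: curve_cont => k; have [] := xg k.
split.
  by apply: continuous_comp => //; exact: param_cont.
move=> d ad dt.
have [/= cd _] := cG d ad.
rewrite /chart_affine in cd; set W := [set x | _] in cd.
have Wo : open W by exact: open_overlap.
have nJ : \forall s \near t, J s by apply: open_nbhs_nbhs; split.
apply: (geodesic_push Wo cd (c := x)) => //.
near=> s => k; have Js : J s by near: s.
by have [_ /(_ k)[]] := H s Js.
Unshelve. all: by end_near. Qed.

(** [local_coordinates] compares a chart with the atlas only, so the transition map is composed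
    through an atlas chart [d] around [p], and [W] is cut down to the domain of [d]. The inverse is
    recorded because it makes the Jacobian invertible. *)
Lemma transition c c' G G' p : local_coordinates c G -> local_coordinates c' G' ->
  dom c p -> dom c' p -> exists W : set (plane R),
  [/\ open W, W (coord c p), affine_map W G G' (coord c' \o param c) &
   exists W' : set (plane R), [/\ open W', affine_map W' G' G (coord c \o param c') &
   forall x, W x -> W' ((coord c' \o param c) x) /\
     (coord c \o param c') ((coord c' \o param c) x) = x]].
Proof.
move=> cG cG' cp cp'.
have [d ad dp] := atlas_cover p.
pose Wof (a b : chart R M) := [set x | cod a x /\ (dom d `&` dom b) (param a x)].
have Wo a b : open (Wof a b) by apply: open_param; apply: openI; exact: dom_open.
have H a b Ga Gb : local_coordinates a Ga -> local_coordinates b Gb ->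
    affine_map (Wof a b) Ga Gb (coord b \o param a).
  move=> /(_ d ad)[/= ad1 _] /(_ d ad)[_ /= bd2].
  rewrite /chart_affine in ad1 bd2; set W1 := [set x | _] in ad1; set W2 := [set x | _] in bd2.
  have s1 : Wof a b `<=` W1 by move=> x [? [? _]]; split.
  have A := affine_map_sub s1 ad1.
  have sub12 x : Wof a b x -> W2 ((coord d \o id \o param a) x).
    move=> [ax [dx bx]]; split=> //=; first exact: coord_cod.
    by rewrite coordK.
  have W2o : open W2 by exact: open_overlap.
  apply: affine_map_ext (affine_map_comp (Wo a b) W2o sub12 A bd2) => //.
  by move=> x [ax [dx bx]] /=; rewrite coordK.
exists (Wof c c'); split=> //.
- by split; [exact: coord_cod|rewrite coordK].
- exact: H.
exists (Wof c' c); split=> //; first exact: H.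
move=> x [cx [dx c'x]]; split=> /=; last by rewrite coordK// paramK.
by split; [exact: coord_cod|rewrite /= coordK//; split=> //; exact: param_dom].
Qed.

End Charts.

(** * Curvature and integrability *)

Section ConstSymbols.
Variable R : realType.
Implicit Types (U V : set (plane R)) (F : plane R -> plane R) (C : symbols R).

(* [nabla_u v] for constant vector fields; it makes the plane a commutative algebra. *)
Definition cprod C (u v : plane R) : plane R :=
  \row_k \sum_i \sum_j u 0 i * v 0 j * C i j k.

Lemma partial_const_row (u : plane R) i k : partial i (component (fun=> u) k) = cst 0.
Proof. exact: partial_cst. Qed.

Lemma nabla_cst C u v : nabla (fun=> C) (fun=> u) (fun=> v) = fun=> cprod C u v.
Proof.
apply/funext => x; apply/rowP => k; rewrite !mxE big1 ?add0r// => i _.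
by rewrite partial_const_row mulr0.
Qed.

Lemma bracket_cst (u v : plane R) : bracket (fun=> u) (fun=> v) = fun=> 0.
Proof.
apply/funext => x; apply/rowP => k; rewrite !mxE big1// => i _.
by rewrite !partial_const_row !mulr0 subrr.
Qed.

Lemma cprod0l C v : cprod C 0 v = 0.
Proof.
by apply/rowP => k; rewrite !mxE big1// => i _; rewrite big1// => j _; rewrite mxE !mul0r.
Qed.

Definition ccurv C (u v w : plane R) : plane R :=
  cprod C u (cprod C v w) - cprod C v (cprod C u w).

Lemma curvature_cst C u v w :
  curvature (fun=> C) (fun=> u) (fun=> v) (fun=> w) = fun=> ccurv C u v w.
Proof.
rewrite /curvature bracket_cst !nabla_cst cprod0l.
by apply/funext => x; rewrite [in LHS]/GRing.add/= /GRing.opp/= subr0.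
Qed.

Definition cnablaR C (u v w z : plane R) : plane R :=
  cprod C u (ccurv C v w z) - ccurv C (cprod C u v) w z
  - ccurv C v (cprod C u w) z - ccurv C v w (cprod C u z).

Lemma nabla_curvature_cst C u v w z :
  nabla_curvature (fun=> C) (fun=> u) (fun=> v) (fun=> w) (fun=> z) = fun=> cnablaR C u v w z.
Proof. by rewrite /nabla_curvature !(nabla_cst, curvature_cst). Qed.

Lemma cprodE C u v k : cprod C u v 0 k =
  u 0 0 * v 0 0 * C 0 0 k + u 0 0 * v 0 1 * C 0 1 k +
  (u 0 1 * v 0 0 * C 1 0 k + u 0 1 * v 0 1 * C 1 1 k).
Proof. by rewrite mxE !sum2. Qed.

(* The l-th component of R(d_0, d_1) d_j. *)
Definition curv01 C (j l : 'I_2) : R :=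
  \sum_a (C 1 j a * C 0 a l - C 0 j a * C 1 a l).

Lemma coord_vecs : ((coord_vec R 0 0 0 = 1) * (coord_vec R 0 0 1 = 0) *
  (coord_vec R 1 0 0 = 0) * (coord_vec R 1 0 1 = 1))%type.
Proof. by rewrite !coord_vecE. Qed.

(** In the trace over [sigma], the term with [sigma = d_i] vanishes by antisymmetry of [R]. The
    other one involves [R(d_1, d_0)] for [i = 0], whence the sign, and [R(d_0, d_1)] for [i = 1]. *)
Definition rho C (i j : 'I_2) : R := if i == 0 then - curv01 C j 1 else curv01 C j 0.

Lemma ricciE C x : ricci (fun=> C) x = \matrix_(i, j) rho C i j.
Proof.
have E i j a b : curvature (fun=> C) (@coord_field R a) (@coord_field R i) (@coord_field R j) x 0 b =
    ccurv C (coord_vec R a) (coord_vec R i) (coord_vec R j) 0 b.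
  by rewrite /coord_field curvature_cst.
apply/matrixP => i j; rewrite !mxE /mxtrace.
under eq_bigr do rewrite mxE E.
rewrite sum2; clear E x.
have F u v w k : ccurv C u v w 0 k = cprod C u (cprod C v w) 0 k - cprod C v (cprod C u w) 0 k.
  by rewrite !mxE.
rewrite !F !cprodE /rho /curv01 !sum2.
by case: (ord2P i) => ->; case: (ord2P j) => ->; rewrite !coord_vecs /=; ring.
Qed.

End ConstSymbols.

Section IntegrabilityAlgebra.
Variable K : comNzRingType.
Implicit Types C : 'I_2 -> 'I_2 -> 'I_2 -> K.
Variables (C C' : 'I_2 -> 'I_2 -> 'I_2 -> K) (P : 'I_2 -> 'I_2 -> K).
Hypotheses (Cs : forall i j k, C i j k = C j i k) (C's : forall i j k, C' i j k = C' j i k).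

Let S i j k := \sum_l C i j l * P l k - \sum_a \sum_b P i a * P j b * C' a b k.

(** The hypothesis equates the two orders of the third derivative [d_0 d_1 d_j F^k], obtained by
    differentiating the affine equation and replacing second derivatives by [S]; [P] is the
    Jacobian. Only the curvatures survive. The determinant appears because [R] is a 2-form in its
    first two arguments. *)
Lemma integrability_alg j k :
  \sum_l C 1 j l * S 0 l k - \sum_a \sum_b (S 0 1 a * P j b + P 1 a * S 0 j b) * C' a b k =
  \sum_l C 0 j l * S 1 l k - \sum_a \sum_b (S 1 0 a * P j b + P 0 a * S 1 j b) * C' a b k ->
  \sum_l (\sum_a (C 1 j a * C 0 a l - C 0 j a * C 1 a l)) * P l k =
  (P 0 0 * P 1 1 - P 0 1 * P 1 0) *
  \sum_b P j b * \sum_a (C' 1 b a * C' 0 a k - C' 0 b a * C' 1 a k).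
Proof.
move/eqP; rewrite -subr_eq0 => /eqP H; apply/eqP; rewrite -subr_eq0; apply/eqP; apply: etrans H.
by rewrite /S !sum2 !(Cs 1 0) !(C's 1 0); ring.
Qed.

End IntegrabilityAlgebra.

Section Integrability.
Variable R : realType.
Implicit Types (U V W : set (plane R)) (F : plane R -> plane R) (C : typeA R).

Lemma is_derive_sum2 (V : normedModType R) (f : 'I_2 -> V -> R) (x v : V) (df : 'I_2 -> R) :
  (forall a, is_derive x v (f a) (df a)) -> is_derive x v (fun y => \sum_a f a y) (\sum_a df a).
Proof.
by move=> H; under eq_fun do rewrite sum2; rewrite sum2; exact: is_deriveD.
Qed.

Lemma is_derive_mulr (V : normedModType R) (f : V -> R) (x v : V) (df c : R) :
  is_derive x v f df -> is_derive x v (fun y => f y * c) (df * c).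
Proof.
move=> H; rewrite -[df * c]addr0 -[X in _ + X](mulr0 (f x)).
exact: (is_deriveMl H (is_derive_cst c x v)).
Qed.

Lemma is_derive_mull (V : normedModType R) (f : V -> R) (x v : V) (df c : R) :
  is_derive x v f df -> is_derive x v (fun y => c * f y) (c * df).
Proof.
by move=> H; rewrite mulrC; under eq_fun do rewrite mulrC; exact: is_derive_mulr.
Qed.

Definition jac F (x : plane R) (i k : 'I_2) : R := partial i (component F k) x.
Definition jacdet F x : R := jac F x 0 0 * jac F x 1 1 - jac F x 0 1 * jac F x 1 0.

Lemma affine_second U (C C' : typeA R) F x i j k : affine_map U (fun=> symb C) (fun=> symb C') F -> U x ->
  partial i (partial j (component F k)) x =
  \sum_l symb C i j l * jac F x l k - \sum_a \sum_b jac F x i a * jac F x j b * symb C' a b k.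
Proof. by move=> [_ H] Ux; rewrite -(H x Ux i j k) addrK. Qed.

Lemma jac_is_derive U F x i k m : open U -> smooth_map U F -> U x ->
  is_derive x (coord_vec R m) (fun y => jac F y i k) (partial m (partial i (component F k)) x).
Proof.
move=> Uo Fs Ux; apply: partial_is_derive.
exact: Ck_derivable (Ck_partial i (Fs k 2%N)) Ux.
Qed.

Lemma affine_third U (C C' : typeA R) F x m i j k : open U ->
  affine_map U (fun=> symb C) (fun=> symb C') F -> U x ->
  let S i j k := partial i (partial j (component F k)) x in
  partial m (partial i (partial j (component F k))) x =
  \sum_l symb C i j l * S m l k -
  \sum_a \sum_b (S m i a * jac F x j b + jac F x i a * S m j b) * symb C' a b k.
Proof.
move=> Uo FA Ux S; have [Fs _] := FA.
rewrite (partial_ext m Uo Ux (fun y Uy => affine_second i j k FA Uy)).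
suff [_ E] : is_derive x (coord_vec R m) (fun y => \sum_l symb C i j l * jac F y l k -
    \sum_a \sum_b jac F y i a * jac F y j b * symb C' a b k)
  (\sum_l symb C i j l * S m l k -
  \sum_a \sum_b (S m i a * jac F x j b + jac F x i a * S m j b) * symb C' a b k).
  exact: E.
have D a b := jac_is_derive a b m Uo Fs Ux.
apply: is_deriveB.
  by apply: is_derive_sum2 => a; exact: is_derive_mull (D a k).
apply: is_derive_sum2 => a; apply: is_derive_sum2 => b.
exact: is_derive_mulr (is_deriveMl (D i a) (D j b)).
Qed.

Lemma curv01_pull U (C C' : typeA R) F x j k : open U ->
  affine_map U (fun=> symb C) (fun=> symb C') F -> U x ->
  \sum_l curv01 (symb C) j l * jac F x l k =
  jacdet F x * \sum_b jac F x j b * curv01 (symb C') b k.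
Proof.
move=> Uo FA Ux; have [Fs _] := FA.
pose S i j k := \sum_l symb C i j l * jac F x l k -
  \sum_a \sum_b jac F x i a * jac F x j b * symb C' a b k.
have E m i : partial m (partial i (partial j (component F k))) x =
    \sum_l symb C i j l * S m l k -
    \sum_a \sum_b (S m i a * jac F x j b + jac F x i a * S m j b) * symb C' a b k.
  rewrite (affine_third m i j k Uo FA Ux); congr (_ - _).
    by apply: eq_bigr => l _; rewrite (affine_second m l k FA Ux).
  apply: eq_bigr => a _; apply: eq_bigr => b _.
  by rewrite (affine_second m i a FA Ux) (affine_second m j b FA Ux).
have := etrans (esym (E 0 1)) (etrans (Schwarz 0 1 Uo (Ck_partial j (Fs k 3%N)) Ux) (E 1 0)).
exact: (integrability_alg (P := jac F x) (symb_sym C) (symb_sym C')).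
Qed.

(** Cramer's rule: the determinant produced by the 2-form cancels the one in the inverse Jacobian,
    so the Ricci tensor is pulled back without denominators. *)
Lemma rho_pull_alg (K : fieldType) (P : 'I_2 -> 'I_2 -> K) (r S : 'I_2 -> K) :
  P 0 0 * P 1 1 - P 0 1 * P 1 0 != 0 ->
  (forall k, \sum_l r l * P l k = (P 0 0 * P 1 1 - P 0 1 * P 1 0) * S k) ->
  r 0 = S 0 * P 1 1 - S 1 * P 1 0 /\ r 1 = S 1 * P 0 0 - S 0 * P 0 1.
Proof.
move=> d0 H; have := H 0; have := H 1; rewrite !sum2 => H1 H0.
set d := _ - _ in d0 H0 H1.
split; apply: (mulfI d0).
  have -> : d * (S 0 * P 1 1 - S 1 * P 1 0) = (d * S 0) * P 1 1 - (d * S 1) * P 1 0 by ring.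
  by rewrite -H0 -H1 /d; ring.
have -> : d * (S 1 * P 0 0 - S 0 * P 0 1) = (d * S 1) * P 0 0 - (d * S 0) * P 0 1 by ring.
by rewrite -H0 -H1 /d; ring.
Qed.

Lemma rho_pull U (C C' : typeA R) F x i j : open U ->
  affine_map U (fun=> symb C) (fun=> symb C') F -> U x -> jacdet F x != 0 ->
  rho (symb C) i j = \sum_a \sum_b jac F x i a * jac F x j b * rho (symb C') a b.
Proof.
move=> Uo FA Ux d0.
have [r0 r1] := rho_pull_alg d0 (fun k => curv01_pull j k Uo FA Ux).
by rewrite /rho; case: (ord2P i) => -> /=; rewrite ?r0 ?r1;
  move: (jac F x) (curv01 (symb C')) => P c; rewrite !sum2 /=; ring.
Qed.

(** [R(d_0, d_1)] is the commutator of the multiplications by [d_0] and [d_1], hence has trace zero;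
    this is the only nontrivial case of the symmetry. *)
Lemma rho_sym C i j : rho (symb C) i j = rho (symb C) j i.
Proof.
have Cs := symb_sym C.
by case: (ord2P i) => ->; case: (ord2P j) => ->; rewrite // /rho /= /curv01 !sum2 !(Cs 1 0); ring.
Qed.

Definition rhodet C : R := rho (symb C) 0 0 * rho (symb C) 1 1 - rho (symb C) 0 1 ^+ 2.

Lemma rank2_alg (K : numFieldType) (P r : 'I_2 -> 'I_2 -> K) (S : 'I_2 -> 'I_2 -> 'I_2 -> K) :
  P 0 0 * P 1 1 - P 0 1 * P 1 0 != 0 -> r 0 0 * r 1 1 - r 0 1 ^+ 2 != 0 ->
  (forall a b, r a b = r b a) -> (forall m i a, S m i a = S i m a) ->
  (forall m i j, \sum_a \sum_b (S m i a * P j b + P i a * S m j b) * r a b = 0) ->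
  forall m i a, S m i a = 0.
Proof.
move=> d0 e0 rs Ss H m i a.
pose T m i j := \sum_a \sum_b S m i a * P j b * r a b.
have Ts k l n : T k l n = T l k n by rewrite /T !sum2 !(Ss k l).
have Ta k l n : T k l n = - T k n l.
  apply/eqP; rewrite -subr_eq0 opprK -(H k l n) /T !sum2 (rs 1 0); apply/eqP; ring.
have T0 k l n : T k l n = 0.
  (* Swapping alternately the last two and the first two indices, three times each, returns to the
     same triple with sign [-1]. *)
  have E : T k l n = - T k l n.
    by rewrite {1}Ta Ts Ta opprK Ts Ta Ts.
  by apply/eqP; rewrite -[_ == 0](mulrn_eq0 _ 2) mulr2n {1}E addNr.
(* The row [S m i] is annihilated by [r] times the transpose of [P], whose determinant is this
   product; the two identities below are Cramer's rule for that system. *)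
have N : (P 0 0 * P 1 1 - P 0 1 * P 1 0) * (r 0 0 * r 1 1 - r 0 1 ^+ 2) != 0 by rewrite mulf_neq0.
have := T0 m i 0; have := T0 m i 1; rewrite /T !sum2 (rs 1 0) => H1 H0.
case: (ord2P a) => ->; apply: (mulIf N); rewrite mul0r.
  have -> : S m i 0 * ((P 0 0 * P 1 1 - P 0 1 * P 1 0) * (r 0 0 * r 1 1 - r 0 1 ^+ 2)) =
    (S m i 0 * P 0 0 * r 0 0 + S m i 0 * P 0 1 * r 0 1 + (S m i 1 * P 0 0 * r 0 1 + S m i 1 * P 0 1 * r 1 1))
     * (r 0 1 * P 1 0 + r 1 1 * P 1 1) -
    (S m i 0 * P 1 0 * r 0 0 + S m i 0 * P 1 1 * r 0 1 + (S m i 1 * P 1 0 * r 0 1 + S m i 1 * P 1 1 * r 1 1))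
     * (r 0 1 * P 0 0 + r 1 1 * P 0 1) by ring.
  by rewrite H0 H1 !mul0r subrr.
have -> : S m i 1 * ((P 0 0 * P 1 1 - P 0 1 * P 1 0) * (r 0 0 * r 1 1 - r 0 1 ^+ 2)) =
    (S m i 0 * P 1 0 * r 0 0 + S m i 0 * P 1 1 * r 0 1 + (S m i 1 * P 1 0 * r 0 1 + S m i 1 * P 1 1 * r 1 1))
     * (r 0 0 * P 0 0 + r 0 1 * P 0 1) -
    (S m i 0 * P 0 0 * r 0 0 + S m i 0 * P 0 1 * r 0 1 + (S m i 1 * P 0 0 * r 0 1 + S m i 1 * P 0 1 * r 1 1))
     * (r 0 0 * P 1 0 + r 0 1 * P 1 1) by ring.
by rewrite H0 H1 !mul0r subrr.
Qed.

(* Differentiating the constancy of the Ricci tensor, T_mij = rho(d_m d_i F, d_j F) is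
   symmetric in m, i and antisymmetric in i, j, hence zero. *)
Lemma rank2_affine U (C C' : typeA R) F : open U ->
  affine_map U (fun=> symb C) (fun=> symb C') F -> (forall x, U x -> jacdet F x != 0) ->
  rhodet C' != 0 -> forall x, U x -> forall i j k, partial i (partial j (component F k)) x = 0.
Proof.
move=> Uo FA d0 r0 x Ux; have [Fs _] := FA.
apply: (rank2_alg (S := fun i j k => partial i (partial j (component F k)) x) (d0 x Ux) r0).
- exact: rho_sym.
- by move=> m i a; apply: (Schwarz _ _ Uo (Fs a 2%N) Ux).
move=> m i j.
have D a b := jac_is_derive a b m Uo Fs Ux.
have [_ <-] : is_derive x (coord_vec R m)
  (fun y => \sum_a \sum_b jac F y i a * jac F y j b * rho (symb C') a b)
  (\sum_a \sum_b (partial m (partial i (component F a)) x * jac F x j b +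
     jac F x i a * partial m (partial j (component F b)) x) * rho (symb C') a b).
  apply: is_derive_sum2 => a; apply: is_derive_sum2 => b.
  by exact: is_derive_mulr (is_deriveMl (D i a) (D j b)).
rewrite -/(partial m _ x).
rewrite -(@partial_ext _ U (cst (rho (symb C) i j)) _ x m Uo Ux); last first.
  by move=> y Uy; exact: rho_pull Uo FA Uy (d0 y Uy).
by rewrite partial_cst.
Qed.

Lemma rank2_intertwine U (C C' : typeA R) F : open U ->
  affine_map U (fun=> symb C) (fun=> symb C') F -> (forall x, U x -> jacdet F x != 0) ->
  rhodet C' != 0 -> forall x, U x -> forall i j k,
  \sum_a \sum_b jac F x i a * jac F x j b * symb C' a b k = \sum_l symb C i j l * jac F x l k.
Proof.
move=> Uo FA d0 r0 x Ux i j k; have [_ /(_ x Ux i j k) <-] := FA.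
by rewrite (rank2_affine Uo FA d0 r0 Ux) add0r.
Qed.

Lemma jac_inverse_alg (K : comNzRingType) (q p : 'I_2 -> 'I_2 -> K) :
  (forall i k, \sum_a q a k * p i a = (i == k)%:R) ->
  (p 0 0 * p 1 1 - p 0 1 * p 1 0) * (q 0 0 * q 1 1 - q 0 1 * q 1 0) = 1.
Proof.
move=> E.
have -> : (p 0 0 * p 1 1 - p 0 1 * p 1 0) * (q 0 0 * q 1 1 - q 0 1 * q 1 0) =
  (q 0 0 * p 0 0 + q 1 0 * p 0 1) * (q 0 1 * p 1 0 + q 1 1 * p 1 1) -
  (q 0 1 * p 0 0 + q 1 1 * p 0 1) * (q 0 0 * p 1 0 + q 1 0 * p 1 1) by ring.
have := E 0 0; have := E 0 1; have := E 1 0; have := E 1 1.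
by rewrite !sum2 /= => -> -> -> ->; rewrite !mulr1 mul0r subr0.
Qed.

Lemma jacdet_neq0 W W' F F' : open W -> open W' -> smooth_map W F -> smooth_map W' F' ->
  (forall x, W x -> W' (F x) /\ F' (F x) = x) -> forall x, W x -> jacdet F x != 0.
Proof.
move=> Wo W'o Fs F's FF x Wx.
have E i k : \sum_a jac F' (F x) a k * jac F x i a = (i == k)%:R.
  have WW y : W y -> W' (F y) by move=> /FF[].
  rewrite -(partial_comp i Wo W'o WW (fun a => Fs a 1%N) (F's k 1%N) Wx).
  rewrite (@partial_ext _ W _ (fun y => y 0 k) x i Wo Wx); last by move=> y /FF[_ E]; rewrite /component E.
  by rewrite partial_coord.
apply/eqP => d0.
have := jac_inverse_alg E; rewrite -/(jacdet F x) d0 mul0r => /esym/eqP.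
by rewrite oner_eq0.
Qed.

End Integrability.

(** * Linear differential inequalities *)

Section LinearODE.
Variable R : realType.
Implicit Types (J : set R).

Lemma continuous_bounded_above (A : R -> R) (a b : R) : a <= b ->
  (forall s, a <= s <= b -> {for s, continuous A}) ->
  exists K, forall s, a <= s <= b -> A s <= K.
Proof.
move=> ab Ac.
have AC : {within `[a, b], continuous A}.
  by apply: continuous_in_subspaceT => s; rewrite inE/= in_itv/= => /Ac.
have [c _ H] := EVT_max ab AC.
by exists (A c) => s sab; apply: H; rewrite in_itv.
Qed.

Lemma MVT_cc (h dh : R -> R) (a b : R) : a <= b ->
  (forall s, a <= s <= b -> is_derive s 1 h (dh s)) ->
  exists2 c, a <= c <= b & h b - h a = dh c * (b - a).
Proof.
move=> ab H; have [|c cab E] := @MVT_segment R h dh a b ab _ (within_cont H).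
  by move=> s; rewrite in_itv/= => /andP[/ltW ? /ltW ?]; apply: H; apply/andP.
by exists c => //; move: cab; rewrite in_itv.
Qed.

(** With [K] a bound for [A] on the segment between [t0] and [t], [E exp (- K s)] does not increase
    to the right of [t0] and [E exp (K s)] does not decrease to its left. As [K] may depend on [t],
    [J] need not be compact nor [A] bounded on it. *)
Lemma gronwall_zero J (E dE A : R -> R) t0 t : is_interval J ->
  (forall s, J s -> is_derive s 1 E (dE s)) ->
  (forall s, J s -> {for s, continuous A}) ->
  (forall s, J s -> `|dE s| <= A s * E s) -> (forall s, J s -> 0 <= E s) ->
  J t0 -> J t -> E t0 = 0 -> E t = 0.
Proof.
move=> Ji Ed Ac EA E0 Jt0 Jt Et0.
have expd (K s : R) : is_derive s 1 (fun s => expR (K * s)) (expR (K * s) * K).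
  have H : is_derive s 1 (fun s => K * s) (K * 1) by exact: is_derive_mull.
  by rewrite -[X in _ * X]mulr1; exact: (@is_derive1_comp _ expR (fun s => K * s) s _ _ (is_derive_expR _) H).
have Gd (K s : R) : J s -> is_derive s 1 (fun s => E s * expR (K * s)) ((dE s + K * E s) * expR (K * s)).
  move=> Js; have := is_deriveMl (Ed s Js) (expd K s).
  by rewrite mulrDl (mulrC (expR _) K) (mulrA (E s)) (mulrC (E s) K).
apply/eqP; rewrite eq_le E0// andbT.
have [t0t|tt0] := leP t0 t.
  have JJ s : t0 <= s <= t -> J s by move=> h; exact: (Ji _ _ Jt0 Jt _ h).
  have [K HK] := continuous_bounded_above t0t (fun s h => Ac s (JJ s h)).
  pose G s := E s * expR (- K * s).
  have GD s : t0 <= s <= t -> is_derive s 1 G ((dE s + - K * E s) * expR (- K * s)).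
    by move=> /JJ; exact: Gd.
  have [c cc Gc] := MVT_cc t0t GD.
  have : G t - G t0 <= 0.
    rewrite Gc mulr_le0_ge0 ?subr_ge0// mulr_le0_ge0 ?expR_ge0//.
    rewrite mulNr subr_le0; apply: le_trans (ler_norm _) _.
    by apply: le_trans (EA _ (JJ _ cc)) _; rewrite ler_wpM2r ?E0 ?HK//; exact: JJ.
  by rewrite /G Et0 mul0r subr0 pmulr_lle0// expR_gt0.
have JJ s : t <= s <= t0 -> J s by move=> h; exact: (Ji _ _ Jt Jt0 _ h).
have [K HK] := continuous_bounded_above (ltW tt0) (fun s h => Ac s (JJ s h)).
pose G s := E s * expR (K * s).
have GD s : t <= s <= t0 -> is_derive s 1 G ((dE s + K * E s) * expR (K * s)).
  by move=> /JJ; exact: Gd.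
have [c cc Gc] := MVT_cc (ltW tt0) GD.
have : 0 <= G t0 - G t.
  rewrite Gc mulr_ge0 ?subr_ge0 ?(ltW tt0)// mulr_ge0 ?expR_ge0//.
  rewrite addrC -[dE c]opprK subr_ge0; apply: le_trans (ler_norm _) _; rewrite normrN.
  by apply: le_trans (EA _ (JJ _ cc)) _; rewrite ler_wpM2r ?E0 ?HK//; exact: JJ.
by rewrite /G Et0 mul0r sub0r oppr_ge0 pmulr_lle0// expR_gt0.
Qed.

Lemma energy_bound (x y d e : R) (p q r s : R) : d = p * x + q * y -> e = r * x + s * y ->
  `|2 * (x * d) + 2 * (y * e)| <= 2 * (`|p| + `|q| + `|r| + `|s|) * (x ^+ 2 + y ^+ 2).
Proof.
move=> -> ->.
have -> : 2 * (x * (p * x + q * y)) + 2 * (y * (r * x + s * y)) =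
  2 * (p * x ^+ 2 + (q + r) * (x * y) + s * y ^+ 2) by ring.
rewrite normrM ger0_norm// -mulrA ler_pM2l//.
have x0 := sqr_ge0 x; have y0 := sqr_ge0 y.
have xy : `|x * y| <= x ^+ 2 + y ^+ 2.
  rewrite normrM -(real_normK (num_real x)) -(real_normK (num_real y)).
  have := sqr_ge0 (`|x| - `|y|); have := normr_ge0 x; have := normr_ge0 y.
  by move: (`|x|) (`|y|) => u v u0 v0; nra.
apply: le_trans (ler_normD _ _) _.
apply: le_trans (lerD (ler_normD _ _) (lexx _)) _.
rewrite (normrM p) (normrM (q + r)) (normrM s) (ger0_norm x0) (ger0_norm y0).
have pq := ler_normD q r.
have := normr_ge0 p; have := normr_ge0 q; have := normr_ge0 r; have := normr_ge0 s.
have := normr_ge0 (x * y); have := normr_ge0 (q + r).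
move: (`|p|) (`|q|) (`|r|) (`|s|) (`|q + r|) (`|x * y|) (x ^+ 2) (y ^+ 2) pq xy x0 y0 => P Q T S' U W X Y.
move=> h1 h2 h3 h4 h5 h6 h7 h8 h9 h10.
have : U * W <= (Q + T) * (X + Y) by apply: ler_pM.
nra.
Qed.

(** Gronwall for the sum of the squares. The coefficients may be any continuous functions, including
    ones built from solutions: the difference of two solutions of a quadratic equation satisfies
    such a linear system, and this is how the lemma is applied to geodesics. *)
Lemma linear_system_unique J (D : 'I_2 -> R -> R) (L : 'I_2 -> 'I_2 -> R -> R) t0 t :
  is_interval J ->
  (forall s k, J s -> is_derive s 1 (D k) (\sum_i L i k s * D i s)) ->
  (forall s i k, J s -> {for s, continuous (L i k)}) ->
  J t0 -> J t -> (forall k, D k t0 = 0) -> forall k, D k t = 0.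
Proof.
move=> Ji Dd Lc Jt0 Jt D0.
pose E s := D 0 s ^+ 2 + D 1 s ^+ 2.
pose dD k s := \sum_i L i k s * D i s.
have Ed s : J s -> is_derive s 1 E (2 * (D 0 s * dD 0 s) + 2 * (D 1 s * dD 1 s)).
  move=> Js; have H k : is_derive s 1 (fun s => D k s ^+ 2) (2 * (D k s * dD k s)).
    have := is_deriveMl (Dd s k Js) (Dd s k Js).
    by rewrite mulrC -mulr2n mulr_natl; under eq_fun do rewrite -expr2.
  exact: is_deriveD (H 0) (H 1).
have : E t = 0.
  apply: (@gronwall_zero J E _ (fun s => 2 * (`|L 0 0 s| + `|L 1 0 s| + `|L 0 1 s| + `|L 1 1 s|)) t0 t Ji Ed) => //.
  - move=> s Js; apply: continuousM; first exact: cst_continuous.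
    have Lc' i k : {for s, continuous (fun s => `|L i k s|)}.
      by apply: continuous_comp; [exact: Lc|exact: norm_continuous].
    exact: continuousD (continuousD (continuousD (Lc' _ _) (Lc' _ _)) (Lc' _ _)) (Lc' _ _).
  - by move=> s Js; apply: energy_bound; rewrite /dD sum2.
  - by move=> s _; rewrite addr_ge0// sqr_ge0.
  - by rewrite /E !D0 expr0n addr0.
move/eqP; rewrite /E paddr_eq0 ?sqr_ge0// !sqrf_eq0 => /andP[/eqP H0 /eqP H1] k.
by case: (ord2P k) => ->.
Qed.

(** Connectedness of the line: the indicator function of [P] is locally constant, so its derivative
    is zero and it is constant. *)
Lemma loc_const (P : R -> Prop) : (forall s, \forall t \near s, P t <-> P s) ->
  forall a b, P a -> P b.
Proof.
move=> H a b Pa.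
pose g (t : R) : R := (`[< P t >])%:R.
have gd x : is_derive x (1 : R) g 0.
  have C : is_derive x (1 : R) (cst (g x)) (0 : R) by exact: is_derive_cst.
  apply: (near_eq_is_derive _ C).
  have := H x; apply: filterS => t tx; rewrite /cst /g; congr (_%:R).
  by congr nat_of_bool; apply/asbool_equiv_eq; split; apply tx.
have := is_derive_0_is_cst a b gd; rewrite /g (asboolT Pa).
by case: asboolP => // _ /eqP; rewrite oner_eq0.
Qed.

End LinearODE.

(** * Essential incompleteness *)

Section Engine.
Variable R : realType.
Implicit Types (W : set (plane R)) (F : plane R -> plane R) (C : typeA R).

Definition velocity (x : R -> plane R) (t : R) : plane R := \row_k derive1 (coordf x k) t.

Definition jac_apply F (x v : plane R) : plane R := \row_k \sum_a jac F x a k * v 0 a.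

Definition transition_invariant C (Z : set (plane R)) := forall W F,
  open W -> affine_map W (fun=> symb C) (fun=> symb C) F -> (forall x, W x -> jacdet F x != 0) ->
  forall x v, W x -> Z v -> Z (jac_apply F x v).

Lemma near_shrink (s : R) (P : R -> Prop) : (\forall t \near s, P t) ->
  exists2 e : R, 0 < e & forall t, `|s - t| < e -> P t.
Proof. by move=> /nbhs_ballP[e /= e0 H]; exists e => // t st; exact: H. Qed.

Lemma dist_interval (s e : R) : is_interval [set t | `|s - t| < e].
Proof.
move=> a b /=; rewrite !ltr_distlC => /andP[a1 a2] /andP[b1 b2] z /andP[az zb] /=.
by rewrite ltr_distlC (lt_le_trans a1 az) (le_lt_trans zb b2).
Qed.

Lemma dist_open (s e : R) : open [set t : R | `|s - t| < e].
Proof. exact: ball_open. Qed.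

Section GoodSet.
Variables (C : typeA R) (Z : set (plane R)).
Hypothesis Zinv : transition_invariant C Z.
Hypothesis Zode : forall (J : set R) (x : R -> plane R), open J -> is_interval J ->
  (forall t, J t -> geodesic_at (fun=> symb C) x t) ->
  forall t1, J t1 -> 0 < t1 -> Z (t1 *: velocity x t1) ->
  ~ J 0 /\ forall t2, J t2 -> 0 < t2 -> Z (t2 *: velocity x t2).

Variables (M : affineSurface R) (tau : R -> M).
Hypothesis MC : modeled_on M C.
Hypothesis taug : geodesic setT tau.

Let good c t := Z (t *: velocity (coord c \o tau) t).

Lemma good_transfer c c' t : local_coordinates c (fun=> symb C) ->
  local_coordinates c' (fun=> symb C) -> dom c (tau t) -> dom c' (tau t) ->
  good c t -> good c' t.
Proof.
move=> cC c'C ct c't gt.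
have [W [Wo Wx FA [W' [W'o FA' FF]]]] := transition cC c'C ct c't.
have d0 := jacdet_neq0 Wo W'o FA.1 FA'.1 FF.
have := Zinv Wo FA d0 Wx gt; congr (Z _).
have tc : {for t, continuous tau} by have /geodesicP[_ _ H] := taug; apply H.
have cg := geodesic_chart taug cC I ct.
have E : \forall s \near t, ((coord c' \o param c) \o (coord c \o tau)) s = (coord c' \o tau) s.
  by have := open_dom_near tc ct; apply: filterS => s cs; rewrite /= coordK.
apply/rowP => k; rewrite [LHS]mxE [RHS]mxE [X in _ = _ * X]mxE.
have [//|_] := push_velocity Wo FA Wx (c := coord c \o tau) (t := t) _ k.
  by move=> i; have [] := cg i.
have {}E : \forall s \near t, coordf ((coord c' \o param c) \o (coord c \o tau)) k s = coordf (coord c' \o tau) k s.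
  by apply: filterS E => s; rewrite /coordf => ->.
rewrite (near_eq_derive _ E) derive1E => ->.
rewrite !sum2 /jac !mxE; ring.
Qed.

Lemma good_contra c1 : local_coordinates c1 (fun=> symb C) -> dom c1 (tau 1) -> ~ good c1 1.
Proof.
move=> c1C c1t g1.
pose P t := 0 < t /\ forall c, local_coordinates c (fun=> symb C) -> dom c (tau t) -> good c t.
have P1 : P 1 by split=> // c cC ct; exact: good_transfer c1C cC c1t ct g1.
suff Ploc s : \forall t \near s, P t <-> P s.
  by have [] := loc_const Ploc 0 P1; rewrite ltxx.
have tc t : {for t, continuous tau} by have /geodesicP[_ _ H] := taug; apply H.
have [c ct cC] := MC (tau s).
have [e e0 He] := near_shrink (open_dom_near (tc s) ct).
have Pc t : `|s - t| < e -> P t <-> (0 < t /\ good c t).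
  move=> /He ctt; split=> [[t0 H]|[t0 gt]]; split=> //; first exact: H.
  by move=> c' c'C c't; exact: good_transfer cC c'C ctt c't gt.
(* For [s > 0] the radius is at most [s], so the window contains positive times only. For [s <= 0],
   a positive time in the window forces 0 into it, and the first conclusion of [Zode] then excludes
   that [P] holds there. *)
pose r := if 0 < s then Num.min e s else e.
have r0 : 0 < r by rewrite /r; case: ifP => // s0; rewrite lt_min e0.
have re : r <= e by rewrite /r; case: ifP => // s0; rewrite ge_min lexx.
have step t1 t2 : `|s - t1| < r -> `|s - t2| < r -> P t1 -> P t2.
  move=> st1 st2 /(Pc _ (lt_le_trans st1 re))[t10 gt1].
  apply/(Pc _ (lt_le_trans st2 re)).
  have [n0 H] := Zode (@dist_open s r) (@dist_interval s r)
    (fun t st => geodesic_chart taug cC I (He t (lt_le_trans st re))) st1 t10 gt1.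
  have s0 : 0 < s.
    rewrite ltNge; apply/negP => s0; apply: n0; rewrite /= subr0.
    move: st1; rewrite ltr_distlC => /andP[_ h].
    by rewrite ler0_norm// -(ltrD2r s) addNr addrC; exact: lt_trans t10 h.
  have t20 : 0 < t2.
    move: st2; rewrite /r s0 lt_min ltr_distlC => /andP[_]; rewrite ltr_distlC subrr.
    by case/andP.
  by split=> //; exact: H.
apply/nbhs_ballP; exists r => //= t st.
by split; apply: step => //; rewrite subrr normr0.
Qed.

End GoodSet.

(* Along a complete extension of the geodesic, the condition that [t > 0] and that [t] times
   the velocity lies in [Z] is locally constant in [t]; it holds at 1 and fails at 0. *)
Lemma essentially_incompleteI C (Z : set (plane R)) (x : R -> plane R) (J : set R) :
  transition_invariant C Z ->
  (forall (J : set R) (x : R -> plane R), open J -> is_interval J ->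
    (forall t, J t -> geodesic_at (fun=> symb C) x t) ->
    forall t1, J t1 -> 0 < t1 -> Z (t1 *: velocity x t1) ->
    ~ J 0 /\ forall t2, J t2 -> 0 < t2 -> Z (t2 *: velocity x t2)) ->
  open J -> J 1 -> (forall t, J t -> geodesic_at (fun=> symb C) x t) ->
  Z (velocity x 1) -> essentially_incomplete C.
Proof.
move=> Zinv Zode Jo J1 xg Zx [M MC Mcomplete].
have [p _] := surf_nonempty M.
have [c cp cC] := MC p.
(* Constant symbols are invariant under translations, so the given geodesic can be moved to pass at
   time 1 through the image of [p] in the chart [c]. *)
pose q := coord c p - x 1.
pose y t := x t + q.
have yE k t : coordf y k t = coordf x k t + q 0 k by rewrite /coordf /y mxE.
have yF k : coordf y k = (fun s => coordf x k s + q 0 k) by apply/funext => s; exact: yE.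
have yg t : J t -> geodesic_at (fun=> symb C) y t.
  move=> Jt.
  have D k s : derivable (coordf x k) s 1 -> is_derive s 1 (coordf y k) (derive1 (coordf x k) s).
    move=> H; rewrite yF.
    by rewrite -[derive1 _ _]addr0; exact: (is_deriveD (derive1P H) (is_derive_cst _ _ _)).
  have E k : \forall s \near t, derive1 (coordf x k) s = derive1 (coordf y k) s.
    have : \forall s \near t, J s by apply: open_nbhs_nbhs; split.
    apply: filterS => s Js; have [H _ _] := xg s Js k.
    by have [_ <-] := D k s H; rewrite derive1E.
  move=> k; have [H1 H2 H3] := xg t Jt k; split.
  - by have [] := D k t H1.
  - exact: near_eq_derivable (E k) H2.
  - apply: etrans H3; rewrite (derive1E (derive1 _)) -(near_eq_derive _ (E k)) -derive1E.
    congr (_ + _); apply: eq_bigr => i _; apply: eq_bigr => j _.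
    by rewrite -!(nbhs_singleton (E _)).
have y1 : y 1 = coord c p by rewrite /y /q subrKC.
have yc : {for 1, continuous y} by apply: curve_cont => k; have [] := yg 1 J1 k.
have N1 : \forall t \near (1 : R), J t by apply: open_nbhs_nbhs; split.
have N2 : \forall t \near (1 : R), cod c (y t).
  by apply: near_in yc; [exact: cod_open|rewrite y1; exact: coord_cod].
have [e1 e10 H1] := near_shrink N1.
have [e2 e20 H2] := near_shrink N2.
pose e := Num.min e1 e2.
have e0 : 0 < e by rewrite lt_min e10.
pose I' := [set t : R | `|1 - t| < e].
have I'1 : I' 1 by rewrite /I' /= subrr normr0.
have gI : geodesic I' (param c \o y).
  apply: (chart_geodesic cC) => [||t]; [exact: dist_open|exact: dist_interval|].
  rewrite /I' /= lt_min => /andP[t1 t2]; split; first exact: H2.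
  by apply: yg; exact: H1.
have [tau tg tE] := Mcomplete _ _ gI.
have near1 : \forall t \near (1 : R), I' t by apply: open_nbhs_nbhs; split=> //; exact: dist_open.
have c1 : dom c (tau 1) by rewrite tE//=; apply: param_dom; rewrite y1; exact: coord_cod.
apply: (good_contra Zinv Zode MC tg cC c1).
rewrite scale1r; move: Zx; congr (Z _); apply/rowP => k; rewrite !mxE !derive1E.
rewrite -(@near_eq_derive _ _ _ (coordf y k) (coordf (coord c \o tau) k)).
  rewrite yF.
  have H : derivable (coordf x k) 1 1 by have [] := xg 1 J1 k.
  by rewrite deriveD// derive_cst addr0.
have := near1; apply: filterS => t It; rewrite /coordf /= tE//= paramK//.
by apply: H2; move: It; rewrite /I' /= lt_min => /andP[].
Qed.

End Engine.

(** * Logarithmic geodesics and idempotents *)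

Section LogGeodesics.
Variable R : realType.
Implicit Types (C : typeA R).

Lemma geodesic_atI (G : christoffel R) (x : R -> plane R) (dx ddx : 'I_2 -> R -> R) (t : R) :
  (\forall s \near t, forall k, is_derive (s : R) (1 : R) (coordf x k) (dx k s)) ->
  (forall k, is_derive t 1 (dx k) (ddx k t)) ->
  (forall k, ddx k t + \sum_i \sum_j G (x t) i j k * dx i t * dx j t = 0) ->
  geodesic_at G x t.
Proof.
move=> H1 H2 H3 k.
have E i : \forall s \near t, dx i s = derive1 (coordf x i) s.
  by apply: filterS H1 => s /(_ i)[_ <-]; rewrite derive1E.
split.
- by have [] := nbhs_singleton H1 k.
- by apply: near_eq_derivable (E k) _; have [] := H2 k.
- apply: etrans (H3 k); rewrite (derive1E (derive1 _)) -(near_eq_derive _ (E k)).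
  have [_ ->] := H2 k; congr (_ + _).
  by apply: eq_bigr => i _; apply: eq_bigr => j _; rewrite -!(nbhs_singleton (E _)).
Qed.

Lemma continuous_sum2 (f : 'I_2 -> R -> R) (s : R) : (forall a, {for s, continuous (f a)}) ->
  {for s, continuous (fun t => \sum_a f a t)}.
Proof.
move=> H; have -> : (fun t => \sum_a f a t) = f 0 \+ f 1 by apply/funext => t; rewrite sum2.
exact: continuousD.
Qed.

Lemma is_derive_inv (t : R) : t != 0 -> is_derive t 1 (GRing.inv : R -> R) (- (t^-1 * t^-1)).
Proof.
move=> t0; have := @is_deriveV R id t 1 1 t0 (is_derive_id _ _).
by rewrite -exprVn expr2 /GRing.scale/= mulr1.
Qed.

Lemma log_derivs (v t : R) : 0 < t -> is_derive t 1 (fun t => ln t * v) (t^-1 * v) /\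
  is_derive t 1 (fun t => t^-1 * v) (- (t^-1 * t^-1) * v).
Proof.
move=> t0; split; apply: is_derive_mulr; first exact: is_derive1_ln.
by apply: is_derive_inv; rewrite gt_eqF.
Qed.

Lemma near_pos (t : R) : 0 < t -> \forall s \near t, 0 < s.
Proof. by move=> t0; exact: lt_nbhsr. Qed.

Lemma open_pos : open [set t : R | 0 < t].
Proof. by rewrite openE => t /near_pos. Qed.

Lemma log_velocity v t k : 0 < t -> derive1 (coordf (fun t : R => ln t *: v) k) t = t^-1 * v 0 k.
Proof.
move=> t0; rewrite derive1E.
have -> : coordf (fun t : R => ln t *: v : plane R) k = (fun t => ln t * v 0 k).
  by apply/funext => s; rewrite /coordf mxE.
by have [[_ ->]] := log_derivs (v 0 k) t0.
Qed.

Lemma log_geodesic_at (C : symbols R) v t : cprod C v v = v -> 0 < t ->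
  geodesic_at (fun=> C) (fun t => ln t *: v) t.
Proof.
move=> vv t0.
apply: (@geodesic_atI _ _ (fun k t => t^-1 * v 0 k) (fun k t => - (t^-1 * t^-1) * v 0 k)).
- apply: filterS (near_pos t0) => s s0 k.
  have -> : coordf (fun t : R => ln t *: v : plane R) k = (fun t => ln t * v 0 k).
    by apply/funext => r; rewrite /coordf mxE.
  by have [] := log_derivs (v 0 k) s0.
- by move=> k; have [] := log_derivs (v 0 k) t0.
move=> k; rewrite -{1}vv cprodE !sum2; ring.
Qed.

Lemma idempotent_of_log_geodesic (C : symbols R) v :
  geodesic_at (fun=> C) (fun t => ln t *: v) 1 -> cprod C v v = v.
Proof.
move=> H; apply/rowP => k; have [_ _] := H k.
have E i : \forall s \near (1 : R), s^-1 * v 0 i = derive1 (coordf (fun t : R => ln t *: v) i) s.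
  by apply: filterS (near_pos (@ltr01 R)) => s s0; rewrite log_velocity.
rewrite (derive1E (derive1 _)) -(near_eq_derive _ (E k)).
have [_ [_ ->]] := log_derivs (v 0 k) (@ltr01 R).
under eq_bigr do under eq_bigr do rewrite -!(nbhs_singleton (E _)).
rewrite invr1 !mul1r mulN1r => /eqP; rewrite addrC subr_eq0 => /eqP <-.
rewrite cprodE !sum2; ring.
Qed.

Lemma cont_zero_right (g : R -> R) : {for 0, continuous g} ->
  (\forall t \near (0 : R), 0 < t -> g t = 0) -> g 0 = 0.
Proof.
move=> gc gz; apply/eqP; rewrite -normr_le0 leNgt; apply/negP => g0.
have /cvgrPdist_lt/(_ _ g0) N := gc.
have [e e0 H] : exists2 e : R, 0 < e & forall t, `|0 - t| < e ->
    (0 < t -> g t = 0) /\ `|g 0 - g t| < `|g 0|.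
  by apply: near_shrink; near=> t; split; near: t.
have [] := H (e / 2).
  by rewrite sub0r normrN gtr0_norm ?divr_gt0// ltr_pdivrMr// ltr_pMr// ltr1n.
by rewrite divr_gt0// => ->//; rewrite subr0 ltxx.
Unshelve. all: by end_near. Qed.

End LogGeodesics.

Section Rank2Incomplete.
Variable R : realType.
Implicit Types (C : typeA R).

Lemma intertwine_alg (K : comNzRingType) (T : 'I_2 -> 'I_2 -> K) (C C' : 'I_2 -> 'I_2 -> 'I_2 -> K)
    (v : 'I_2 -> K) k :
  (forall i j, \sum_a \sum_b T i a * T j b * C' a b k = \sum_l C i j l * T l k) ->
  \sum_i \sum_j (\sum_a T a i * v a) * (\sum_a T a j * v a) * C' i j k =
  \sum_a T a k * (\sum_i \sum_j v i * v j * C i j a).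
Proof.
move=> H.
have -> : \sum_a T a k * (\sum_i \sum_j v i * v j * C i j a) =
   \sum_i \sum_j v i * v j * (\sum_l C i j l * T l k) by rewrite !sum2; ring.
under [RHS]eq_bigr do under eq_bigr do rewrite -H.
by rewrite !sum2; ring.
Qed.

Lemma cprod_jac_apply U (C C' : typeA R) F x v : open U ->
  affine_map U (fun=> symb C) (fun=> symb C') F -> (forall x, U x -> jacdet F x != 0) ->
  rhodet C' != 0 -> U x ->
  cprod (symb C') (jac_apply F x v) (jac_apply F x v) = jac_apply F x (cprod (symb C) v v).
Proof.
move=> Uo FA d0 r0 Ux; apply/rowP => k; rewrite [LHS]mxE [RHS]mxE.
under eq_bigr do under eq_bigr do rewrite !mxE.
under [RHS]eq_bigr do rewrite mxE.
apply: (@intertwine_alg _ (jac F x) (symb C) (symb C') (v 0)) => i j.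
exact: rank2_intertwine Uo FA d0 r0 _ Ux _ _ _.
Qed.

Lemma jac_apply_inj (F : plane R -> plane R) x v : jacdet F x != 0 -> jac_apply F x v = 0 -> v = 0.
Proof.
move=> d0 H; have H0 := congr1 (fun u : plane R => u 0 0) H; have H1 := congr1 (fun u : plane R => u 0 1) H.
move: d0 H0 H1; rewrite /= !mxE !sum2 /jacdet; move: (jac F x) => T d0 H0 H1.
apply/rowP => k; rewrite mxE; apply: (mulfI d0); rewrite mulr0.
case: (ord2P k) => ->.
  have -> : (T 0 0 * T 1 1 - T 0 1 * T 1 0) * v 0 0 =
    (T 0 0 * v 0 0 + T 1 0 * v 0 1) * T 1 1 - (T 0 1 * v 0 0 + T 1 1 * v 0 1) * T 1 0 by ring.
  by rewrite H0 H1 !mul0r subrr.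
have -> : (T 0 0 * T 1 1 - T 0 1 * T 1 0) * v 0 1 =
    (T 0 1 * v 0 0 + T 1 1 * v 0 1) * T 0 0 - (T 0 0 * v 0 0 + T 1 0 * v 0 1) * T 0 1 by ring.
by rewrite H0 H1 !mul0r subrr.
Qed.

Lemma velocity_derive C x t k : geodesic_at (fun=> symb C) x t ->
  is_derive t 1 (derive1 (coordf x k))
    (- \sum_i \sum_j symb C i j k * derive1 (coordf x i) t * derive1 (coordf x j) t).
Proof.
move=> /(_ k)[_ H /eqP]; rewrite addr_eq0 => /eqP E; have := derive1P H.
by rewrite E.
Qed.

(** For [W = t w] the left side is [(W - C(W, W)) / t]. Subtracting the equilibrium [v = C(v, v)]
    and writing [C(W, W) - C(v, v) = C(W + v, W - v)] makes it linear in [W - v], with coefficients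
    singular only at [t = 0]. *)
Lemma scaled_velocity_alg (K : fieldType) (C : 'I_2 -> 'I_2 -> 'I_2 -> K) (w v : 'I_2 -> K) (t : K) k :
  (forall i j k, C i j k = C j i k) -> t != 0 ->
  \sum_i \sum_j v i * v j * C i j k = v k ->
  w k + t * - (\sum_i \sum_j C i j k * w i * w j) =
  \sum_i (t^-1 * ((i == k)%:R - \sum_j C i j k * (t * w j + v j))) * (t * w i - v i).
Proof.
move=> Cs t0 vv; apply: (mulfI t0).
have -> : t * \sum_i (t^-1 * ((i == k)%:R - \sum_j C i j k * (t * w j + v j))) * (t * w i - v i) =
  \sum_i ((i == k)%:R - \sum_j C i j k * (t * w j + v j)) * (t * w i - v i).
  by rewrite mulr_sumr; apply: eq_bigr => i _; rewrite !mulrA divff// mul1r.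
have -> : \sum_i ((i == k)%:R - \sum_j C i j k * (t * w j + v j)) * (t * w i - v i) =
  t * w k - v k - t * t * (\sum_i \sum_j C i j k * w i * w j) + \sum_i \sum_j v i * v j * C i j k.
  by rewrite !sum2 !(Cs 1 0); case: (ord2P k) => -> /=; ring.
rewrite vv !sum2; ring.
Qed.

Lemma rank2_incomplete C v : rhodet C != 0 -> v != 0 -> cprod (symb C) v v = v ->
  essentially_incomplete C.
Proof.
move=> r0 v0 vv.
apply: (@essentially_incompleteI _ C [set v | v != 0 /\ cprod (symb C) v v = v]
    (fun t => ln t *: v) [set t | 0 < t]) => //.
- move=> W F Wo FA d0 x u Wx /= [u0 uu]; split.
    by apply: contra_neq u0; apply: jac_apply_inj; exact: d0.
  by rewrite (cprod_jac_apply _ Wo FA d0 r0 Wx) uu.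
- move=> J x Jo Ji xg t1 Jt1 t10 /=; set u := t1 *: _ => -[u0 uu].
  pose w k := derive1 (coordf x k).
  pose D k t := t * w k t - u 0 k.
  pose L (i k : 'I_2) t := t^-1 * ((i == k)%:R - \sum_j symb C i j k * (t * w j t + u 0 j)).
  have wd t k : J t -> is_derive t 1 (w k) (- \sum_i \sum_j symb C i j k * w i t * w j t).
    by move=> /xg; exact: velocity_derive.
  have wc t k : J t -> {for t, continuous (w k)} by move=> /(wd _ k); exact: is_derive_cont.
  (* The coefficients [L] contain [t^-1], so uniqueness is applied on the positive part of [J]
     only. *)
  have JI : is_interval [set t | J t /\ 0 < t].
    move=> a b /= [Ja a0] [Jb b0] z ab; split; first exact: Ji ab.
    by case/andP: ab => az _; exact: lt_le_trans az.
  have Dz t k : J t -> 0 < t -> D k t = 0.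
    move=> Jt t0; apply: (linear_system_unique (L := L) (t0 := t1) JI) => //.
    + move=> s i [Js s0].
      have := is_deriveMl (is_derive_id s 1) (wd s i Js); rewrite /= mul1r => Hw.
      have := is_deriveB Hw (is_derive_cst (u 0 i) s 1); rewrite subr0.
      rewrite (scaled_velocity_alg (v := u 0) _ (symb_sym C))//.
      * by rewrite gt_eqF.
      * by rewrite -[RHS](congr1 (fun y : plane R => y 0 i) uu) mxE.
    + move=> s i j [Js s0].
      apply: continuousM; first by apply: is_derive_cont (is_derive_inv _); rewrite gt_eqF.
      have tc l : {for s, continuous (fun t : R => symb C i l j * (t * w l t + u 0 l))}.
        apply: continuousM; first exact: cst_continuous.
        apply: continuousD; last exact: cst_continuous.
        by apply: continuousM; [exact: cvg_id|exact: wc].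
      apply: continuousB; first exact: cst_continuous.
      exact: continuous_sum2.
    + by move=> i; rewrite /D /u !mxE subrr.
  have uE t : J t -> 0 < t -> t *: velocity x t = u.
    by move=> Jt t0; apply/rowP => k; rewrite 2!mxE; apply/eqP; rewrite -subr_eq0; apply/eqP; exact: Dz.
  split; last by move=> t2 Jt2 t20; rewrite /= (uE _ Jt2 t20).
  move=> J0; move/eqP: u0; apply; apply/rowP => k; rewrite [RHS]mxE.
  (* If 0 were in [J], [D] would be continuous there; it vanishes for [t > 0] and equals [- u] at 0,
     so [u] would be zero. *)
  have Dc : {for 0, continuous (D k)}.
    apply: continuousB; last exact: cst_continuous.
    by apply: continuousM; [exact: cvg_id|exact: wc].
  have := cont_zero_right Dc; rewrite /D mul0r sub0r => H.
  apply/eqP; rewrite -oppr_eq0; apply/eqP; apply: H.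
  have N : \forall t \near (0 : R), J t by apply: open_nbhs_nbhs; split.
  by apply: filterS N => t; exact: Dz.
- exact: ltr01.
- by move=> t /=; exact: log_geodesic_at.
- have -> : velocity (fun t : R => ln t *: v) 1 = v; last by split=> //; exact/eqP.
  by apply/rowP => k; rewrite mxE log_velocity// invr1 mul1r.
Qed.

End Rank2Incomplete.

(** * Ricci tensor of rank one *)

Section RicciRank.
Variable R : realType.
Implicit Types (C : typeA R).

Lemma det_mx22 (K : comNzRingType) (A : 'M[K]_2) : \det A = A 0 0 * A 1 1 - A 0 1 * A 1 0.
Proof.
rewrite (expand_det_row _ 0) sum2 /cofactor !det_mx11 !mxE /=.
have -> : lift 0 0 = 1 :> 'I_2 by exact/val_inj.
have -> : lift 1 0 = 0 :> 'I_2 by exact/val_inj.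
by rewrite expr0 expr1 mul1r mulN1r mulrN.
Qed.

Lemma det_ricci C : \det (\matrix_(i, j) rho (symb C) i j) = rhodet C.
Proof. by rewrite det_mx22 !mxE (rho_sym C 1 0) -expr2. Qed.

Lemma ricci_rank2 C : ricci_rank C 2 -> rhodet C != 0.
Proof.
move=> /(_ 0); rewrite ricciE => r2.
have : row_full (\matrix_(i, j) rho (symb C) i j) by rewrite /row_full r2.
by rewrite row_full_unit unitmxE unitfE det_ricci.
Qed.

Lemma ricci_rank1 C : ricci_rank C 1 -> rhodet C = 0 /\ exists i, rho (symb C) i i != 0.
Proof.
move=> /(_ 0); rewrite ricciE => r1.
have d0 : rhodet C = 0.
  apply/eqP; apply: contraT; rewrite -det_ricci -unitfE -unitmxE => /mxrank_unit.
  by rewrite r1.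
split=> //; have [E0|] := eqVneq (rho (symb C) 0 0) 0; last by exists 0.
have [E1|] := eqVneq (rho (symb C) 1 1) 0; last by exists 1.
move: d0; rewrite /rhodet E0 mul0r sub0r => /eqP; rewrite oppr_eq0 sqrf_eq0 => /eqP E01.
have Z : \matrix_(i, j) rho (symb C) i j = 0.
  apply/matrixP => i j; rewrite !mxE.
  by case: (ord2P i) => ->; case: (ord2P j) => ->; rewrite ?E0 ?E1 ?E01// rho_sym E01.
by move: r1; rewrite Z mxrank0.
Qed.

(* In the basis [e1 - m e2, e2], which diagonalises the Ricci tensor, the equations say that
   the last components of C_11 and C_12 vanish. *)
Lemma rank1_alg (K : fieldType) (a b c d e f r m : K) :
  r = f * c + e * a - e * d - c ^+ 2 -> r != 0 ->
  c * d - b * e = m * r -> a * d + b * f - b * c - d ^+ 2 = m ^+ 2 * r ->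
  m * a + b = (m * e + f) * m ^+ 2 /\ m * c + d = (m * e + f) * m.
Proof.
move=> rE r0 r01 r00.
(* The components of [C_11] are [a], [b], those of [C_12] are [c], [d] and those of [C_22] are [e],
   [f]. The primed letters are the components in the new basis, where [e] is unchanged. *)
pose a' := a - 2 * m * c + m ^+ 2 * e.
pose c' := c - m * e.
pose b' := b - 2 * m * d + m ^+ 2 * f + m * a'.
pose d' := d - m * f + m * c'.
pose f' := f + m * e.
have r00' : a' * d' + b' * f' - b' * c' - d' ^+ 2 = 0.
  have -> : a' * d' + b' * f' - b' * c' - d' ^+ 2 =
    (a * d + b * f - b * c - d ^+ 2) - 2 * m * (c * d - b * e) + m ^+ 2 * (f * c + e * a - e * d - c ^+ 2).
    by rewrite /f' /d' /b' /c' /a'; ring.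
  by rewrite r00 r01 -rE; ring.
have r01' : c' * d' - b' * e = 0.
  have -> : c' * d' - b' * e = (c * d - b * e) - m * (f * c + e * a - e * d - c ^+ 2).
    by rewrite /d' /b' /c' /a'; ring.
  by rewrite r01 -rE subrr.
have r' : r = f' * c' + e * a' - e * d' - c' ^+ 2.
  by rewrite rE /f' /d' /c' /a'; ring.
(* [b' r] is a combination of the two vanishing Ricci components, so [b'] is zero. If then [d'] were
   not zero, they would give [c' = 0] and [a' = d'], and so [r = 0]. *)
have [b0 d0] : b' = 0 /\ d' = 0.
  have [b0|b0] := eqVneq b' 0; last first.
    case/eqP: r0; apply: (mulfI b0); rewrite mulr0 r'.
    have -> : b' * (f' * c' + e * a' - e * d' - c' ^+ 2) =
      c' * (a' * d' + b' * f' - b' * c' - d' ^+ 2) + (d' - a') * (c' * d' - b' * e) by ring.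
    by rewrite r00' r01' !mulr0 addr0.
  split=> //; apply/eqP; apply: contraT => d0.
  move: r00' r01'; rewrite b0 !mul0r !subr0 addr0 => h1 /eqP.
  rewrite mulf_eq0 (negPf d0) orbF => /eqP c0.
  have ad : a' = d' by apply: (mulIf d0); apply/eqP; rewrite -subr_eq0 -expr2; apply/eqP.
  by case/eqP: r0; rewrite r' c0 ad; ring.
split.
  have -> : m * a + b = b' + 2 * m * d' + (m * e + f) * m ^+ 2 by rewrite /b' /d' /c' /a'; ring.
  by rewrite b0 d0 mulr0 !add0r.
have -> : m * c + d = d' + (m * e + f) * m by rewrite /d' /c'; ring.
by rewrite d0 add0r.
Qed.

(** If all products lie on the line through [n], so do the values of [R], and the four terms of the
    covariant derivative cancel identically. *)
Lemma cnablaR_eq0 (C : symbols R) (s : 'I_2 -> 'I_2 -> R) (n : plane R) :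
  (forall i j k, C i j k = s i j * n 0 k) -> (forall i j, s i j = s j i) ->
  forall u v w z, cnablaR C u v w z = 0.
Proof.
move=> Cs ss u v w z.
pose B (x y : plane R) : R := x 0 0 * y 0 0 * s 0 0 + x 0 0 * y 0 1 * s 0 1 +
  (x 0 1 * y 0 0 * s 0 1 + x 0 1 * y 0 1 * s 1 1).
have P x y : cprod C x y = B x y *: n.
  by apply/rowP => k; rewrite cprodE mxE !Cs (ss 1 0) /B; ring.
have Q x y t : ccurv C x y t = (B y t * B x n - B x t * B y n) *: n.
  rewrite /ccurv !P -scalerBl; congr (_ *: _); rewrite /B !mxE; ring.
rewrite /cnablaR !(P, Q) -!scalerBl; apply/eqP; rewrite scaler_eq0; apply/orP; left; apply/eqP.
rewrite /B !mxE.
move: (u 0 0) (u 0 1) (v 0 0) (v 0 1) (w 0 0) (w 0 1) (z 0 0) (z 0 1) (n 0 0) (n 0 1)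
  (s 0 0) (s 0 1) (s 1 1) => *; ring.
Qed.

(** A symmetric form of rank one is [eps l l]: the index [q] has [rho_qq] nonzero, [z] is the other
    index, and [l] is 1 at [q] and [m = rho_zq / rho_qq] at [z]. Then [rank1_alg] gives the relation
    between [l] and the product, and [f = 0] would put all products into the kernel of [l]. *)
Lemma rank1_structure C : ricci_rank C 1 -> exists (l : 'I_2 -> R) (eps f : R),
  [/\ eps != 0, exists i, l i != 0, forall i j, rho (symb C) i j = eps * l i * l j,
      forall i j, \sum_k symb C i j k * l k = f * l i * l j & nabla_R_neq0 C -> f != 0].
Proof.
move=> r1; have [d0 [q rq0]] := ricci_rank1 r1.
have Cs := symb_sym C.
have [z [qz cases]] : exists z : 'I_2, q != z /\ forall i, i = q \/ i = z.
  by case: (ord2P q) => ->; [exists 1|exists 0]; split=> // i; case: (ord2P i); auto.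
have S2 (V : nmodType) (g : 'I_2 -> V) : \sum_i g i = g z + g q.
  rewrite sum2; case: (ord2P q) qz => ->; case: (ord2P z) => -> //= _.
  by rewrite addrC.
pose c := symb C.
have cs i j k : c i j k = c j i k by exact: Cs.
have rho_oo : rho c q q = c q q q * c z q z + c q q z * c z z z - c q q z * c z q q - c z q z ^+ 2.
  rewrite /rho; case: (ord2P q) qz => ->; case: (ord2P z) => -> //= _;
  rewrite /curv01 !sum2 /c !(Cs 1 0); ring.
have rho_zo : rho c z q = c z q z * c z q q - c z z q * c q q z.
  rewrite /rho; case: (ord2P q) qz => ->; case: (ord2P z) => -> //= _;
  rewrite /curv01 !sum2 /c !(Cs 1 0); ring.
have rho_zz : rho c z z = c z z z * c z q q + c z z q * c q q q - c z z q * c z q z - c z q q ^+ 2.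
  rewrite /rho; case: (ord2P q) qz => ->; case: (ord2P z) => -> //= _;
  rewrite /curv01 !sum2 /c !(Cs 1 0); ring.
have dd : rho c z z * rho c q q = rho c z q ^+ 2.
  move/eqP: d0; rewrite /rhodet subr_eq0 => /eqP d0.
  case: (ord2P q) qz => ->; case: (ord2P z) => -> // _.
    by rewrite mulrC /c (rho_sym C 1 0).
pose m := rho c z q / rho c q q.
have m1 : rho c z q = m * rho c q q by rewrite /m divfK.
have m2 : rho c z z = m ^+ 2 * rho c q q.
  by apply: (mulIf rq0); rewrite dd m1; ring.
have [F1 F2] : m * c z z z + c z z q = (m * c q q z + c q q q) * m ^+ 2 /\
    m * c z q z + c z q q = (m * c q q z + c q q q) * m.
  apply: (rank1_alg rho_oo rq0); first by rewrite -rho_zo.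
  by rewrite -rho_zz.
exists (fun i => if i == q then 1 else m), (rho c q q), (m * c q q z + c q q q).
have zq : (z == q) = false by rewrite eq_sym (negPf qz).
split=> //.
- by exists q; rewrite eqxx oner_eq0.
- move=> i j; case: (cases i) => ->; case: (cases j) => ->; rewrite ?eqxx ?zq.
  + by rewrite !mulr1.
  + by rewrite rho_sym -/c m1; ring.
  + by rewrite -/c m1; ring.
  + by rewrite -/c m2; ring.
- move=> i j; rewrite S2 eqxx zq -/c mulr1.
  case: (cases i) => ->; case: (cases j) => ->; rewrite ?eqxx ?zq ?mulr1.
  + ring.
  + by rewrite !(cs q z) -F2; ring.
  + by rewrite -F2; ring.
  + by rewrite -mulrA -expr2 -F1; ring.
move=> [x [i [j [k [l]]]]]; apply: contra_neq => f0.
rewrite f0 !mul0r in F1 F2.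
rewrite /coord_field nabla_curvature_cst.
(* The vector [n] with components 1 at [z] and [- m] at [q] spans the kernel of [l]. *)
apply: (cnablaR_eq0 (s := fun i j => c i j z) (n := \row_k if k == q then - m else 1)) => // i' j' k'.
rewrite mxE; case: (cases k') => ->; rewrite ?eqxx ?zq ?mulr1// -/c.
have G : c i' j' q + m * c i' j' z = 0.
  rewrite addrC; case: (cases i') => ->; case: (cases j') => -> //.
  by rewrite !(cs q z).
by apply/eqP; rewrite mulrN -subr_eq0 opprK mulrC G.
Qed.

End RicciRank.

Section Rank1Incomplete.
Variable R : realType.
Implicit Types (C : typeA R).

(* Invariance of the Ricci tensor only gives [l o dF = l] up to sign; the minus sign is
   incompatible with [l o C = f l l] as [f] is nonzero. *)
Lemma rank1_preserved C (l : 'I_2 -> R) (eps f : R) U F : eps != 0 -> f != 0 ->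
  (exists i, l i != 0) -> (forall i j, rho (symb C) i j = eps * l i * l j) ->
  (forall i j, \sum_k symb C i j k * l k = f * l i * l j) -> open U ->
  affine_map U (fun=> symb C) (fun=> symb C) F -> (forall x, U x -> jacdet F x != 0) ->
  forall x, U x -> forall i, \sum_a jac F x i a * l a = l i.
Proof.
move=> e0 f0 [j lj] rhoE lC Uo FA d0 x Ux.
pose m i y := \sum_a jac F y i a * l a.
have mm i k y : U y -> m i y * m k y = l i * l k.
  move=> Uy; apply: (mulfI e0); rewrite [RHS]mulrA -(rhoE i k).
  rewrite (rho_pull i k Uo FA Uy (d0 y Uy)).
  rewrite (eq_bigr (fun a => \sum_b jac F y i a * jac F y k b * (eps * l a * l b))); last first.
    by move=> a _; apply: eq_bigr => b _; rewrite rhoE.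
  by rewrite /m !sum2; move: (jac F y) => P; ring.
have mj0 : m j x != 0.
  have : m j x * m j x != 0 by rewrite mm// mulf_neq0.
  by rewrite mulf_eq0 orbb.
have md : is_derive x (coord_vec R j) (m j) (\sum_a partial j (partial j (component F a)) x * l a).
  apply: is_derive_sum2 => a; apply: is_derive_mulr.
  exact: jac_is_derive Uo FA.1 Ux.
(* [m_j^2] is constant and [m_j] is not zero, so the derivative of [m_j] vanishes. *)
have dz : \sum_a partial j (partial j (component F a)) x * l a = 0.
  have [_ E] := is_deriveMl md md.
  have : 'D_(coord_vec R j) (fun y => m j y * m j y) x = 0.
    rewrite -(derive_cst (l j * l j) x (coord_vec R j)).
    exact: (@partial_ext _ U _ (cst (l j * l j)) x j Uo Ux (fun y Uy => mm j j y Uy)).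
  rewrite E mulrC -mulr2n => /eqP; rewrite mulrn_eq0 mulf_eq0 (negPf mj0) /=.
  by move/eqP.
(* Contracting the affine equation with [l] removes the second derivatives and leaves
   [f m_j^2 = sum_i C_jj^i m_i]. Multiplied by [m_j] and combined with [m_i m_j = l_i l_j], this
   reads [f l_j^2 m_j = f l_j^3], which fixes the sign. *)
have key : m j x = l j.
  have [_ FE] := FA.
  have E1 k := FE x Ux j j k.
  have : \sum_k (partial j (partial j (component F k)) x +
     \sum_a \sum_b jac F x j a * jac F x j b * symb C a b k) * l k =
     \sum_k (\sum_l symb C j j l * jac F x l k) * l k.
    by apply: eq_bigr => k _; rewrite -E1.
  have -> : \sum_k (\sum_l symb C j j l * jac F x l k) * l k = \sum_i symb C j j i * m i x.
    by rewrite /m !sum2; move: (jac F x) (symb C) => P c; ring.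
  have alg (p : 'I_2 -> R) P (c : symbols R) : \sum_k (p k +
     \sum_a \sum_b P j a * P j b * c a b k) * l k =
     \sum_a p a * l a + \sum_a \sum_b P j a * P j b * (\sum_k c a b k * l k).
    by rewrite !sum2; ring.
  rewrite (alg (fun k => partial j (partial j (component F k)) x)).
  rewrite dz add0r.
  have -> : \sum_a \sum_b jac F x j a * jac F x j b * (\sum_k symb C a b k * l k) = f * (m j x * m j x).
    rewrite (eq_bigr (fun a => \sum_b jac F x j a * jac F x j b * (f * l a * l b))); last first.
      by move=> a _; apply: eq_bigr => b _; rewrite lC.
    by rewrite /m !sum2; move: (jac F x) => P; ring.
  move=> E2; apply: (mulIf mj0); apply: (mulfI f0).
  rewrite E2; apply: (mulIf mj0).
  have -> : (\sum_i symb C j j i * m i x) * m j x = \sum_i symb C j j i * (m i x * m j x).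
    by rewrite mulr_suml; apply: eq_bigr => i _; rewrite mulrA.
  rewrite (eq_bigr (fun i => symb C j j i * (l i * l j))); last by move=> i _; rewrite mm.
  have -> : \sum_i symb C j j i * (l i * l j) = (\sum_i symb C j j i * l i) * l j.
    by rewrite mulr_suml; apply: eq_bigr => i _; rewrite mulrA.
  rewrite lC; move: (mm j j x Ux); move: (m j x) => q H.
  have -> : f * l j * l j * l j = f * (l j * l j) * l j by ring.
  by rewrite -H; ring.
by move=> i; apply: (mulIf mj0); rewrite mm// key.
Qed.

(** A solution near 0 suffices, so the initial value is free: a real root of the quadratic gives a
    constant [N], the case [A = b = 0] a linear one, and a negative discriminant a tangent. [M] is a
    primitive of [N]. *)
Lemma riccati (A b d : R) : exists M N : R -> R, \forall s \near (0 : R),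
  is_derive (s : R) (1 : R) M (N s) /\ is_derive (s : R) (1 : R) N (- (A * N s ^+ 2 + b * N s + d)).
Proof.
have root n : A * n ^+ 2 + b * n + d = 0 -> exists M N : R -> R, \forall s \near (0 : R),
  is_derive (s : R) (1 : R) M (N s) /\ is_derive (s : R) (1 : R) N (- (A * N s ^+ 2 + b * N s + d)).
  move=> n0; exists (fun s => s * n), (fun=> n); apply/nbhs_ballP; exists 1 => //= s _; split.
    by have := is_derive_mulr n (is_derive_id s (1 : R)); rewrite mul1r.
  by rewrite n0 oppr0; exact: is_derive_cst.
have [A0|A0] := eqVneq A 0.
  have [b0|b0] := eqVneq b 0; last first.
    by apply: (root (- d / b)); rewrite A0 mul0r add0r mulrC divfK// addNr.
  exists (fun s => s * s * (- d / 2)), (fun s => s * (- d)); apply/nbhs_ballP; exists 1 => //= s _; split.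
    have := is_derive_mulr (- d / 2) (is_deriveMl (is_derive_id s (1 : R)) (is_derive_id s (1 : R))).
    by rewrite (_ : (1 * id s + id s * 1) * (- d / 2) = s * - d)//; rewrite mul1r mulr1; field.
  have := is_derive_mulr (- d) (is_derive_id s (1 : R)).
  by rewrite mul1r A0 b0 !mul0r !add0r.
have [D0|D0] := leP 0 (b ^+ 2 - 4 * A * d).
  apply: (root ((- b + Num.sqrt (b ^+ 2 - 4 * A * d)) / (2 * A))).
  have := sqr_sqrtr D0; move: (Num.sqrt _) => r rE.
  have -> : A * ((- b + r) / (2 * A)) ^+ 2 + b * ((- b + r) / (2 * A)) + d =
    (r ^+ 2 - (b ^+ 2 - 4 * A * d)) / (4 * A) by field.
  by rewrite rE subrr mul0r.
(* Half the root of minus the discriminant: with [q^2 = A d - b^2 / 4], completing the square in the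
   quadratic gives the solution [N = - b / (2 A) - (q / A) tan (q s)]. *)
pose q := Num.sqrt (- (b ^+ 2 - 4 * A * d)) / 2.
have qE : q ^+ 2 = A * d - b ^+ 2 / 4.
  have := @sqr_sqrtr R (- (b ^+ 2 - 4 * A * d)); rewrite /q; move: (Num.sqrt _) => r.
  rewrite oppr_ge0 => /(_ (ltW D0)) rE.
  have -> : (r / 2) ^+ 2 = r ^+ 2 / 4 by field.
  by rewrite rE; field.
exists (fun s => s * (- b / (2 * A)) + ln (cos (s * q)) * A^-1),
  (fun s => - b / (2 * A) + tan (s * q) * (- q / A)).
have cq : \forall s \near (0 : R), 0 < cos (s * q).
  have C0 : {for 0, continuous (fun s : R => cos (s * q))}.
    apply: continuous_comp; last exact: continuous_cos.
    by apply: continuousM; [exact: cvg_id|exact: cst_continuous].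
  have : \forall y \near cos (0 * q), 0 < y by apply: lt_nbhsr; rewrite mul0r cos0.
  exact: C0.
apply: filterS cq => s cs.
have c0 : cos (s * q) != 0 by rewrite gt_eqF.
have Ls : is_derive s 1 (fun s : R => s * q) q.
  by have := is_derive_mulr q (is_derive_id s (1 : R)); rewrite mul1r.
have Lb (c : R) : is_derive s 1 (fun s : R => s * c) c.
  by have := is_derive_mulr c (is_derive_id s (1 : R)); rewrite mul1r.
split.
  have H1 : is_derive s 1 (fun s : R => cos (s * q)) (- sin (s * q) * q).
    exact: (@is_derive1_comp _ cos (fun s => s * q) s _ _ (is_derive_cos _) Ls).
  have H2 : is_derive s 1 (fun s : R => ln (cos (s * q))) ((cos (s * q))^-1 * (- sin (s * q) * q)).
    exact: (@is_derive1_comp _ (@ln R) (fun s => cos (s * q)) s _ _ (is_derive1_ln cs) H1).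
  have := is_deriveD (Lb (- b / (2 * A))) (is_derive_mulr A^-1 H2).
  rewrite (_ : - b / (2 * A) + (cos (s * q))^-1 * (- sin (s * q) * q) * A^-1 =
    - b / (2 * A) + tan (s * q) * (- q / A))//.
  by rewrite /tan; move: (sin _) (cos _) c0 => S c c0; field; rewrite c0 A0.
have H3 : is_derive s 1 (fun s : R => tan (s * q)) (cos (s * q) ^- 2 * q).
  exact: (@is_derive1_comp _ tan (fun s => s * q) s _ _ (is_derive_tan c0) Ls).
have := is_deriveD (is_derive_cst (- b / (2 * A)) s 1) (is_derive_mulr (- q / A) H3).
rewrite add0r (cos2_tan2 c0); move: (tan _) => T.
rewrite (_ : - (A * (- b / (2 * A) + T * (- q / A)) ^+ 2 + b * (- b / (2 * A) + T * (- q / A)) + d) =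
  (1 + T ^+ 2) * q * (- q / A))//.
have dE : d = (q ^+ 2 + b ^+ 2 / 4) / A by rewrite qE; field.
by rewrite dE; field.
Qed.

End Rank1Incomplete.

Section Rank1Geodesics.
Variable R : realType.
Implicit Types (C : typeA R).

(* Looking for [x t = M (ln t) n + (ln t / f) u] with [l n = 0] and [l u = 1] turns the
   geodesic equation into a Riccati equation with constant coefficients for the derivative of M. *)
Lemma rank1_local_geodesic C (l : 'I_2 -> R) (f : R) : f != 0 ->
  (exists i, l i != 0) ->
  (forall i j, \sum_k symb C i j k * l k = f * l i * l j) ->
  exists (J : set R) (x : R -> plane R), [/\ open J, J 1,
    forall t, J t -> geodesic_at (fun=> symb C) x t &
    \sum_k velocity x 1 0 k * l k = f^-1].
Proof.
move=> f0 l0 lC.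
pose N2 := l 0 ^+ 2 + l 1 ^+ 2.
have N20 : N2 != 0.
  rewrite /N2 paddr_eq0 ?sqr_ge0// !sqrf_eq0 negb_and.
  by case: l0 => i; case: (ord2P i) => -> ->; rewrite ?orbT.
(* [n] spans the kernel of [l], and [u] is the multiple of the vector [l] on which [l] takes the
   value 1. *)
pose n := pt (l 1) (- l 0).
pose u := pt (l 0 / N2) (l 1 / N2).
have decomp (c : plane R) : c = ((c 0 0 * l 1 - c 0 1 * l 0) / N2) *: n + (\sum_k c 0 k * l k) *: u.
  have N20' := N20; rewrite /N2 in N20'.
  by apply: planeP; rewrite !mxE sum2 /= /N2; field.
have lcprod v w : \sum_k cprod (symb C) v w 0 k * l k = f * (\sum_k v 0 k * l k) * (\sum_k w 0 k * l k).
  have -> : \sum_k cprod (symb C) v w 0 k * l k = \sum_i \sum_j v 0 i * w 0 j * (\sum_k symb C i j k * l k).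
    by rewrite sum2 !cprodE !sum2; move: (symb C) => c; ring.
  rewrite (eq_bigr (fun i => \sum_j v 0 i * w 0 j * (f * l i * l j))); last first.
    by move=> i _; apply: eq_bigr => j _; rewrite lC.
  by rewrite !sum2; ring.
have ln0 : \sum_k n 0 k * l k = 0 by rewrite sum2 pt0 pt1; ring.
have lu1 : \sum_k u 0 k * l k = 1.
  by have N20' := N20; rewrite sum2 pt0 pt1; rewrite /N2 in N20' *; field.
have [A nn] : exists A, cprod (symb C) n n = A *: n.
  by eexists; rewrite [LHS]decomp lcprod ln0 mulr0 scale0r addr0.
have [B nu] : exists B, cprod (symb C) n u = B *: n.
  by eexists; rewrite [LHS]decomp lcprod ln0 mulr0 mul0r scale0r addr0.
have [d uu] : exists d, cprod (symb C) u u = d *: n + f *: u.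
  by eexists; rewrite [LHS]decomp lcprod lu1 !mulr1.
(* With [x' = (N n + u / f) / t], the [u] component of the geodesic equation holds identically. The
   [n] component is [N' - N + A N^2 + 2 B N / f + d / f^2 = 0], where [N'] is taken with respect to
   [ln t]. *)
have [M [N MN]] := riccati A (2 * B / f - 1) (d / f ^+ 2).
have Nln : \forall t \near (1 : R), 0 < t /\ (is_derive (ln t) (1 : R) M (N (ln t)) /\
    is_derive (ln t) (1 : R) N (- (A * N (ln t) ^+ 2 + (2 * B / f - 1) * N (ln t) + d / f ^+ 2))).
  have P1 := near_pos (@ltr01 R).
  have P2 : \forall t \near (1 : R), is_derive (ln t) (1 : R) M (N (ln t)) /\
    is_derive (ln t) (1 : R) N (- (A * N (ln t) ^+ 2 + (2 * B / f - 1) * N (ln t) + d / f ^+ 2)).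
    have C1 : (@ln R) @ (1 : R) --> (@ln R) 1 by exact: continuous_ln.
    by rewrite ln1 in C1; exact: (C1 _ MN).
  by near=> t; split; near: t.
have [e e0 He] := near_shrink Nln.
pose dx k t := N (ln t) * t^-1 * n 0 k + t^-1 * f^-1 * u 0 k.
pose ddx k t := - (A * N (ln t) ^+ 2 + (2 * B / f - 1) * N (ln t) + d / f ^+ 2 + N (ln t)) * (t^-1 * t^-1) * n 0 k
   - (t^-1 * t^-1) * f^-1 * u 0 k.
have D1 t k : `|1 - t| < e -> is_derive t 1 (coordf (fun t => M (ln t) *: n + (ln t * f^-1) *: u) k) (dx k t).
  move=> /He[t0 [Mt Nt]].
  have -> : coordf (fun t => M (ln t) *: n + (ln t * f^-1) *: u) k =
     (fun t => M (ln t) * n 0 k + ln t * f^-1 * u 0 k).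
    by apply/funext => s; rewrite /coordf !mxE.
  have H1 : is_derive t 1 (fun t => M (ln t)) (N (ln t) * t^-1).
    exact: (@is_derive1_comp _ M (@ln R) t _ _ Mt (is_derive1_ln t0)).
  exact: is_deriveD (is_derive_mulr (n 0 k) H1)
    (is_derive_mulr (u 0 k) (is_derive_mulr f^-1 (is_derive1_ln t0))).
have D2 t k : `|1 - t| < e -> is_derive t 1 (dx k) (ddx k t).
  move=> /He[t0 [Mt Nt]].
  have H1 := @is_derive1_comp _ N (@ln R) t _ _ Nt (is_derive1_ln t0).
  have Hi := is_derive_inv (lt0r_neq0 t0).
  have := is_deriveD (is_derive_mulr (n 0 k) (is_deriveMl H1 Hi))
    (is_derive_mulr (u 0 k) (is_derive_mulr f^-1 Hi)).
  rewrite (_ : (_ + _) = ddx k t)//; rewrite /ddx /=.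
  by move: (N (ln t)) (t^-1) (f^-1) (d / _) (2 * B / f) => *; ring.
exists [set t | `|1 - t| < e], (fun t => M (ln t) *: n + (ln t * f^-1) *: u); split.
- exact: dist_open.
- by rewrite /= subrr normr0.
- move=> t te; apply: (@geodesic_atI _ _ _ dx ddx) => [||k].
  + have : \forall s \near t, `|1 - s| < e by apply: open_nbhs_nbhs; split=> //; exact: dist_open.
    by apply: filterS => s se k; exact: D1.
  + by move=> k; exact: D2.
  have Cs := symb_sym C.
  have E : \sum_i \sum_j symb C i j k * dx i t * dx j t =
    (N (ln t) * t^-1) ^+ 2 * cprod (symb C) n n 0 k +
    2 * (N (ln t) * t^-1) * (t^-1 * f^-1) * cprod (symb C) n u 0 k +
    (t^-1 * f^-1) ^+ 2 * cprod (symb C) u u 0 k.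
    rewrite !cprodE !sum2 /dx !(Cs 1 0).
    by move: (symb C) (N (ln t)) (t^-1) (f^-1) (n 0 0) (n 0 1) (u 0 0) (u 0 1) => *; ring.
  rewrite E nn nu uu /ddx !mxE.
  by move: (N (ln t)) (t^-1) (if k == 0 then l 1 else - l 0) (if k == 0 then l 0 / N2 else l 1 / N2) => *; field.
have J1 : `|1 - 1| < e by rewrite subrr normr0.
have V k : velocity (fun t => M (ln t) *: n + (ln t * f^-1) *: u) 1 0 k = dx k 1.
  by rewrite mxE derive1E; have [_ ->] := D1 1 k J1.
rewrite (eq_bigr (fun k => dx k 1 * l k)); last by move=> k _; rewrite V.
transitivity (N (ln 1) * 1^-1 * (\sum_k n 0 k * l k) + 1^-1 * f^-1 * (\sum_k u 0 k * l k)).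
  by rewrite !sum2 /dx; ring.
by rewrite ln0 lu1 mulr0 add0r invr1 mul1r mulr1.
Unshelve. all: by end_near. Qed.

Lemma rank1_incomplete C : ricci_rank C 1 -> nabla_R_neq0 C -> essentially_incomplete C.
Proof.
move=> r1 nR; have [l [eps [f [e0 l0 rhoE lC /(_ nR) f0]]]] := rank1_structure r1.
have [J [x [Jo J1 xg x1]]] := rank1_local_geodesic f0 l0 lC.
apply: (@essentially_incompleteI _ C [set v | f * (\sum_k v 0 k * l k) = 1] x J) => //.
- move=> W F Wo FA d0 y v Wy /= <-; congr (f * _).
  have P := rank1_preserved e0 f0 l0 rhoE lC Wo FA d0 Wy.
  under eq_bigr do rewrite mxE.
  under [RHS]eq_bigr do rewrite -P.
  by rewrite !sum2; move: (jac F y) => p; ring.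
- move=> I' y I'o I'i yg t1 It1 t10 /= H1.
  pose w k := derive1 (coordf y k).
  (* Since [l o C = f l l], the function [h = l (x')] satisfies the scalar equation
     [h' = - f h^2]. *)
  pose h t := \sum_k w k t * l k.
  have hd t : I' t -> is_derive t 1 h (- (f * h t ^+ 2)).
    move=> It; have wd k := velocity_derive k (yg t It).
    have := is_derive_sum2 (fun k => is_derive_mulr (l k) (wd k)).
    rewrite (_ : \sum_a _ = - (f * h t ^+ 2))//.
    transitivity (- \sum_i \sum_j w i t * w j t * (\sum_k symb C i j k * l k)).
      by rewrite !sum2 /w; move: (fun k => derive1 (coordf y k) t) (symb C) => u c; ring.
    congr (- _); rewrite (eq_bigr (fun i => \sum_j w i t * w j t * (f * l i * l j))); last first.
      by move=> i _; apply: eq_bigr => j _; rewrite lC.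
    by rewrite /h !sum2; ring.
  (* [f t h - 1] solves the linear equation [D' = - f h D], padded with a zero component to fit
     [linear_system_unique]. The coefficient is regular at 0, so [D] vanishes on all of the
     interval, whereas its value at 0 would be [-1]. *)
  pose D (i : 'I_2) t : R := if i == 0 then f * (t * h t) - 1 else 0.
  pose L (i k : 'I_2) t : R := if k == 0 then - (f * h t) else 0.
  have Dz t : I' t -> D 0 t = 0.
    move=> It; apply: (linear_system_unique (L := L) (t0 := t1) I'i) => //.
    + move=> s k Is; rewrite sum2; case: (ord2P k) => ->; rewrite /L /D /=; last first.
        by rewrite !mul0r addr0; exact: is_derive_cst.
      have := is_deriveB (is_derive_mull f (is_deriveMl (is_derive_id s (1 : R)) (hd s Is))) (is_derive_cst (1 : R) s (1 : R)).
      rewrite (_ : f * (1 * h s + id s * - (f * h s ^+ 2)) - 0 = - (f * h s) * (f * (s * h s) - 1) + - (f * h s) * 0)//.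
      by rewrite /=; ring.
    + move=> s i k Is; rewrite /L; case: (ord2P k) => -> /=; last exact: cst_continuous.
      apply: continuousN; apply: continuousM; first exact: cst_continuous.
      exact: is_derive_cont (hd s Is).
    + move=> k; rewrite /D; case: ifP => // _; apply/eqP; rewrite subr_eq0 -H1; apply/eqP.
      by congr (f * _); rewrite /h mulr_sumr; apply: eq_bigr => i _; rewrite !mxE mulrA.
  split; first by move=> /Dz; rewrite /D /= mul0r mulr0 sub0r => /eqP; rewrite oppr_eq0 oner_eq0.
  move=> t2 It2 t20; move/eqP: (Dz t2 It2); rewrite /D /= subr_eq0 => /eqP E; rewrite -[RHS]E.
  by congr (f * _); rewrite /h mulr_sumr; apply: eq_bigr => i _; rewrite !mxE mulrA.
- rewrite /= -[RHS](divff f0); congr (f * _); exact: x1.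
Qed.

End Rank1Geodesics.

(** * Geodesics of plane models *)

Section PlaneGeodesics.
Variable R : realType.
Implicit Types (C : typeA R) (J : set R) (x y : R -> plane R).

Section General.
Variables (G : christoffel R) (Gsmooth : forall i j k, smooth setT (fun z => G z i j k))
  (Gsym : forall z i j k, G z i j k = G z j i k).

Let M := plane_surface Gsmooth Gsym.

Lemma plane_geodesicP J (x : R -> plane R) : geodesic (M := M) J x <->
  [/\ open J, is_interval J & forall t, J t -> geodesic_at G x t].
Proof.
split=> [[Jo Ji H]|[Jo Ji H]]; split=> // t Jt.
  by have [_ /(_ _ erefl I)] := H t Jt.
split; first by apply: curve_cont => k; have [] := H t Jt k.
by move=> _ -> _; exact: H.
Qed.

Lemma derive1_shift (f : R -> R) (c : R) :
  derive1 (fun s => f (s - c)) = (fun t => derive1 f (t - c)).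
Proof.
apply/funext => t; rewrite /derive1.
set g := (fun h : R => _); set g' := (fun h : R => _).
suff -> : g = g' by [].
by apply/funext => h; rewrite /g /g' /= addrA.
Qed.

Lemma derivable_shift (f : R -> R) (c t : R) :
  derivable f (t - c) 1 -> derivable (fun s => f (s - c)) t 1.
Proof.
rewrite /derivable; set g := fun h => _; set g' := fun h => _.
suff -> : g' = g by [].
by apply/funext => h; rewrite /g /g' /= addrA.
Qed.

Lemma geodesic_at_shift (x : R -> plane R) (c t : R) :
  geodesic_at G x (t - c) -> geodesic_at G (fun s => x (s - c)) t.
Proof.
move=> H k; have [H1 H2 H3] := H k.
have E i : derive1 (coordf (fun s => x (s - c)) i) = (fun t => derive1 (coordf x i) (t - c)).
  exact: derive1_shift (coordf x i) c.
split; first exact: derivable_shift (coordf x k) c t H1.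
  by rewrite E; exact: derivable_shift.
by under eq_bigr do under eq_bigr do rewrite !E; rewrite E derive1_shift.
Qed.

Lemma complete_planeI :
  (forall p v, exists x : R -> plane R, [/\ forall t, geodesic_at G x t, x 0 = p & velocity x 0 = v]) ->
  (forall J (x y : R -> plane R) t0, is_interval J -> J t0 ->
    (forall t, J t -> geodesic_at G x t) -> (forall t, J t -> geodesic_at G y t) ->
    x t0 = y t0 -> velocity x t0 = velocity y t0 -> forall t, J t -> x t = y t) ->
  geodesically_complete M.
Proof.
move=> ex un J x /plane_geodesicP[Jo Ji xg].
(* [geodesic] admits an empty [J]; any complete geodesic extends it. *)
have [[t0 Jt0]|J0] := pselect (exists t, J t); last first.
  have [y [yg _ _]] := ex 0 0; exists y; last by move=> t Jt; case: J0; exists t.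
  by apply/plane_geodesicP; split=> //; exact: openT.
have [y [yg y0 yv]] := ex (x t0) (velocity x t0).
have yg' t : geodesic_at G (fun s => y (s - t0)) t by apply: geodesic_at_shift.
exists (fun s => y (s - t0)); first by apply/plane_geodesicP; split=> //; exact: openT.
apply: (un J (fun s => y (s - t0)) x t0) => //; first by rewrite subrr.
rewrite -yv; apply/rowP => k; rewrite !mxE.
by rewrite (derive1_shift (coordf y k) t0) subrr.
Qed.

End General.

Lemma equal_positions J x y t0 : is_interval J -> J t0 ->
  (forall t k, J t -> derivable (coordf x k) t 1) ->
  (forall t k, J t -> derivable (coordf y k) t 1) ->
  (forall t k, J t -> derive1 (coordf x k) t = derive1 (coordf y k) t) ->
  x t0 = y t0 -> forall t, J t -> x t = y t.
Proof.
move=> Ji Jt0 xd yd E xy t Jt; apply/rowP => k; apply/eqP; rewrite -subr_eq0; apply/eqP.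
apply: (linear_system_unique (J := J) (D := fun k t => x t 0 k - y t 0 k) (L := fun _ _ => cst 0) (t0 := t0)) => //.
- move=> s i Js; rewrite sum2 !mul0r addr0.
  have := is_deriveB (derive1P (xd s i Js)) (derive1P (yd s i Js)).
  by rewrite E// subrr.
- by move=> s i j Js; exact: cst_continuous.
- by move=> i; rewrite xy subrr.
Qed.

(** For constant symbols the velocity alone satisfies a quadratic equation, and polarisation makes
    the difference of two velocities a solution of a linear system; equality of the positions
    follows. *)
Lemma const_geodesic_unique C J x y t0 : is_interval J -> J t0 ->
  (forall t, J t -> geodesic_at (fun=> symb C) x t) ->
  (forall t, J t -> geodesic_at (fun=> symb C) y t) ->
  x t0 = y t0 -> velocity x t0 = velocity y t0 -> forall t, J t -> x t = y t.
Proof.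
move=> Ji Jt0 xg yg xy vxy.
have xd t k : J t -> derivable (coordf x k) t 1 by move=> Jt; have [] := xg t Jt k.
have yd t k : J t -> derivable (coordf y k) t 1 by move=> Jt; have [] := yg t Jt k.
apply: (equal_positions Ji Jt0 xd yd) => // t k Jt; apply/eqP; rewrite -subr_eq0; apply/eqP.
pose w i t := derive1 (coordf x i) t; pose w' i t := derive1 (coordf y i) t.
apply: (linear_system_unique (J := J) (D := fun k t => w k t - w' k t)
  (L := fun i k t => - \sum_j symb C i j k * (w j t + w' j t)) (t0 := t0)) => //.
- move=> s i Js.
  have := is_deriveB (velocity_derive i (xg s Js)) (velocity_derive i (yg s Js)).
  rewrite (_ : \sum_i0 - _ * _ = - (\sum_i0 \sum_j symb C i0 j i * w i0 s * w j s) -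
     - (\sum_i0 \sum_j symb C i0 j i * w' i0 s * w' j s))//.
  have Cs := symb_sym C; rewrite !sum2 !(Cs 1 0).
  by move: (symb C) (w 0 s) (w 1 s) (w' 0 s) (w' 1 s) => *; ring.
- move=> s i j Js; apply: continuousN; apply: continuous_sum2 => l.
  apply: continuousM; first exact: cst_continuous.
  by apply: continuousD; apply: is_derive_cont; apply: velocity_derive; [exact: xg|exact: yg].
- by move=> i; have := congr1 (fun v : plane R => v 0 i) vxy; rewrite !mxE /w /w' => ->; rewrite subrr.
Qed.

Lemma model_completeI C :
  (forall p v, exists x, [/\ forall t, geodesic_at (fun=> symb C) x t, x 0 = p & velocity x 0 = v]) ->
  geodesically_complete (model C).
Proof.
move=> H; apply: complete_planeI => // J x y t0; exact: const_geodesic_unique.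
Qed.

(** On a complete extension, [t] times the velocity is continuous at 0 and equals [v] for [t > 0],
    but it is 0 at 0. *)
Lemma log_incomplete C v : v != 0 -> cprod (symb C) v v = v -> geodesically_incomplete (model C).
Proof.
move=> v0 vv comp.
have g : geodesic (M := model C) [set t | 0 < t] (fun t => ln t *: v).
  apply/plane_geodesicP; split; [exact: open_pos| |by move=> t; exact: log_geodesic_at].
  by move=> a b /= a0 b0 z /andP[az _]; exact: lt_le_trans az.
have [tau /plane_geodesicP[_ _ tg] tE] := comp _ _ g.
move/eqP: v0; apply; apply/rowP => k; rewrite [RHS]mxE.
pose w := derive1 (coordf tau k).
have wc : {for 0, continuous (fun t : R => t * w t - v 0 k)}.
  apply: continuousB; last exact: cst_continuous.
  apply: continuousM; first exact: cvg_id.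
  exact: is_derive_cont (velocity_derive k (tg 0 I)).
have := cont_zero_right wc; rewrite mul0r sub0r => H.
apply/eqP; rewrite -oppr_eq0; apply/eqP; apply: H.
apply/nbhs_ballP; exists 1 => //= t _ t0.
have E : \forall s \near t, coordf (fun s : R => ln s *: v) k s = coordf tau k s.
  by apply: filterS (near_pos t0) => s s0; rewrite /coordf tE.
have := log_velocity v k t0; rewrite derive1E (near_eq_derive _ E) -derive1E /w => ->.
by rewrite mulrA divff ?mul1r ?subrr// gt_eqF.
Qed.

Lemma modeled_on_self C : modeled_on (model C) C.
Proof.
move=> p; exists (plane_chart R) => // d ->.
by split; exact: plane_compat.
Qed.

End PlaneGeodesics.

(** * Linear changes of coordinates *)

Section LinearMaps.
Variable R : realType.
Implicit Types (C : typeA R) (U : set (plane R)).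

Lemma affine_mapI U (G G' : christoffel R) (F : plane R -> plane R)
    (dF : 'I_2 -> 'I_2 -> plane R -> R) (ddF : 'I_2 -> 'I_2 -> 'I_2 -> plane R -> R) :
  open U -> smooth_map U F ->
  (forall x i k, U x -> is_derive x (coord_vec R i) (component F k) (dF i k x)) ->
  (forall x i j k, U x -> is_derive x (coord_vec R i) (dF j k) (ddF i j k x)) ->
  (forall x i j k, U x -> ddF i j k x + \sum_a \sum_b dF i a x * dF j b x * G' (F x) a b k =
    \sum_l G x i j l * dF l k x) ->
  affine_map U G G' F.
Proof.
move=> Uo Fs D1 D2 E; split=> // x Ux i j k.
have p1 a b y : U y -> partial a (component F b) y = dF a b y.
  by move=> Uy; have [_] := D1 y a b Uy.
rewrite (partial_ext i Uo Ux (p1 j k)).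
have [_ H] := D2 x i j k Ux; rewrite /partial H.
apply: etrans (etrans (E x i j k Ux) _).
  congr (_ + _); apply: eq_bigr => a _; apply: eq_bigr => b _.
  by rewrite -/(partial i _ x) -/(partial j _ x) !p1.
by apply: eq_bigr => l _; rewrite -/(partial l _ x) p1.
Qed.

Lemma is_derive_coord (x : plane R) i k :
  is_derive x (coord_vec R i) (fun y : plane R => y 0 k) (i == k)%:R.
Proof.
apply: DeriveDef; first exact: derivable_coord.
by rewrite -/(partial i (fun y : plane R => y 0 k) x) partial_coord.
Qed.

Lemma linear_component (T : 'M[R]_2) k :
  component (fun x : plane R => x *m T) k = (fun x => \sum_j x 0 j * T j k).
Proof. by apply/funext => x; rewrite /component mxE. Qed.

Lemma linear_derive (T : 'M[R]_2) x i k :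
  is_derive x (coord_vec R i) (component (fun x : plane R => x *m T) k) (T i k).
Proof.
rewrite linear_component.
have := is_derive_sum2 (fun j => is_derive_mulr (T j k) (is_derive_coord x i j)).
by rewrite sum2; case: (ord2P i) => -> /=; rewrite mul1r mul0r ?addr0 ?add0r.
Qed.

Lemma linear_affineP (T : 'M[R]_2) C C' :
  affine_map setT (fun=> symb C) (fun=> symb C') (fun x => x *m T) <->
  forall i j k, \sum_a \sum_b T i a * T j b * symb C' a b k = \sum_l symb C i j l * T l k.
Proof.
split=> [[_ H] i j k|H].
  have := H 0 Logic.I i j k.
  have p a b : partial a (component (fun x : plane R => x *m T) b) = cst (T a b).
    by apply/funext => x; have [_] := linear_derive T x a b.
  rewrite p partial_cst add0r.
  under eq_bigr do under eq_bigr do rewrite !p.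
  by under [RHS]eq_bigr do rewrite p.
apply: (@affine_mapI _ _ _ _ (fun i k => cst (T i k)) (fun i j k => cst 0)) => //.
- exact: openT.
- move=> k n; rewrite linear_component; apply: Ck_sum => [|j]; first exact: openT.
  apply: CkM; [exact: openT|exact: smooth_coord|exact: Ck_cst].
- by move=> x i k _; exact: linear_derive.
- by move=> x i j k _; rewrite /= add0r H.
Qed.

Lemma linear_cprodP (T : 'M[R]_2) C C' :
  (forall i j k, \sum_a \sum_b T i a * T j b * symb C' a b k = \sum_l symb C i j l * T l k) <->
  forall u v, cprod (symb C') (u *m T) (v *m T) = cprod (symb C) u v *m T.
Proof.
split=> [H u v|H i j k].
  apply/rowP => k; rewrite [LHS]mxE [RHS]mxE.
  transitivity (\sum_i \sum_j u 0 i * v 0 j * (\sum_a \sum_b T i a * T j b * symb C' a b k)).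
    under eq_bigr do under eq_bigr do rewrite !mxE.
    by rewrite !sum2; move: (symb C') => c; ring.
  under eq_bigr do under eq_bigr do rewrite H.
  under [RHS]eq_bigr do rewrite mxE.
  by rewrite !sum2; move: (symb C) => c; ring.
have := congr1 (fun w : plane R => w 0 k) (H (coord_vec R i) (coord_vec R j)).
have RR a b : (coord_vec R a *m T) 0 b = T a b by rewrite -rowE mxE.
rewrite /= cprodE [X in _ = X -> _]mxE sum2 !cprodE !RR !coord_vecE !sum2.
move: (symb C) (symb C') => c c'.
by case: (ord2P i) => ->; case: (ord2P j) => -> /=; rewrite !(mul0r, mul1r, mulr0, mulr1, add0r, addr0).
Qed.

Lemma linear_iso_complete C C' : linearly_isomorphic C C' ->
  geodesically_complete (model C') -> geodesically_complete (model C).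
Proof.
move=> [T Tu TA] comp J x /plane_geodesicP[Jo Ji xg].
have TI := (linear_cprodP T C C').1 ((linear_affineP T C C').1 TA).
have TA' : affine_map setT (fun=> symb C') (fun=> symb C) (fun x => x *m invmx T).
  apply/linear_affineP/linear_cprodP => u v.
  by rewrite -[LHS](mulmxK Tu) -TI !mulmxKV.
have push c (D D' : typeA R) (S : 'M[R]_2) (I' : set R) : open I' ->
    affine_map setT (fun=> symb D) (fun=> symb D') (fun x => x *m S) ->
    (forall t, I' t -> geodesic_at (fun=> symb D) c t) ->
    forall t, I' t -> geodesic_at (fun=> symb D') (fun t => c t *m S) t.
  move=> Io SA cg t It.
  apply: (geodesic_push (c := c) openT SA) => //; last exact: cg.
  have : \forall s \near t, I' s by apply: open_nbhs_nbhs; split.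
  by apply: filterS => s Is k; have [] := cg s Is k.
have yg : geodesic (M := model C') J (fun t => x t *m T).
  by apply/plane_geodesicP; split=> //; exact: push xg.
have [tau /plane_geodesicP[_ _ tg] tE] := comp _ _ yg.
exists (fun t => tau t *m invmx T).
  by apply/plane_geodesicP; split=> //; [exact: openT|exact: push openT TA' tg].
by move=> t Jt; rewrite tE// mulmxK.
Qed.

End LinearMaps.

(** * Explicit geodesics of [C2] and [tildeM3] *)

Section ExplicitGeodesics.
Variable R : realType.

Lemma geodesic_at_pt (G : christoffel R) (X Y X1 Y1 X2 Y2 : R -> R) :
  (forall t : R, is_derive t (1 : R) X (X1 t)) -> (forall t : R, is_derive t (1 : R) Y (Y1 t)) ->
  (forall t : R, is_derive t (1 : R) X1 (X2 t)) -> (forall t : R, is_derive t (1 : R) Y1 (Y2 t)) ->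
  (forall t k, (if k == 0 then X2 t else Y2 t) +
     (G (pt (X t) (Y t)) 0 0 k * X1 t * X1 t + G (pt (X t) (Y t)) 0 1 k * X1 t * Y1 t +
     (G (pt (X t) (Y t)) 1 0 k * Y1 t * X1 t + G (pt (X t) (Y t)) 1 1 k * Y1 t * Y1 t)) = 0) ->
  (forall t, geodesic_at G (fun t => pt (X t) (Y t)) t) /\
  (forall t, velocity (fun t => pt (X t) (Y t)) t = pt (X1 t) (Y1 t)).
Proof.
move=> Xd Yd X1d Y1d E.
pose dx (k : 'I_2) := if k == 0 then X1 else Y1.
have D (t : R) k : is_derive t (1 : R) (coordf (fun t => pt (X t) (Y t)) k) (dx k t).
  rewrite (_ : coordf _ k = if k == 0 then X else Y); last first.
    by apply/funext => s; rewrite /coordf mxE; case: ifP.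
  by rewrite /dx; case: ifP.
split=> t; last first.
  by apply/rowP => k; rewrite !mxE derive1E; have [_ ->] := D t k; rewrite /dx; case: ifP.
apply: (@geodesic_atI _ _ _ dx (fun k t => if k == 0 then X2 t else Y2 t)) => [|k|k].
- by apply/nbhs_ballP; exists 1 => //= s _ k; exact: D.
- by rewrite /dx; case: ifP.
by rewrite !sum2; exact: E.
Qed.

Lemma is_derive_affine (a b t : R) : is_derive t (1 : R) (fun t : R => a + t * b) b.
Proof.
have := is_deriveD (is_derive_cst a t (1 : R)) (is_derive_mulr b (is_derive_id t (1 : R))).
by rewrite mul1r add0r.
Qed.

Lemma is_derive_lin (b t : R) : is_derive t (1 : R) (fun t : R => t * b) b.
Proof. by have := is_derive_mulr b (is_derive_id t (1 : R)); rewrite mul1r. Qed.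

Lemma C2_complete : geodesically_complete (model (C2 R)).
Proof.
apply: model_completeI => p v; pose b := v 0 1.
have Ed (t : R) : is_derive t (1 : R) (fun t => expR (t * b)) (expR (t * b) * b).
  exact: (@is_derive1_comp _ expR (fun t => t * b) t _ _ (is_derive_expR _) (is_derive_lin b t)).
(* The equations are [y'' = 0] and [x'' = x' y'], so [x'] is a multiple of [exp (b t)]; [S] is its
   primitive vanishing at 0. *)
pose S t := if b == 0 then t else (expR (t * b) - 1) / b.
have Sd (t : R) : is_derive t (1 : R) S (expR (t * b)).
  rewrite /S; case: eqVneq => [->|b0].
    by rewrite mulr0 expR0; exact: is_derive_id.
  have := is_derive_mulr b^-1 (is_deriveB (Ed t) (is_derive_cst (1 : R) t (1 : R))).
  by rewrite subr0 mulfK.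
have S0 : S 0 = 0 by rewrite /S mul0r expR0 subrr mul0r; case: ifP.
have H1 (t : R) : is_derive t (1 : R) (fun t => p 0 0 + S t * v 0 0) (expR (t * b) * v 0 0).
  have := is_deriveD (is_derive_cst (p 0 0) t (1 : R)) (is_derive_mulr (v 0 0) (Sd t)).
  by rewrite add0r.
have [t k|g w] := geodesic_at_pt (G := fun=> symb (C2 R)) H1 (is_derive_affine (p 0 1) b)
  (fun t => is_derive_mulr (v 0 0) (Ed t)) (fun t => is_derive_cst b t (1 : R)).
  by case: (ord2P k) => -> /=; rewrite /mk_symbols /=; field.
exists (fun t => pt (p 0 0 + S t * v 0 0) (p 0 1 + t * b)); split=> //.
  by rewrite S0 !mul0r !addr0 pt_eta.
by rewrite w mul0r expR0 mul1r pt_eta.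
Qed.

Lemma tildeM3_complete : geodesically_complete (tildeM3 R).
Proof.
apply: complete_planeI => [p v|J x y t0 Ji Jt0 xg yg xy vxy].
  pose b := v 0 1.
  (* With [y' = b] constant, [x'' = - b^2 x] is a harmonic oscillator; [S] is the solution with
     [S 0 = 0] and [S' 0 = 1]. *)
  pose S t := if b == 0 then t else sin (t * b) / b.
  have Sd (t : R) : is_derive t (1 : R) S (cos (t * b)).
    rewrite /S; case: eqVneq => [->|b0].
      by rewrite mulr0 cos0; exact: is_derive_id.
    have := is_derive_mulr b^-1 (@is_derive1_comp _ sin (fun t => t * b) t _ _ (is_derive_sin _) (is_derive_lin b t)).
    by rewrite mulfK.
  have Cd (t : R) : is_derive t (1 : R) (fun t => cos (t * b)) (- (b ^+ 2 * S t)).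
    have := @is_derive1_comp _ cos (fun t => t * b) t _ _ (is_derive_cos _) (is_derive_lin b t).
    rewrite mulNr (_ : sin (t * b) * b = b ^+ 2 * S t)//.
    rewrite /S; case: eqVneq => [->|b0]; first by rewrite mulr0 expr0n mul0r.
    by field.
  have S0 : S 0 = 0 by rewrite /S mul0r sin0 mul0r; case: ifP.
  have H1 (t : R) : is_derive t (1 : R) (fun t => cos (t * b) * p 0 0 + S t * v 0 0)
      (- (b ^+ 2 * S t) * p 0 0 + cos (t * b) * v 0 0).
    exact: is_deriveD (is_derive_mulr (p 0 0) (Cd t)) (is_derive_mulr (v 0 0) (Sd t)).
  have H2 (t : R) : is_derive t (1 : R) (fun t => - (b ^+ 2 * S t) * p 0 0 + cos (t * b) * v 0 0)
      (- (b ^+ 2 * cos (t * b)) * p 0 0 + - (b ^+ 2 * S t) * v 0 0).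
    exact: is_deriveD (is_derive_mulr (p 0 0) (is_deriveN (is_derive_mull (b ^+ 2) (Sd t))))
      (is_derive_mulr (v 0 0) (Cd t)).
  have [t k|g w] := geodesic_at_pt (G := @tildeG3 R) H1 (is_derive_affine (p 0 1) b)
    H2 (fun t => is_derive_cst b t (1 : R)).
    by case: (ord2P k) => -> /=; rewrite /tildeG3 /mk_symbols /= ?mxE /=; ring.
  exists (fun t => pt (cos (t * b) * p 0 0 + S t * v 0 0) (p 0 1 + t * b)); split=> //.
    by rewrite S0 !mul0r cos0 mul1r !addr0 pt_eta.
  by rewrite w S0 mulr0 oppr0 mul0r add0r mul0r cos0 mul1r pt_eta.
have xd t k : J t -> derivable (coordf x k) t 1 by move=> Jt; have [] := xg t Jt k.
have yd t k : J t -> derivable (coordf y k) t 1 by move=> Jt; have [] := yg t Jt k.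
have acc (z : R -> plane R) t : geodesic_at (@tildeG3 R) z t ->
    is_derive t 1 (derive1 (coordf z 0)) (- (z t 0 0 * derive1 (coordf z 1) t ^+ 2)) /\
    is_derive t 1 (derive1 (coordf z 1)) 0.
  move=> zg; split.
    have [_ H /eqP] := zg 0; rewrite addr_eq0 !sum2 /tildeG3 /mk_symbols /= => /eqP E.
    have := derive1P H; rewrite E (_ : - _ = - (z t 0 0 * derive1 (coordf z 1) t ^+ 2))//.
    by congr (- _); ring.
  have [_ H /eqP] := zg 1; rewrite addr_eq0 !sum2 /tildeG3 /mk_symbols /= => /eqP E.
  by have := derive1P H; rewrite E !mul0r !addr0 oppr0.
pose w k t := derive1 (coordf x k) t; pose w' k t := derive1 (coordf y k) t.
have w0 k : w k t0 = w' k t0 by have := congr1 (fun v : plane R => v 0 k) vxy; rewrite !mxE.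
have x0 k : x t0 0 k = y t0 0 k by rewrite xy.
(* The symbols are not constant, so uniqueness goes in two stages: the second velocity components
   agree first, and then the differences in the first position and velocity solve a linear
   system. *)
have w1 t : J t -> w 1 t = w' 1 t.
  move=> Jt; apply/eqP; rewrite -subr_eq0; apply/eqP.
  apply: (@linear_system_unique _ J (fun k t => w 1 t - w' 1 t) (fun _ _ => cst 0) t0 t Ji _ _ Jt0 Jt _ 0).
  - move=> s i Js; rewrite sum2 !mul0r addr0.
    by have := is_deriveB (acc x s (xg s Js)).2 (acc y s (yg s Js)).2; rewrite subr0.
  - by move=> s i j _; exact: cst_continuous.
  - by move=> _; rewrite w0 subrr.
pose D (k : 'I_2) t := if k == 0 then x t 0 0 - y t 0 0 else w 0 t - w' 0 t.
pose L (i k : 'I_2) t : R := if k == 0 then (if i == 0 then 0 else 1) else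
  (if i == 0 then - (w 1 t * w 1 t) else 0).
have Dz t k : J t -> D k t = 0.
  move=> Jt; apply: (@linear_system_unique _ J D L t0 t Ji _ _ Jt0 Jt).
  - move=> s i Js; rewrite sum2 /L /D; case: (ord2P i) => -> /=.
      rewrite mul0r mul1r add0r.
      exact: is_deriveB (derive1P (xd s 0 Js)) (derive1P (yd s 0 Js)).
    rewrite mul0r addr0.
    have := is_deriveB (acc x s (xg s Js)).1 (acc y s (yg s Js)).1.
    rewrite -/(w 1 s) -/(w' 1 s) -w1// (_ : - _ - - _ = - (w 1 s * w 1 s) * (x s 0 0 - y s 0 0))//.
    ring.
  - move=> s i j Js; rewrite /L; case: (j == 0); case: (i == 0); try exact: cst_continuous.
    apply: continuousN; have c := is_derive_cont (acc x s (xg s Js)).2.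
    exact: (continuousM c c).
  - by move=> i; rewrite /D; case: ifP => _; rewrite ?x0 ?w0 subrr.
apply: (equal_positions Ji Jt0 xd yd) => // t k Jt; case: (ord2P k) => ->; last exact: w1.
by apply/eqP; rewrite -subr_eq0; apply/eqP; exact: (Dz t 1).
Qed.

End ExplicitGeodesics.

(* The coordinates [u = - ln (x + h y), v = y] on the domain [x + h y > 0], in which C1
   (for constant h) and C3 (for h'' = - h) describe the connections of C2 and of tildeM3. *)
Section LogCharts.
Variable R : realType.
Variables (h h1 h2 : R -> R).
Hypotheses (hd : forall t : R, is_derive t (1 : R) h (h1 t))
  (h1d : forall t : R, is_derive t (1 : R) h1 (h2 t))
  (hs : smooth setT (fun x : plane R => h (x 0 1))).
Implicit Types x u : plane R.

Definition shifted x : R := x 0 0 + h (x 0 1).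
Definition log_dom : set (plane R) := [set x | 0 < shifted x].
Definition log_coord x : plane R := pt (- ln (shifted x)) (x 0 1).
Definition log_param u : plane R := pt (expR (- u 0 0) - h (u 0 1)) (u 0 1).

Lemma component_pt0 (f g : plane R -> R) : component (fun x => pt (f x) (g x)) 0 = f.
Proof. by apply/funext => x; rewrite /component pt0. Qed.

Lemma component_pt1 (f g : plane R -> R) : component (fun x => pt (f x) (g x)) 1 = g.
Proof. by apply/funext => x; rewrite /component pt1. Qed.

Lemma shifted_smooth U : open U -> smooth U shifted.
Proof.
move=> Uo n; apply: CkD => //; first exact: smooth_coord.
exact: Ck_sub (hs n).
Qed.

Lemma log_dom_open : open log_dom.
Proof.
rewrite openE => x Dx.
have c : shifted @ x --> shifted x by apply: (Ck_cont (shifted_smooth openT 0%N) Logic.I).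
have N : \forall y \near shifted x, 0 < y by exact: lt_nbhsr.
exact: c N.
Qed.

Lemma log_coord_smooth : smooth_map log_dom log_coord.
Proof.
move=> k n; case: (ord2P k) => ->; rewrite ?component_pt0 ?component_pt1; last exact: smooth_coord.
apply: CkN; first exact: log_dom_open.
apply: Ck_ln => //; first exact: log_dom_open.
by apply: shifted_smooth; exact: log_dom_open.
Qed.

Lemma log_param_smooth : smooth_map setT log_param.
Proof.
move=> k n; case: (ord2P k) => ->; rewrite ?component_pt0 ?component_pt1; last exact: smooth_coord.
apply: CkD; first exact: openT.
  apply: Ck_exp; first exact: openT.
  by apply: CkN; [exact: openT|exact: smooth_coord].
by apply: CkN; [exact: openT|exact: hs].
Qed.

Lemma log_chart_exists : exists c : chart R (plane R),
  [/\ dom c = log_dom, cod c = setT, coord c = log_coord & param c = log_param].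
Proof.
have oT := @openT (plane R).
unshelve eexists (@Chart R (plane R) log_dom setT log_coord log_param log_dom_open oT _ _ _ _ _ _) => //.
- by move=> x _; rewrite /log_dom /= /shifted pt0 pt1 subrK expR_gt0.
- move=> x Dx; rewrite /log_param /log_coord pt0 pt1 opprK lnK; last by rewrite posrE.
  by rewrite /shifted addrK pt_eta.
- move=> u _; rewrite /log_param /log_coord /shifted pt0 pt1 subrK expRK opprK.
  by rewrite pt_eta.
- by move=> x Dx; apply: continuous_plane => a; exact: Ck_cont (log_coord_smooth a 0%N) Dx.
- by move=> x Dx; apply: continuous_plane => a; exact: Ck_cont (log_param_smooth a 0%N) Dx.
Qed.

Definition dparam (i k : 'I_2) u : R :=
  if k == 0 then (if i == 0 then - expR (- u 0 0) else - h1 (u 0 1)) else (i == 1)%:R.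
Definition ddparam (i j k : 'I_2) u : R :=
  if k == 0 then
    (if j == 0 then (if i == 0 then expR (- u 0 0) else 0)
     else (if i == 0 then 0 else - h2 (u 0 1))) else 0.
Definition dcoord (i k : 'I_2) x : R :=
  if k == 0 then (if i == 0 then - (shifted x)^-1 else - (h1 (x 0 1) * (shifted x)^-1)) else (i == 1)%:R.
Definition ddcoord (i j k : 'I_2) x : R :=
  let s' := (shifted x)^-1 in
  if k == 0 then
    (if j == 0 then (if i == 0 then s' * s' else h1 (x 0 1) * (s' * s'))
     else (if i == 0 then h1 (x 0 1) * (s' * s')
           else - (h2 (x 0 1) * s' - h1 (x 0 1) * h1 (x 0 1) * (s' * s')))) else 0.

Lemma is_derive_fun1 (f f1 : R -> R) (fd : forall t : R, is_derive t (1 : R) f (f1 t)) x i :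
  is_derive x (coord_vec R i) (fun y : plane R => f (y 0 1)) (f1 (x 0 1) * (i == 1)%:R).
Proof. exact: (is_derive_comp1 (fd _) (is_derive_coord x i 1)). Qed.

Lemma is_derive_expN x i :
  is_derive x (coord_vec R i) (fun y : plane R => expR (- y 0 0)) (expR (- x 0 0) * - (i == 0)%:R).
Proof. exact: (is_derive_comp1 (is_derive_expR _) (is_deriveN (is_derive_coord x i 0))). Qed.

Lemma is_derive_shifted x i :
  is_derive x (coord_vec R i) shifted ((i == 0)%:R + h1 (x 0 1) * (i == 1)%:R).
Proof. exact: is_deriveD (is_derive_coord x i 0) (is_derive_fun1 hd x i). Qed.

Lemma is_derive_shiftedV x i : log_dom x ->
  is_derive x (coord_vec R i) (fun y => (shifted y)^-1)
    (- ((shifted x)^-1 * (shifted x)^-1) * ((i == 0)%:R + h1 (x 0 1) * (i == 1)%:R)).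
Proof.
by move=> Dx; exact: (is_derive_comp1 (is_derive_inv (lt0r_neq0 Dx)) (is_derive_shifted x i)).
Qed.

Lemma is_derive_to (f : plane R -> R) x v (a b : R) : is_derive x v f a -> a = b -> is_derive x v f b.
Proof. by move=> H <-. Qed.

Lemma log_param_derive x i k : is_derive x (coord_vec R i) (component log_param k) (dparam i k x).
Proof.
case: (ord2P k) => ->; rewrite ?component_pt0 ?component_pt1; last exact: is_derive_coord.
apply: (is_derive_to (is_deriveD (is_derive_expN x i) (is_deriveN (is_derive_fun1 hd x i)))).
by rewrite /dparam /=; case: (ord2P i) => -> /=; ring.
Qed.

Lemma dparam_derive x i j k : is_derive x (coord_vec R i) (dparam j k) (ddparam i j k x).
Proof.
case: (ord2P k) => ->; last by rewrite /dparam /ddparam /=; exact: is_derive_cst.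
case: (ord2P j) => ->; rewrite /dparam /ddparam /=.
  apply: (is_derive_to (is_deriveN (is_derive_expN x i))).
  by case: (ord2P i) => -> /=; ring.
apply: (is_derive_to (is_deriveN (is_derive_fun1 h1d x i))).
by case: (ord2P i) => -> /=; ring.
Qed.

Lemma log_coord_derive x i k : log_dom x ->
  is_derive x (coord_vec R i) (component log_coord k) (dcoord i k x).
Proof.
move=> Dx; case: (ord2P k) => ->; rewrite ?component_pt0 ?component_pt1; last exact: is_derive_coord.
apply: (is_derive_to (is_deriveN (is_derive_comp1 (is_derive1_ln Dx) (is_derive_shifted x i)))).
by rewrite /dcoord /=; case: (ord2P i) => -> /=; ring.
Qed.

Lemma dcoord_derive x i j k : log_dom x -> is_derive x (coord_vec R i) (dcoord j k) (ddcoord i j k x).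
Proof.
move=> Dx; case: (ord2P k) => ->; last by rewrite /dcoord /ddcoord /=; exact: is_derive_cst.
case: (ord2P j) => ->; rewrite /dcoord /ddcoord /=.
  apply: (is_derive_to (is_deriveN (is_derive_shiftedV i Dx))).
  by case: (ord2P i) => -> /=; ring.
apply: (is_derive_to (is_deriveN (is_deriveMl (is_derive_fun1 h1d x i) (is_derive_shiftedV i Dx)))).
by case: (ord2P i) => -> /=; ring.
Qed.

(** The atlas of a plane surface consists of [plane_chart] alone, so the two transformation laws,
    one per direction, are all that [local_coordinates] demands. *)
Lemma log_chart_local (G : christoffel R) (C : typeA R)
    (Gsmooth : forall i j k, smooth setT (fun x => G x i j k))
    (Gsym : forall x i j k, G x i j k = G x j i k) :
  (forall u i j k, ddparam i j k u +
     \sum_a \sum_b dparam i a u * dparam j b u * G (log_param u) a b k =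
     \sum_l symb C i j l * dparam l k u) ->
  (forall x i j k, log_dom x -> ddcoord i j k x +
     \sum_a \sum_b dcoord i a x * dcoord j b x * symb C a b k =
     \sum_l G x i j l * dcoord l k x) ->
  exists2 c : chart R (plane_surface Gsmooth Gsym), dom c = log_dom & local_coordinates c (fun=> symb C).
Proof.
move=> E1 E2; have [c [cd cc cco cp]] := log_chart_exists.
pose M := plane_surface Gsmooth Gsym.
have cd' : @dom R M c = log_dom by exact: cd.
have cco' : @coord R M c = log_coord by exact: cco.
have cp' : @param R M c = log_param by exact: cp.
exists c => // d ->; split; rewrite /chart_affine /= ?cp'.
  apply: (@affine_map_sub _ setT) => //.
  apply: (@affine_mapI _ _ _ _ _ dparam ddparam) => //; first exact: openT.
  - exact: log_param_smooth.
  - by move=> x i k _; exact: log_param_derive.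
  - by move=> x i j k _; exact: dparam_derive.
rewrite cco' cd'; apply: (@affine_map_sub _ log_dom); first by move=> x [].
apply: (@affine_mapI _ _ _ _ _ dcoord ddcoord) => //.
- exact: log_dom_open.
- exact: log_coord_smooth.
- by move=> x i k; exact: log_coord_derive.
- by move=> x i j k; exact: dcoord_derive.
Qed.

End LogCharts.

Section LogModels.
Variable R : realType.

Lemma model2_modeled_on_C1 : modeled_on (model (C2 R)) (C1 R).
Proof.
(* This constant makes [shifted] equal to 1 at [p], so that [p] lies in the domain of the chart. *)
move=> p; pose a : R := 1 - p 0 0.
have cstd (b t : R) : is_derive t (1 : R) (cst b) (0 : R) by exact: is_derive_cst.
have [||c cd cl] := @log_chart_local R (cst a) (cst 0) (cst 0) (cstd a) (cstd 0) (smooth_cst setT a)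
  (fun=> symb (C2 R)) (C1 R) (fun i j k => smooth_cst setT (symb (C2 R) i j k)) (fun=> symb_sym (C2 R)).
- move=> u i j k; rewrite !sum2 /ddparam /dparam /=.
  by case: (ord2P k) => ->; case: (ord2P j) => ->; case: (ord2P i) => ->; rewrite /mk_symbols /=;
  try (move: (expR _) => e); field.
- move=> x i j k Dx; rewrite !sum2 /ddcoord /dcoord /=.
  by case: (ord2P k) => ->; case: (ord2P j) => ->; case: (ord2P i) => ->; rewrite /mk_symbols /=;
  try (move: (shifted _ x)^-1 => e); field.
exists c => //; rewrite cd /log_dom /= /shifted /a /= subrKC; exact: ltr01.
Qed.

(* The shifts of x by solutions of h'' = - h are affine symmetries of tildeM3. *)
Lemma tildeM3_modeled_on_C3 : modeled_on (tildeM3 R) (C3 R).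
Proof.
(* [A] and [B] are chosen so that [h q = 1 - p 0 0]; then [shifted] equals 1 at [p], which puts [p]
   in the domain of the chart. *)
move=> p; pose q := p 0 1; pose A := (1 - p 0 0) * cos q; pose B := (1 - p 0 0) * sin q.
pose h (t : R) := cos t * A + sin t * B.
pose h1 (t : R) := - sin t * A + cos t * B.
have hd (t : R) : is_derive t (1 : R) h (h1 t).
  exact: is_deriveD (is_derive_mulr A (is_derive_cos t)) (is_derive_mulr B (is_derive_sin t)).
have h1d (t : R) : is_derive t (1 : R) h1 (- h t).
  have := is_deriveD (is_derive_mulr A (is_deriveN (is_derive_sin t))) (is_derive_mulr B (is_derive_cos t)).
  by rewrite (_ : _ + _ = - h t)// /h; ring.
have hs : smooth setT (fun x : plane R => h (x 0 1)).
  have oT := @openT (plane R).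
  move=> n; have [sC cC] := Ck_trig oT (@smooth_coord R setT 1 n).
  by apply: CkD => //; apply: CkM => //; exact: Ck_cst.
have [||c cd cl] := @log_chart_local R h h1 (fun t => - h t) hd h1d hs (@tildeG3 R) (C3 R)
  (@tildeG3_smooth R) (fun x => mk_symbols_sym 0 0 0 0 (x 0 0) 0).
- move=> u i j k; rewrite !sum2 /ddparam /dparam /tildeG3 /=.
  by case: (ord2P k) => ->; case: (ord2P j) => ->; case: (ord2P i) => ->; rewrite /mk_symbols /= ?pt0;
  try (move: (expR _) => e); try (move: (h _) => g); try (move: (h1 _) => g1); ring.
- move=> x i j k Dx; rewrite !sum2 /ddcoord /dcoord /tildeG3 /=.
  have s0 : shifted h x != 0 by rewrite gt_eqF.
  have xE : x 0 0 = shifted h x - h (x 0 1) by rewrite /shifted addrK.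
  by case: (ord2P k) => ->; case: (ord2P j) => ->; case: (ord2P i) => ->; rewrite /mk_symbols /= ?xE;
  move: (shifted h x) s0 => s s0; try (move: (h _) => g); try (move: (h1 _) => g1); field.
exists c => //; rewrite cd /log_dom /= /shifted /h /A /B -/q.
have -> : cos q * ((1 - p 0 0) * cos q) + sin q * ((1 - p 0 0) * sin q) =
  (1 - p 0 0) * (cos q ^+ 2 + sin q ^+ 2) by ring.
by rewrite cos2Dsin2 mulr1 subrKC; exact: ltr01.
Qed.

End LogModels.

(** * Completeness of the models with Ricci tensor of rank two *)

Section Primitive.
Variable R : realType.
Implicit Types f : R -> R.

Lemma primitive_right_of f (a : R) : (forall x : R, {for x, continuous f}) ->
  exists F, forall x, a < x -> is_derive x (1 : R) F (f x).
Proof.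
move=> fc; pose mu := @lebesgue_measure R.
exists (fun x => \int[mu]_(t in [set` `[a, x]]) (f t))%R => x ax.
have xu : x < x + 1 by rewrite ltrDl.
have fi : mu.-integrable `[a, x + 1] (EFin \o f).
  apply: continuous_compact_integrable; first exact: segment_compact.
  by apply: continuous_subspaceT => y; exact: fc.
have [Fd FE] := continuous_FTC1_closed xu fi ax (fc x).
by split; [exact: Fd|rewrite -derive1E; exact: FE].
Qed.

(** An integral from [- n] is a primitive only to the right of [- n]. Normalised to vanish at 0,
    these primitives agree where both are valid, and at [x] the one with [n] an integer above [|x|]
    is used. *)
Lemma primitive_exists f : (forall x : R, {for x, continuous f}) ->
  exists F, forall x : R, is_derive x (1 : R) F (f x).
Proof.
move=> fc.
have [F FP] := choice (fun n : nat => primitive_right_of (- n%:R) fc).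
pose G n x := F n x - F n 0.
have Gd n x : `|x| < n%:R -> is_derive x (1 : R) (G n) (f x).
  move=> xn; have := is_deriveB (FP n x _) (is_derive_cst (F n 0) x (1 : R)).
  by rewrite subr0; apply; move: xn; rewrite ltr_norml => /andP[].
have GE n m x : `|x| < n%:R -> `|x| < m%:R -> G n x = G m x.
  move=> xn xm; apply/eqP; rewrite -subr_eq0; apply/eqP.
  have Ji : is_interval [set y : R | `|y| <= `|x|].
    move=> a b /=; rewrite !ler_norml => /andP[a1 a2] /andP[b1 b2] z /andP[az zb].
    by rewrite /= ler_norml (le_trans a1 az) (le_trans zb b2).
  apply: (@linear_system_unique R _ (fun _ x => G n x - G m x) (fun _ _ => cst 0) 0 x Ji _ _ _ _ _ 0).
  - move=> s _ sx; rewrite sum2 !mul0r addr0.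
    have := is_deriveB (Gd n s (le_lt_trans sx xn)) (Gd m s (le_lt_trans sx xm)).
    by rewrite subrr.
  - by move=> s _ _ _; exact: cst_continuous.
  - by rewrite /= normr0.
  - by rewrite /=.
  - by move=> _; rewrite /G !subrr.
pose N (x : R) := Num.bound `|x|.
have NP x : `|x| < (N x)%:R by apply: archi_boundP.
exists (fun x => G (N x) x) => x.
have near_lt : \forall y \near x, `|y| < (N x)%:R.
  have c : Num.norm @ x --> `|x| by exact: norm_continuous.
  have M : \forall z \near `|x|, z < (N x)%:R by exact: lt_nbhsl.
  exact: c M.
apply: (near_eq_is_derive _ (Gd _ _ (NP x))).
by apply: filterS near_lt => y yN; exact: GE.
Qed.

(** Separation of variables: [U] inverts a primitive [T] of [g]. The lower bound [m] makes [T] grow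
    at least linearly, hence bijective on the line, so the solution lives for all times. *)
Lemma flow_exists (g : R -> R) (m : R) : 0 < m -> (forall x : R, {for x, continuous g}) ->
  (forall x, m <= g x) ->
  exists U : R -> R, (forall u, exists t, U t = u) /\
    forall t : R, is_derive t (1 : R) U (g (U t))^-1.
Proof.
move=> m0 gc mg.
have [T Td] := primitive_exists gc.
have growth a b : a <= b -> m * (b - a) <= T b - T a.
  move=> ab; have [c _ ->] := MVT_cc ab (fun s _ => Td s).
  by rewrite ler_wpM2r// subr_ge0.
have Tinj a b : T a = T b -> a = b.
  wlog ab : a b / a <= b => [H E|E].
    by case: (leP a b) => [/H/(_ E)//|/ltW/H/(_ (esym E))].
  have := growth _ _ ab; rewrite E subrr pmulr_rle0// subr_le0 => ba.
  by apply/eqP; rewrite eq_le ab.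
have Tsurj t : exists u, T u = t.
  pose r := `|t - T 0| / m.
  have r0 : 0 <= r by rewrite divr_ge0// ltW.
  have mr : m * r = `|t - T 0| by rewrite /r mulrC divfK// gt_eqF.
  have h1 : t <= T r.
    have := growth _ _ r0; rewrite subr0 mr; have := ler_norm (t - T 0); lra.
  have rN : - r <= 0 by rewrite oppr_le0.
  have h2 : T (- r) <= t.
    have := growth _ _ rN; rewrite sub0r opprK mr.
    by have := ler_norm (- (t - T 0)); rewrite normrN; lra.
  have rr : - r <= r by apply: le_trans r0.
  have [|c _ <-] := @IVT R T (- r) r t rr (within_cont (fun s _ => Td s)); last by exists c.
  by rewrite ge_min h2 le_max h1 orbT.
have [U TU] := choice Tsurj.
have UT u : U (T u) = u by apply: Tinj; rewrite TU.
exists U; split; first by move=> u; exists (T u).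
move=> t; rewrite -{1}(TU t).
apply: (@is_derive_inverse R T U (g (U t)) (U t)).
- by apply/nbhs_ballP; exists 1 => //= u _; exact: UT.
- by apply/nbhs_ballP; exists 1 => //= u _; exact: is_derive_cont (Td u).
- by rewrite gt_eqF// (lt_le_trans m0).
Qed.

End Primitive.

(** * Geodesics of [Cminus delta] *)

Section CminusComplete.
Variable R : realType.

Definition sh (u : R) : R := (expR u - expR (- u)) / 2.
Definition ch (u : R) : R := (expR u + expR (- u)) / 2.

Lemma ch_gt0 u : 0 < ch u.
Proof. by rewrite divr_gt0// addr_gt0// expR_gt0. Qed.

Lemma ch2 u : ch u ^+ 2 = 1 + sh u ^+ 2.
Proof.
have := expRxMexpNx_1 u; rewrite /ch /sh; move: (expR u) (expR (- u)) => a b ab.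
have -> : ((a + b) / 2) ^+ 2 = a * b + ((a - b) / 2) ^+ 2 by field.
by rewrite ab.
Qed.

Lemma is_derive_expNR (u : R) : is_derive u (1 : R) (fun u => expR (- u)) (- expR (- u)).
Proof.
have := @is_derive1_comp R expR (fun u => - u) u _ _ (is_derive_expR _) (is_deriveNid u 1).
by rewrite mulrN1.
Qed.

Lemma is_derive_sh (u : R) : is_derive u (1 : R) sh (ch u).
Proof.
have := is_derive_mulr 2^-1 (is_deriveB (is_derive_expR u) (is_derive_expNR u)).
by rewrite opprK.
Qed.

Lemma is_derive_ch (u : R) : is_derive u (1 : R) ch (sh u).
Proof. exact: is_derive_mulr 2^-1 (is_deriveD (is_derive_expR u) (is_derive_expNR u)). Qed.

Lemma sh_surj (z : R) : exists u, sh u = z.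
Proof.
pose s := Num.sqrt (1 + z ^+ 2).
have s2 : s ^+ 2 = 1 + z ^+ 2 by rewrite sqr_sqrtr// addr_ge0// sqr_ge0.
have s0 : 0 <= s by exact: sqrtr_ge0.
have zs : 0 < z + s.
  have : `|z| < s by rewrite -(ltr_pXn2r (n := 2)) ?nnegrE// real_normK ?num_real// s2 ltrDr.
  by rewrite ltr_norml => /andP[h _]; lra.
exists (ln (z + s)); rewrite /sh expRN lnK ?posrE//.
have z0 : z + s != 0 by rewrite gt_eqF.
have -> : (z + s - (z + s)^-1) / 2 = (z ^+ 2 + 2 * z * s + s ^+ 2 - 1) / (2 * (z + s)).
  by field.
by rewrite s2; field.
Qed.

(** The Gudermannian function, a bounded primitive of [1 / ch]. *)
Definition gd (u : R) : R := atan (sh u).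

Lemma is_derive_gd (u : R) : is_derive u (1 : R) gd (ch u)^-1.
Proof.
have := @is_derive1_comp R (@atan R) sh u _ _ (is_derive1_atan (sh u)) (is_derive_sh u).
rewrite -ch2 (_ : (ch u ^+ 2)^-1 * ch u = (ch u)^-1)//.
by have := lt0r_neq0 (ch_gt0 u) => c0; field.
Qed.

Variable delta : R.
Hypothesis d02 : 0 <= delta < 2.

(** The slope [s = Y / X] of a velocity satisfies [s' = X (s^2 - delta s + 1) = X ((s - delta / 2)^2
    + k^2)], without real equilibria exactly because [delta < 2]. The constant [c] comes from
    integrating [d (ln X) / du = - (c + sh u) / ch u], where the first term yields [gd]. *)
Let k := Num.sqrt (1 - delta ^+ 2 / 4).
Let c := delta / (2 * k).

Lemma kappa_sqr : k ^+ 2 = 1 - delta ^+ 2 / 4.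
Proof.
apply: sqr_sqrtr; case/andP: d02 => d0 d2.
have : delta * delta <= 2 * 2 by apply: ler_pM => //; exact: ltW.
rewrite expr2; lra.
Qed.

Lemma kappa_gt0 : 0 < k.
Proof.
rewrite sqrtr_gt0; case/andP: d02 => d0 d2.
have : delta * delta < 2 * 2 by apply: ltr_pM.
rewrite expr2; lra.
Qed.

(** The source of completeness: [gd] is bounded by [pi / 2], so [exp (c gd u)] stays away from 0 and
    the equation for [u] is solvable for all times. *)
Let U0 : exists U : R -> R, (forall u, exists t, U t = u) /\
    forall t : R, is_derive t (1 : R) U (expR (c * gd (U t)))^-1.
Proof.
apply: (@flow_exists R (fun u => expR (c * gd u)) (expR (- (`|c| * (pi / 2))))); first exact: expR_gt0.
  move=> u; have D := is_derive_mull c (is_derive_gd u).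
  exact: is_derive_cont (@is_derive1_comp R expR (fun u => c * gd u) u _ _ (is_derive_expR _) D).
move=> u; rewrite ler_expR.
have gb : `|gd u| <= pi / 2.
  by rewrite ler_norml; apply/andP; split; apply: ltW; [exact: atan_gtNpi2|exact: atan_ltpi2].
rewrite lerNl; apply: le_trans (ler_norm _) _; rewrite normrN normrM.
by apply: ler_wpM2l.
Qed.

(* For velocities (X, Y) with X <> 0, put Y / X = delta / 2 + k sh u and theta = gd u: then
   X = K exp (- c theta) / ch u, where K is a first integral, and u' = k K exp (- c theta). *)
Lemma Cminus_complete : geodesically_complete (model (Cminus delta)).
Proof.
apply: model_completeI => p v.
have kp := kappa_gt0; have k0 : k != 0 by rewrite gt_eqF.
(* A velocity with [X = 0] has no slope; since [C_22 = 0], its geodesic is a vertical line with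
   affine parametrisation. *)
have [v0|v0] := eqVneq (v 0 0) 0.
  have cd (b t : R) : is_derive t (1 : R) (cst b) (0 : R) by exact: is_derive_cst.
  have [t i|g w] := geodesic_at_pt (G := fun=> symb (Cminus delta)) (cd (p 0 0)) (is_derive_affine (p 0 1) (v 0 1))
    (cd 0) (cd (v 0 1)).
    by case: (ord2P i) => -> /=; rewrite /mk_symbols /=; field.
  exists (fun t => pt (p 0 0) (p 0 1 + t * v 0 1)); split=> //; first by rewrite mul0r addr0 pt_eta.
  by rewrite w /= -[X in pt X _]v0 pt_eta.
have [U [Us Ud]] := U0.
have [u0 u0E] := sh_surj ((v 0 1 / v 0 0 - delta / 2) / k).
have [t0 t0E] := Us u0.
(* The value of the first integral at the initial velocity. The flow [U], started at [t0] and run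
   with speed [k K], gives the required [u]; [K] may be negative. *)
pose K := v 0 0 * ch u0 * expR (c * gd u0).
pose u (t : R) := U (t0 + t * (k * K)).
pose a (t : R) := (expR (c * gd (u t)))^-1.
have ud (t : R) : is_derive t (1 : R) u (a t * (k * K)).
  exact: (@is_derive1_comp R U (fun t => t0 + t * (k * K)) t _ _ (Ud _) (is_derive_affine _ _ _)).
have chud (t : R) : is_derive t (1 : R) (fun t => ch (u t)) (sh (u t) * (a t * (k * K))).
  exact: (@is_derive1_comp R ch u t _ _ (is_derive_ch _) (ud t)).
have shud (t : R) : is_derive t (1 : R) (fun t => sh (u t)) (ch (u t) * (a t * (k * K))).
  exact: (@is_derive1_comp R sh u t _ _ (is_derive_sh _) (ud t)).
have gud (t : R) : is_derive t (1 : R) (fun t => gd (u t)) ((ch (u t))^-1 * (a t * (k * K))).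
  exact: (@is_derive1_comp R gd u t _ _ (is_derive_gd _) (ud t)).
have lud (t : R) : is_derive t (1 : R) (fun t => ln (ch (u t))) ((ch (u t))^-1 * (sh (u t) * (a t * (k * K)))).
  exact: (@is_derive1_comp R (@ln R) (fun t => ch (u t)) t _ _ (is_derive1_ln (ch_gt0 _)) (chud t)).
have c0 t : ch (u t) != 0 by rewrite gt_eqF// ch_gt0.
have ad (t : R) : is_derive t (1 : R) a (- c * ((ch (u t))^-1 * (a t * (k * K))) * a t).
  have D := is_derive_mull (- c) (gud t).
  have aE s : a s = expR (- c * gd (u s)) by rewrite /a -expRN mulNr.
  have := @is_derive1_comp R expR (fun t => - c * gd (u t)) t _ _ (is_derive_expR _) D.
  rewrite -aE mulrC (_ : expR \o _ = a)//.
  by apply/funext => s; rewrite /= aE.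
pose X1 (t : R) := K * a t * (ch (u t))^-1.
pose X2 (t : R) := - (X1 t * (X1 t * (delta / 2 + k * sh (u t)))).
pose Y1 (t : R) := X1 t * (delta / 2 + k * sh (u t)).
pose Y2 (t : R) := X1 t * X1 t - delta * (X1 t * Y1 t).
have Xd (t : R) : is_derive t (1 : R) (fun t => p 0 0 - gd u0 / k + gd (u t) * k^-1) (X1 t).
  have := is_deriveD (is_derive_cst (p 0 0 - gd u0 / k) t (1 : R)) (is_derive_mulr k^-1 (gud t)).
  rewrite add0r (_ : (ch (u t))^-1 * (a t * (k * K)) * k^-1 = X1 t)//.
  by rewrite /X1; move: (ch _) (c0 t) (a t) => q q0 b; field; rewrite q0.
have kc : k * c = delta / 2 by rewrite /c; field.
have X1d (t : R) : is_derive t (1 : R) X1 (X2 t).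
  have := is_deriveMl (is_derive_mull K (ad t)) (@is_derive1_comp R GRing.inv (fun t => ch (u t)) t _ _ (is_derive_inv (c0 t)) (chud t)).
  rewrite [X in is_derive _ _ _ X -> _](_ : _ = X2 t)//; rewrite /X2 /X1 /= -kc.
  by move: (ch _) (c0 t) (a t) (sh _) => q q0 b s; field.
have Yd (t : R) : is_derive t (1 : R)
    (fun t => p 0 1 - (gd u0 * c + ln (ch u0)) + (gd (u t) * c + ln (ch (u t)))) (Y1 t).
  have := is_deriveD (is_derive_cst (p 0 1 - (gd u0 * c + ln (ch u0))) t (1 : R))
    (is_deriveD (is_derive_mulr c (gud t)) (lud t)).
  rewrite add0r [X in is_derive _ _ _ X -> _](_ : _ = Y1 t)//.
  by rewrite /Y1 /X1 -kc; move: (ch _) (c0 t) (a t) (sh _) => q q0 b s; field.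
have Y1d (t : R) : is_derive t (1 : R) Y1 (Y2 t).
  have gD : is_derive t (1 : R) (fun t => delta / 2 + k * sh (u t)) (k * (ch (u t) * (a t * (k * K)))).
    have := is_deriveD (is_derive_cst (delta / 2) t (1 : R)) (is_derive_mull k (shud t)).
    by rewrite add0r.
  have := is_deriveMl (X1d t) gD.
  rewrite [X in is_derive _ _ _ X -> _](_ : _ = Y2 t)// /Y2 /Y1 /X2 /=.
  have E : k * (ch (u t) * (a t * (k * K))) = k ^+ 2 * (1 + sh (u t) ^+ 2) * X1 t.
    rewrite -ch2 /X1; move: (ch _) (c0 t) (a t) => q q0 b; field.
    by rewrite q0.
  have kE := kappa_sqr; rewrite E.
  move: (X1 t) (sh (u t)) => x s.
  have -> : - (x * (x * (delta / 2 + k * s))) * (delta / 2 + k * s) + x * (k ^+ 2 * (1 + s ^+ 2) * x) =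
    x * x * (k ^+ 2 - delta ^+ 2 / 4 - delta * k * s) by field.
  by rewrite kE; field.
have [t i|g w] := geodesic_at_pt (G := fun=> symb (Cminus delta)) Xd Yd X1d Y1d.
  by case: (ord2P i) => -> /=; rewrite /mk_symbols /X2 /Y2 /Y1 /=; move: (X1 t) (sh _) => x s; field.
have u00 : u 0 = u0 by rewrite /u mul0r addr0.
have x10 : X1 0 = v 0 0.
  rewrite /X1 /K /a u00.
  have e0 := lt0r_neq0 (expR_gt0 (c * gd u0)); have q0 := lt0r_neq0 (ch_gt0 u0).
  by field; rewrite q0.
exists (fun t => pt (p 0 0 - gd u0 / k + gd (u t) * k^-1)
   (p 0 1 - (gd u0 * c + ln (ch u0)) + (gd (u t) * c + ln (ch (u t))))); split=> //.
  by rewrite u00 !subrK pt_eta.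
rewrite w /Y1 x10 u00 u0E.
have -> : v 0 0 * (delta / 2 + k * ((v 0 1 / v 0 0 - delta / 2) / k)) = v 0 1 by field; rewrite k0.
by rewrite pt_eta.
Qed.

End CminusComplete.

(** * Normal forms *)

Section NormalForm.
Variable R : realType.
Implicit Types C : typeA R.

(** The rows of [T] are [b0] and [b1], so [x *m T] sends the coordinate vectors to this basis; hence
    the map goes from [C'], the structure constants in the basis, to [C]. *)
Lemma linear_iso_of_basis C C' (b0 b1 : plane R) : b0 0 0 * b1 0 1 - b0 0 1 * b1 0 0 != 0 ->
  cprod (symb C) b0 b0 = symb C' 0 0 0 *: b0 + symb C' 0 0 1 *: b1 ->
  cprod (symb C) b0 b1 = symb C' 0 1 0 *: b0 + symb C' 0 1 1 *: b1 ->
  cprod (symb C) b1 b1 = symb C' 1 1 0 *: b0 + symb C' 1 1 1 *: b1 ->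
  exists2 T : 'M[R]_2, \det T = b0 0 0 * b1 0 1 - b0 0 1 * b1 0 0 &
    affine_map setT (fun=> symb C') (fun=> symb C) (fun x => x *m T).
Proof.
move=> d0 E00 E01 E11.
pose T : 'M[R]_2 := \matrix_(i, j) (if i == 0 then b0 0 j else b1 0 j).
exists T; first by rewrite det_mx22 !mxE.
apply/linear_affineP => i j k.
have Cs := symb_sym C; have C's := symb_sym C'.
have := congr1 (fun x : plane R => x 0 k) E00.
have := congr1 (fun x : plane R => x 0 k) E01.
have := congr1 (fun x : plane R => x 0 k) E11.
rewrite /= !cprodE !sum2 !mxE.
move: (symb C) (symb C') Cs C's => c c' cs c's.
case: (ord2P i) => ->; case: (ord2P j) => -> /= e11 e01 e00.
- by rewrite -e00; ring.
- by rewrite -e01; ring.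
- by rewrite !(c's 1 0) -e01 !(cs 1 0); ring.
- by rewrite -e11; ring.
Qed.

Lemma linear_iso_inv C C' (T : 'M[R]_2) : T \in unitmx ->
  affine_map setT (fun=> symb C) (fun=> symb C') (fun x => x *m T) ->
  affine_map setT (fun=> symb C') (fun=> symb C) (fun x => x *m invmx T).
Proof.
move=> Tu /linear_affineP/linear_cprodP TI; apply/linear_affineP/linear_cprodP => u v.
by rewrite -[LHS](mulmxK Tu) -TI !mulmxKV.
Qed.

Lemma rhodet_pull U C C' F x : open U ->
  affine_map U (fun=> symb C) (fun=> symb C') F -> U x -> jacdet F x != 0 ->
  rhodet C = jacdet F x ^+ 2 * rhodet C'.
Proof.
move=> Uo FA Ux d0; have E i j := rho_pull i j Uo FA Ux d0.
rewrite /rhodet (E 0 0) (E 0 1) (E 1 1) /jacdet.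
move: (jac F x) (rho (symb C')) (rho_sym C' 1 0) => P r rs.
by rewrite !sum2 rs; ring.
Qed.

Lemma linear_jac (T : 'M[R]_2) x i k : jac (fun x => x *m T) x i k = T i k.
Proof. by have [_] := linear_derive T x i k. Qed.

Lemma rhodet_pqrs (p q r s : R) : rhodet (mk_typeA p q r s 0 0) = - r ^+ 2 * (p * s - q * r).
Proof. by rewrite /rhodet /rho /= /curv01 !sum2 /mk_symbols /=; ring. Qed.

(* The cubic form [det (v, C(v, v))] changes sign between [v] and [- v]. *)
Lemma parallel_exists C : exists2 v : plane R, v != 0 & exists l, cprod (symb C) v v = l *: v.
Proof.
pose v (t : R) := pt (cos t) (sin t).
pose phi t := cos t * cprod (symb C) (v t) (v t) 0 1 - sin t * cprod (symb C) (v t) (v t) 0 0.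
have cc (t : R) : {for t, continuous (@cos R)} by exact: continuous_cos.
have cs (t : R) : {for t, continuous (@sin R)} by exact: continuous_sin.
have cM (t a : R) (f g : R -> R) : {for t, continuous f} -> {for t, continuous g} ->
   {for t, continuous (fun t => f t * g t * a)}.
  by move=> fc gc; apply: continuousM; [exact: continuousM|exact: cst_continuous].
have cq k t : {for t, continuous (fun t => cprod (symb C) (v t) (v t) 0 k)}.
  rewrite (_ : (fun t => _) = fun t => cos t * cos t * symb C 0 0 k + cos t * sin t * symb C 0 1 k +
    (sin t * cos t * symb C 1 0 k + sin t * sin t * symb C 1 1 k)); last first.
    by apply/funext => s; rewrite cprodE /v pt0 pt1.
  by do ![apply: continuousD]; exact: cM.
have phic : {within `[0, pi], continuous phi}.
  apply: continuous_subspaceT => t.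
  exact: (continuousB (continuousM (cc t) (cq 1 t)) (continuousM (cs t) (cq 0 t))).
have phipi : phi pi = - phi 0.
  by rewrite /phi !cprodE /v !pt0 !pt1 cospi sinpi cos0 sin0; ring.
have [|t _ t0] := @IVT R phi 0 pi 0 (pi_ge0 R) phic.
  rewrite phipi ge_min le_max oppr_le0 oppr_ge0.
  by case: (leP (phi 0) 0) => [|/ltW] h; rewrite ?h ?orbT.
have v0 : v t != 0.
  apply/eqP => E; have := cos2Dsin2 t.
  have := congr1 (fun x : plane R => x 0 0) E; have := congr1 (fun x : plane R => x 0 1) E.
  rewrite /= /v pt0 pt1 !mxE => -> ->; rewrite expr0n addr0 => /eqP.
  by rewrite eq_sym oner_eq0.
exists (v t) => //; set w := cprod _ _ _ in t0 *.
exists (cos t * w 0 0 + sin t * w 0 1).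
move: t0; rewrite /phi -/w => /eqP; rewrite subr_eq0 => /eqP E.
apply: planeP; rewrite [RHS]mxE /v ?pt0 ?pt1.
  have -> : (cos t * w 0 0 + sin t * w 0 1) * cos t = cos t ^+ 2 * w 0 0 + sin t * (cos t * w 0 1) by ring.
  by rewrite E mulrA -expr2 -mulrDl cos2Dsin2 mul1r.
have -> : (cos t * w 0 0 + sin t * w 0 1) * sin t = cos t * (sin t * w 0 0) + sin t ^+ 2 * w 0 1 by ring.
by rewrite -E mulrA -expr2 -mulrDl cos2Dsin2 mul1r.
Qed.

Lemma idempotent_of_parallel C (v : plane R) l : v != 0 -> l != 0 -> cprod (symb C) v v = l *: v ->
  exists2 u, u != 0 & cprod (symb C) u u = u.
Proof.
move=> v0 l0 E; exists (l^-1 *: v); first by rewrite scaler_eq0 invr_eq0 (negPf l0).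
apply/rowP => k; have := congr1 (fun x : plane R => x 0 k) E.
rewrite /= cprodE [X in _ = X -> _]mxE => Ek; rewrite cprodE !mxE.
have -> : l^-1 * v 0 k = l^-1 * l^-1 * (l * v 0 k) by field.
by rewrite -Ek; ring.
Qed.

(* Without idempotents there are [v <> 0] with [C(v, v) = 0] and, completing it by [n],
   [C(n, n) = p n + q v] and [C(n, v) = r n + s v] where the quadratic equation for the other
   lines [w] with [C(w, w)] parallel to [w] has no root, that is [(p - 2 s)^2 + 8 q r < 0]. *)
Lemma rank2_dichotomy C : rhodet C != 0 ->
  (exists2 v : plane R, v != 0 & cprod (symb C) v v = v) \/
  (exists2 delta : R, 0 <= delta < 2 & linearly_isomorphic C (Cminus delta)).
Proof.
move=> r0; have [|noid] := pselect (exists2 v : plane R, v != 0 & cprod (symb C) v v = v); first by left.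
right; have [v v0 [l vl]] := parallel_exists C.
have l0 : l = 0.
  apply/eqP; apply: contraT => l0; case: noid; exact: idempotent_of_parallel vl.
move: vl; rewrite l0 scale0r => vv.
pose n := pt (v 0 1) (- v 0 0).
pose N := v 0 0 ^+ 2 + v 0 1 ^+ 2.
have N0 : N != 0.
  rewrite /N paddr_eq0 ?sqr_ge0// !sqrf_eq0; apply: contra_neqN v0 => /andP[/eqP a /eqP b].
  by apply: planeP; rewrite mxE.
have decomp (x : plane R) : exists a b, x = a *: n + b *: v.
  exists ((x 0 0 * v 0 1 - x 0 1 * v 0 0) / N), ((x 0 0 * v 0 0 + x 0 1 * v 0 1) / N).
  by have N0' := N0; rewrite /N in N0'; apply: planeP; rewrite !mxE /= /N; field.
have [p [q nn]] := decomp (cprod (symb C) n n).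
have [r [s nv]] := decomp (cprod (symb C) n v).
have bil a b : cprod (symb C) (a *: n + b *: v) (a *: n + b *: v) =
   (a ^+ 2) *: (p *: n + q *: v) + (2 * a * b) *: (r *: n + s *: v).
  rewrite -nn -nv; apply/rowP => k; have := congr1 (fun x : plane R => x 0 k) vv.
  rewrite /= [X in _ = X -> _]mxE => vvk.
  transitivity (a ^+ 2 * cprod (symb C) n n 0 k + 2 * a * b * cprod (symb C) n v 0 k +
     b ^+ 2 * cprod (symb C) v v 0 k); last by rewrite vvk mulr0 addr0 !mxE.
  have Cs := symb_sym C; rewrite !cprodE !(Cs 1 0) !mxE /=.
  by move: (symb C) => c; ring.
have bil2 a b g : cprod (symb C) (a *: n + b *: v) (g *: v) = (a * g) *: (r *: n + s *: v).
  rewrite -nv; apply/rowP => k; have := congr1 (fun x : plane R => x 0 k) vv.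
  rewrite /= [X in _ = X -> _]mxE => vvk.
  transitivity (a * g * cprod (symb C) n v 0 k + b * g * cprod (symb C) v v 0 k);
    last by rewrite vvk mulr0 addr0 !mxE.
  have Cs := symb_sym C; rewrite !cprodE !(Cs 1 0) !mxE /=.
  by move: (symb C) => c; ring.
have dnv : n 0 0 * v 0 1 - n 0 1 * v 0 0 = N by rewrite pt0 pt1 /N; ring.
(* In the basis [n], [v] the determinant of the Ricci form is [- r^2 (p s - q r)], and nondegeneracy
   is independent of the basis. *)
have rps : r != 0 /\ p * s - q * r != 0.
  have [||T dT TA] := @linear_iso_of_basis C (mk_typeA p q r s 0 0) n v _ nn nv.
  - by rewrite dnv.
  - by rewrite vv /= /mk_symbols /= !scale0r addr0.
  have jd x : jacdet (fun x => x *m T) x = N.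
    by rewrite /jacdet !linear_jac -dnv -dT det_mx22.
  have j0 : jacdet (fun x => x *m T) 0 != 0 by rewrite jd.
  have := rhodet_pull openT TA (x := 0) Logic.I j0.
  rewrite rhodet_pqrs jd => E.
  have : N ^+ 2 * rhodet C != 0 by rewrite mulf_neq0// expf_neq0.
  by rewrite -E mulf_eq0 oppr_eq0 sqrf_eq0 negb_or => /andP.
have [rn0 psqr0] := rps.
have disc : (p - 2 * s) ^+ 2 + 8 * r * q < 0.
  rewrite ltNge; apply/negP => d0.
  (* A root [y] makes [C(w, w)] a multiple of [w = n + y v]. A nonzero factor rescales [w] to an
     idempotent; a zero factor together with the root equation gives [p s = q r]. Both are
     excluded. *)
  pose y := (- (p - 2 * s) + Num.sqrt ((p - 2 * s) ^+ 2 + 8 * r * q)) / (4 * r).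
  have yE : 2 * r * y ^+ 2 + (p - 2 * s) * y - q = 0.
    have := sqr_sqrtr d0; rewrite /y; move: (Num.sqrt _) => z zE.
    have -> : 2 * r * ((- (p - 2 * s) + z) / (4 * r)) ^+ 2 +
      (p - 2 * s) * ((- (p - 2 * s) + z) / (4 * r)) - q =
      (z ^+ 2 - ((p - 2 * s) ^+ 2 + 8 * r * q)) / (8 * r) by field.
    by rewrite zE subrr mul0r.
  have w0 : 1 *: n + y *: v != 0.
    apply/eqP => E; case/eqP: N0; rewrite -dnv.
    have E0 := congr1 (fun x : plane R => x 0 0) E; have E1 := congr1 (fun x : plane R => x 0 1) E.
    move: E0 E1; rewrite /= !mxE /= !mul1r => E0 E1.
    transitivity ((v 0 1 + y * v 0 0) * v 0 1 - (- v 0 0 + y * v 0 1) * v 0 0); first by ring.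
    by rewrite E0 E1 !mul0r subrr.
  have wE : cprod (symb C) (1 *: n + y *: v) (1 *: n + y *: v) = (p + 2 * r * y) *: (1 *: n + y *: v).
    rewrite bil; apply/rowP => k; rewrite !mxE.
    have -> : 1 ^+ 2 * (p * (if k == 0 then v 0 1 else - v 0 0) + q * v 0 k) +
      2 * 1 * y * (r * (if k == 0 then v 0 1 else - v 0 0) + s * v 0 k) =
      (p + 2 * r * y) * (1 * (if k == 0 then v 0 1 else - v 0 0) + y * v 0 k) -
      (2 * r * y ^+ 2 + (p - 2 * s) * y - q) * v 0 k by ring.
    by rewrite yE mul0r subr0.
  have [l1|l1] := eqVneq (p + 2 * r * y) 0; last first.
    by case: noid; exact: idempotent_of_parallel l1 wE.
  case/eqP: psqr0.
  have -> : p * s - q * r = (p + 2 * r * y) * (s - r * y) +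
    r * (2 * r * y ^+ 2 + (p - 2 * s) * y - q) by ring.
  by rewrite l1 yE mul0r mulr0 addr0.
(* The discriminant equals [(p + 2 s)^2 - 8 (p s - q r)]. Its negativity gives positivity here, and
   below the bound [delta < 2]. *)
have pos : 0 < 2 * (p * s - q * r).
  by have := sqr_ge0 (p + 2 * s); nra.
pose m := Num.sqrt (2 * (p * s - q * r)).
have m0 : 0 < m by rewrite sqrtr_gt0.
have m2 : m ^+ 2 = 2 * (p * s - q * r) by rewrite sqr_sqrtr// ltW.
(* The size of [a] normalises [C_11^2] to [-1]; its sign is free and is chosen to make [delta]
   nonnegative. *)
pose a := (if 0 <= 2 * s + p then 1 else -1) / m.
pose delta := a * (2 * s + p).
have a2 : a ^+ 2 * (2 * (p * s - q * r)) = 1.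
  rewrite -m2 /a; have mn0 := lt0r_neq0 m0.
  by case: ifP => _; field.
have d0 : 0 <= delta.
  rewrite /delta /a; case: ifPn => [h|]; first by rewrite mulr_ge0// divr_ge0// ltW.
  rewrite -ltNge => h; apply: mulr_le0; last exact: ltW.
  by rewrite mulN1r oppr_le0 invr_ge0 ltW.
have d2 : delta < 2.
  have -> : (2 : R) = Num.sqrt (2 ^+ 2) by rewrite sqrtr_sqr ger0_norm.
  rewrite -[delta]ger0_norm// -sqrtr_sqr ltr_sqrt ?exprn_gt0//.
  have -> : delta ^+ 2 = a ^+ 2 * (2 * s + p) ^+ 2 by rewrite /delta; ring.
  have an0 : 0 < a ^+ 2.
    by rewrite lt_def sqr_ge0 andbT; apply/eqP => z; move: a2; rewrite z mul0r => /eqP; rewrite eq_sym oner_eq0.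
  have -> : (2 : R) ^+ 2 = a ^+ 2 * (8 * (p * s - q * r)).
    have -> : a ^+ 2 * (8 * (p * s - q * r)) = 4 * (a ^+ 2 * (2 * (p * s - q * r))) by ring.
    by rewrite a2; ring.
  by rewrite ltr_pM2l//; nra.
exists delta; first by rewrite d0.
(* In the basis [a n + b v], [g v], the value of [g] gives [C_12^1 = 1/2], and [b] removes [C_11^1],
   that is [a^2 p + 2 a b r = 0]. *)
pose g := (2 * r)^-1.
pose b := - (a * p * g).
have g0 : g != 0 by rewrite /g invr_neq0// mulf_neq0// pnatr_eq0.
have a0 : a != 0.
  by apply/eqP => z; move: a2; rewrite z expr0n mul0r => /eqP; rewrite eq_sym oner_eq0.
have [||||T dT TA] := @linear_iso_of_basis C (Cminus delta) (a *: n + b *: v) (g *: v).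
- rewrite !mxE /=.
  have -> : (a * v 0 1 + b * v 0 0) * (g * v 0 1) - (a * - v 0 0 + b * v 0 1) * (g * v 0 0) = a * g * N.
    by rewrite /N; ring.
  by rewrite mulf_neq0// mulf_neq0.
- rewrite bil /= /mk_symbols /= scale0r add0r scaleN1r.
  apply/rowP => k; rewrite !mxE.
  have -> : a ^+ 2 * (p * (if k == 0 then v 0 1 else - v 0 0) + q * v 0 k) +
     2 * a * b * (r * (if k == 0 then v 0 1 else - v 0 0) + s * v 0 k) =
     - (a ^+ 2 * (2 * (p * s - q * r))) * (g * v 0 k).
    by rewrite /b /g; move: (if _ then _ else _) => z; field.
  by rewrite a2 mulN1r.
- rewrite bil2 /= /mk_symbols /=; apply/rowP => k; rewrite !mxE /delta /b /g.
  by move: (if _ then _ else _) => z; field.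
- rewrite -[g *: v]add0r -(scale0r n) bil /= /mk_symbols /=.
  by rewrite expr0n mulr0 mul0r !scale0r !add0r.
have Tu : T \in unitmx.
  rewrite unitmxE unitfE dT !mxE /=.
  have -> : (a * v 0 1 + b * v 0 0) * (g * v 0 1) - (a * - v 0 0 + b * v 0 1) * (g * v 0 0) = a * g * N.
    by rewrite /N; ring.
  by rewrite mulf_neq0// mulf_neq0.
by exists (invmx T); [rewrite unitmx_inv|exact: linear_iso_inv].
Qed.

End NormalForm.

(** * Models that are not locally isomorphic *)

Section Distinct.
Variable R : realType.
Implicit Types C : typeA R.

Lemma local_iso_affine C C' : locally_isomorphic (model C) (model C') ->
  exists (U : set (plane R)) F x, [/\ open U, U x,
    affine_map U (fun=> symb C) (fun=> symb C') F & forall x, U x -> jacdet F x != 0].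
Proof.
move=> [U [V [f [g [[Uo Vo] [x Ux] fg gf [fA gA]]]]]].
have affine_of D D' (W : set (plane R)) (h : plane R -> plane R) :
    affine_on (M := model D) (N := model D') W h ->
    affine_map W (fun=> symb D) (fun=> symb D') h.
  move=> [_ /(_ _ _ erefl erefl) H].
  by apply: affine_map_sub H => y Wy; split.
have fU := affine_of _ _ _ _ fA; have gV := affine_of _ _ _ _ gA.
exists U, f, x; split=> //.
exact: (jacdet_neq0 Uo Vo fU.1 gV.1).
Qed.

Lemma rho11_C2 : (rho (symb (C2 R)) 1 1 = - 4^-1) * (rhodet (C2 R) = 0).
Proof.
by split; rewrite /rhodet /rho /= /curv01 !sum2 /mk_symbols /=; field.
Qed.

Lemma rho_C3 : (rho (symb (C3 R)) 0 0 = 0) * (rho (symb (C3 R)) 0 1 = 0) * (rho (symb (C3 R)) 1 1 = 1).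
Proof.
by repeat split; rewrite /rho /= /curv01 !sum2 /mk_symbols /=; field.
Qed.

Lemma rho_C2 : (rho (symb (C2 R)) 0 0 = 0) * (rho (symb (C2 R)) 0 1 = 0).
Proof.
by split; rewrite /rho /= /curv01 !sum2 /mk_symbols /=; field.
Qed.

Lemma rhodet_Cminus delta : rhodet (Cminus delta : typeA R) = - 8^-1.
Proof. by rewrite /Cminus rhodet_pqrs; field. Qed.

(** The second basis vector squares to zero, so its image does too, which forces [u = 0]. The
    remaining equations fix [v = 1], [y = 0] and [x = 1] or [x = -1] with [d = d' x]; the sign is
    settled by nonnegativity. *)
Lemma Cminus_rigid (d d' : R) (T : 'I_2 -> 'I_2 -> R) : 0 <= d -> 0 <= d' ->
  T 0 0 * T 1 1 - T 0 1 * T 1 0 != 0 ->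
  (forall i j k, \sum_a \sum_b T i a * T j b * symb (Cminus d') a b k =
     \sum_l symb (Cminus d) i j l * T l k) -> d = d'.
Proof.
move=> d0 d'0 det H.
have := H 1 1 1; have := H 0 1 0; have := H 0 1 1; have := H 0 0 0; have := H 0 0 1; have := H 1 1 0.
rewrite !sum2 /= /mk_symbols /=.
move: (T 0 0) (T 0 1) (T 1 0) (T 1 1) det => x y u v det h110 h001 h000 h011 h010 h111.
have uv : u * v = 0 by move: h110; lra.
have u0 : u = 0.
  have : u ^+ 2 = d' * (u * v) by move: h111; rewrite expr2; lra.
  by rewrite uv mulr0 => /eqP; rewrite sqrf_eq0 => /eqP.
subst u; move: det; rewrite mulr0 subr0 mulf_eq0 negb_or => /andP[x0 v0].
have v1 : v = 1.
  by apply: (mulfI x0); move: h010; lra.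
subst v.
have y0 : y = 0 by apply: (mulfI x0); move: h000; lra.
subst y.
have x2 : x * x = 1 by move: h001; lra.
have dx : d = d' * x by move: h011; lra.
apply/eqP; rewrite -(eqrXn2 (n := 2))//; apply/eqP.
have -> : d ^+ 2 = d' ^+ 2 * (x * x) by rewrite dx; ring.
by rewrite x2 mulr1.
Qed.

(** The Ricci tensor does most of the work: its determinant separates [Cminus] from [C2] and [C3],
    and its sign separates [C2], where [rho_11 = - 1/4], from [C3], where [rho_11 = 1]. Within the
    family [Cminus], the Jacobian is an isomorphism of algebras and [Cminus_rigid] applies. *)
Lemma family_rigid C C' : model_family C -> model_family C' -> C <> C' ->
  ~ locally_isomorphic (model C) (model C').
Proof.
move=> CF C'F CC' /local_iso_affine[U [F [x [Uo Ux FA d0]]]].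
have det := rhodet_pull Uo FA Ux (d0 x Ux).
have r11 := rho_pull 1 1 Uo FA Ux (d0 x Ux).
have D3 : rhodet (C3 R) = 0 by rewrite /rhodet !rho_C3 mul0r expr0n subrr.
have n8 : (- 8^-1 : R) != 0 by rewrite oppr_eq0 invr_eq0 pnatr_eq0.
have j2 : jacdet F x ^+ 2 != 0 by rewrite expf_neq0// d0.
case: CF C'F => [E|E|[d d02 E]]; case=> [E'|E'|[d' d'02 E']]; subst C C'; try by case: CC'.
- move: r11; rewrite !sum2 (rho_sym (C3 R) 1 0) !rho_C3 rho11_C2 !mulr0 !add0r mulr1 -expr2 => H.
  have := sqr_ge0 (jac F x 1 1); rewrite -H; lra.
- by move: det; rewrite rho11_C2 rhodet_Cminus => /esym/eqP; rewrite mulf_eq0 (negPf j2) (negPf n8).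
- move: r11; rewrite !sum2 (rho_sym (C2 R) 1 0) !rho_C2 rho_C3 rho11_C2 !mulr0 !add0r -expr2 => H.
  have := sqr_ge0 (jac F x 1 1); move: H; set s := _ ^+ 2; lra.
- by move: det; rewrite D3 rhodet_Cminus => /esym/eqP; rewrite mulf_eq0 (negPf j2) (negPf n8).
- by move: det; rewrite rho11_C2 rhodet_Cminus mulr0 => /eqP; rewrite (negPf n8).
- by move: det; rewrite D3 rhodet_Cminus mulr0 => /eqP; rewrite (negPf n8).
apply: CC'; congr Cminus.
have r' : rhodet (Cminus d' : typeA R) != 0 by rewrite rhodet_Cminus.
case/andP: d02 => d0' _; case/andP: d'02 => d'0 _.
exact: (Cminus_rigid d0' d'0 (d0 x Ux) (rank2_intertwine Uo FA d0 r' Ux)).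
Qed.

End Distinct.

Theorem theorem1p5 (R : realType) :
  [/\
      [/\ (forall C : typeA R, ricci_rank C 1 ->
             nabla_R_neq0 C -> essentially_incomplete C),
          geodesically_complete (model (C2 R)),
          geodesically_incomplete (model (C1 R)) /\
            essentially_complete (C1 R)
        & [/\ geodesically_incomplete (model (C3 R)),
              modeled_on (tildeM3 R) (C3 R),
              geodesically_complete (tildeM3 R)
            & essentially_complete (C3 R)]],
      (forall C : typeA R, ricci_rank C 2 ->
         [<-> geodesically_incomplete (model C);
              essentially_incomplete C;
              exists a b : R, (a, b) <> (0, 0) /\
                geodesic (M := model C) [set t | 0 < t]
                  (fun t => \row_k (if k == 0 then a * ln t else b * ln t));
              forall delta : R, 0 <= delta < 2 ->
                ~ linearly_isomorphic C (Cminus delta)])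
    & forall C C' : typeA R, model_family C -> model_family C' ->
        C <> C' -> ~ locally_isomorphic (model C) (model C')].
Proof.
have e0 : pt (-1) 0 != 0 :> plane R.
  apply/eqP => /(congr1 (fun x : plane R => x 0 0))/eqP.
  by rewrite pt0 mxE oppr_eq0 oner_eq0.
(* The first coordinate vector squares to its opposite in [C1] and [C3], so its opposite is an
   idempotent. *)
have log13 (C : typeA R) : symb C 0 0 0 = -1 -> symb C 0 0 1 = 0 -> geodesically_incomplete (model C).
  move=> c0 c1; apply: (@log_incomplete _ C (pt (-1) 0)) => //; apply/rowP => k.
  by rewrite cprodE !pt0 !pt1; case: (ord2P k) => ->; rewrite ?pt0 ?pt1 ?c0 ?c1; ring.
split; last exact: family_rigid.
  split.
  - exact: rank1_incomplete.
  - exact: C2_complete.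
  - split; first exact: log13.
    by exists (model (C2 R)); [exact: model2_modeled_on_C1|exact: C2_complete].
  - split; [exact: log13|exact: tildeM3_modeled_on_C3|exact: tildeM3_complete|].
    by exists (tildeM3 R); [exact: tildeM3_modeled_on_C3|exact: tildeM3_complete].
move=> C /ricci_rank2 r0.
have rowE a b : (fun t : R => \row_k (if k == 0 then a * ln t else b * ln t)) =
    (fun t => ln t *: pt a b) :> (R -> plane R).
  by apply/funext => t; apply/rowP => k; rewrite !mxE; case: ifP => _; rewrite mulrC.
have pos_itv : is_interval [set t : R | 0 < t].
  by move=> a b /= a0 b0 z /andP[az _]; exact: lt_le_trans az.
have isoP : (exists2 delta, 0 <= delta < 2 & linearly_isomorphic C (Cminus delta)) ->
    geodesically_complete (model C).
  by move=> [d d02 iso]; apply: (linear_iso_complete iso); exact: Cminus_complete.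
have incP v : v != 0 -> cprod (symb C) v v = v -> geodesically_incomplete (model C).
  by move=> v0 vv; exact: log_incomplete vv.
have logP v : v != 0 -> cprod (symb C) v v = v -> exists a b : R, (a, b) <> (0, 0) /\
    geodesic (M := model C) [set t | 0 < t]
      (fun t => \row_k (if k == 0 then a * ln t else b * ln t)).
  move=> v0 vv; exists (v 0 0), (v 0 1); split.
    by case=> a b; case/eqP: v0; apply: planeP; rewrite mxE.
  rewrite rowE pt_eta; apply/plane_geodesicP; split=> //.
  by move=> t; exact: log_geodesic_at.
tfae.
- move=> inc; have [[v v0 vv]|/isoP//] := rank2_dichotomy r0.
  exact: rank2_incomplete vv.
- move=> einc; have [[v v0 vv]|/isoP comp] := rank2_dichotomy r0; first exact: logP vv.
  by case: einc; exists (model C) => //; exact: modeled_on_self.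
(* A logarithmic geodesic yields an idempotent and so incompleteness, whereas an isomorphism with
   some [Cminus d] would transport completeness. *)
- move=> [a [b [ab]]]; rewrite rowE => /plane_geodesicP[_ _ /(_ 1 ltr01) g] d d02 iso.
  apply: (incP (pt a b)); last by apply: isoP; exists d.
    apply/eqP => E; apply: ab; congr pair.
      by have := congr1 (fun x : plane R => x 0 0) E; rewrite /= pt0 mxE.
    by have := congr1 (fun x : plane R => x 0 1) E; rewrite /= pt1 mxE.
  exact: idempotent_of_log_geodesic g.
move=> niso; have [[v v0 vv]|[d d02 iso]] := rank2_dichotomy r0; first exact: incP vv.
by case: (niso d d02).
Qed.
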